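(* Let $inv:\mathrm{PSH}_0\to[-\infty,+\infty]$ be a singularity invariant of plurisubharmonic functions. Let $X$ and $Y$ be complex spaces such that there exists a biholomorphic map $f:X\to Y$. Then for every $x\in X$, $$inv ( X, x ) = inv ( Y, f ( x ) ).$$
   Context: A complex space is a topological space equipped with an atlas of charts, each isomorphic to an analytic subset of a complex Euclidean space, with transition maps holomorphic in the sense of holomorphic mappings between analytic sets. Two plurisubharmonic functions $\varphi,\psi$ defined near $0\in\mathbb C^N$ are singularity equivalent at $0$ if $\sup_U|\varphi-\psi|<+\infty$ for some neighborhood $U$ of $0$; $\mathrm{PSH}_0$ is the set of equivalence classes of plurisubharmonic functions near $0$. A function $inv:\mathrm{PSH}_0\to[-\infty,+\infty]$ is a singularity invariant if $inv(\varphi\circ H)=inv(\varphi)$ for every biholomorphic germ $H:(\mathbb C^N,0)\to(\mathbb C^N,0)$ (in each dimension $N$). For an ideal $\mathcal I\subset\mathcal O_{\mathbb C^N,0}$ generated by $f_1,\dots,f_m$, $\varphi_{\mathcal I}=\frac12\log\sum_{j=1}^m|f_j|^2$ (with $\log 0=-\infty$), whose class in $\mathrm{PSH}_0$ does not depend on the generators. For a complex space $X$ and $x\in X$, let $\mathcal O_{X,x}$ be the ring of germs of holomorphic functions at $x$, $\mathfrak m_{X,x}=\{f\in\mathcal O_{X,x}:f(x)=0\}$, and $N(X,x)=\dim_{\mathbb C}(\mathfrak m_{X,x}/\mathfrak m_{X,x}^2)$ the embedding dimension, which is the smallest $N$ such that the germ $(X,x)$ embeds in $\mathbb C^N$. Choose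 a neighborhood $A$ of $x$ in $X$ such that $(A,x)$ is biholomorphic to $(B,0)$ with $B$ an analytic subset of a domain $\Omega\subset\mathbb C^{N(X,x)}$, let $\mathcal I(B,\Omega)_0$ be the ideal of germs of holomorphic functions at $0\in\Omega$ vanishing on $B$, and define $$inv(X,x):=inv(\varphi_{\mathcal I(B,\Omega)_0}).$$ This number depends only on $(X,x)$, not on the choice of $(B,\Omega)$. *)

(* Defs.v *)
(* MathComp / MathComp-Analysis.  The complex numbers are R[i] for R : realType. *)
From HB Require Import structures.
From mathcomp Require Import all_boot all_order all_algebra.
From mathcomp Require Import complex.
From mathcomp Require Import all_classical all_reals all_analysis.

Set Implicit Arguments.
Unset Strict Implicit.
Unset Printing Implicit Defensive.

Import Order.TTheory GRing.Theory Num.Theory.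
Import numFieldNormedType.Exports.

Local Open Scope classical_set_scope.
Local Open Scope complex_scope.
Local Open Scope ring_scope.

(* Num.NumField.sort (Cplx R) carries the topology and the normed structure that
   the library puts on every numFieldType; R[i] itself does not. *)
Definition Cplx (R : realType) : numFieldType := R[i].

Section Holomorphic.
Context {R : realType}.

(* [differentiable] is over the scalar field Cplx R, hence complex Frechet
   differentiability. *)
Definition holomorphic_near (V W : normedModType (Cplx R)) (p : V) (F : V -> W) : Prop :=
  \forall z \near p, differentiable F z.

(* Holomorphic mappings on an analytic set S: locally restrictions of
   holomorphic mappings of the ambient space. *)
Definition holomorphic_on (V W : normedModType (Cplx R)) (S : set V) (g : V -> W) : Prop :=
  forall p, S p -> exists F : V -> W,
    holomorphic_near p F /\ \forall z \near p, S z -> g z = F z.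

Definition analytic_subset (n : nat) (Omega B : set 'rV[Cplx R]_n) : Prop :=
  B `<=` Omega /\
  forall p, Omega p -> exists (m : nat) (F : 'rV[Cplx R]_n -> 'rV[Cplx R]_m),
    holomorphic_near p F /\ \forall z \near p, B z <-> F z = 0.

(* psi \o phi^-1 is a well-defined holomorphic mapping on phi(D). *)
Definition holomorphic_through (T : Type) (V W : normedModType (Cplx R)) (D : set T)
    (phi : T -> V) (psi : T -> W) : Prop :=
  exists g : V -> W,
    holomorphic_on (phi @` D) g /\ forall y, D y -> g (phi y) = psi y.

(* Biholomorphic germs (C^N, 0) -> (C^N, 0). *)
Definition biholomorphic_germ (N : nat) (H : 'rV[Cplx R]_N -> 'rV[Cplx R]_N) : Prop :=
  H 0 = 0 /\ holomorphic_near 0 H /\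
  exists G : 'rV[Cplx R]_N -> 'rV[Cplx R]_N,
    [/\ G 0 = 0, holomorphic_near 0 G,
        (\forall z \near (0 : 'rV[Cplx R]_N), G (H z) = z) &
        (\forall z \near (0 : 'rV[Cplx R]_N), H (G z) = z)].

End Holomorphic.

Section ComplexSpaces.
Context {R : realType}.

Record chart (X : topologicalType) := Chart {
  chart_dim : nat;
  chart_dom : set X;
  chart_ambient : set 'rV[Cplx R]_chart_dim;
  chart_img : set 'rV[Cplx R]_chart_dim;
  chart_map :> X -> 'rV[Cplx R]_chart_dim;
  chart_dom_open : open chart_dom;
  chart_ambient_open : open chart_ambient;
  chart_img_analytic : analytic_subset chart_ambient chart_img;
  chart_bij : set_bij chart_dom chart_img chart_map;
  chart_continuous : {within chart_dom, continuous chart_map};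
  (* continuity of the inverse for the subspace topology of chart_img *)
  chart_inv_continuous : forall y, chart_dom y -> forall V, nbhs y V ->
    within chart_img (nbhs (chart_map y)) (chart_map @` (V `&` chart_dom)) }.

Definition compatible (X : topologicalType) (c d : chart X) : Prop :=
  holomorphic_through (chart_dom c `&` chart_dom d) c d /\
  holomorphic_through (chart_dom c `&` chart_dom d) d c.

End ComplexSpaces.

Arguments chart R X : clear implicits.
Arguments chart_ambient {R X} c _ : rename.
Arguments chart_img {R X} c _ : rename.

Record complex_space (R : realType) := ComplexSpace {
  space_carrier :> topologicalType;
  atlas : set (chart R space_carrier);
  atlas_cover : forall x : space_carrier, exists2 c, atlas c & chart_dom c x;
  atlas_compatible : forall c d, atlas c -> atlas d -> compatible c d }.

Arguments atlas {R} c _ : rename.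

Section Maps.
Context {R : realType}.

Definition holomorphic_map (X Y : complex_space R) (f : X -> Y) : Prop :=
  continuous f /\
  forall c d, atlas X c -> atlas Y d ->
    holomorphic_through (chart_dom c `&` f @^-1` chart_dom d) c (d \o f).

Definition biholomorphic_map (X Y : complex_space R) (f : X -> Y) : Prop :=
  holomorphic_map f /\
  exists g : Y -> X, [/\ cancel f g, cancel g f & holomorphic_map g].

(* Elements of the local rings below are represented by functions, and equality
   of germs at x by equality near x. *)

(* h represents a germ in O_{X,x} *)
Definition holomorphic_function_germ (X : complex_space R) (x : X)
    (h : X -> Cplx R) : Prop :=
  exists W : set X, [/\ open W, W x &
    forall c, atlas X c -> holomorphic_through (chart_dom c `&` W) c h].

Definition maximal_ideal (X : complex_space R) (x : X) : set (X -> Cplx R) :=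
  [set h | holomorphic_function_germ x h /\ h x = 0].

Definition maximal_ideal_square (X : complex_space R) (x : X) :
    set (X -> Cplx R) :=
  [set h | exists (k : nat) (a b : 'I_k -> X -> Cplx R),
     (forall i, maximal_ideal x (a i) /\ maximal_ideal x (b i)) /\
     \forall y \near x, h y = \sum_(i < k) a i y * b i y].

(* dim_C (m / m^2) = N: some h_1, ..., h_N in m induce a basis of m / m^2. *)
Definition embedding_dimension (X : complex_space R) (x : X) (N : nat) : Prop :=
  exists h : 'I_N -> X -> Cplx R,
    [/\ forall i, maximal_ideal x (h i),
        forall g, maximal_ideal x g -> exists c : 'I_N -> Cplx R,
          maximal_ideal_square x (fun y => g y - \sum_(i < N) c i * h i y) &
        forall c : 'I_N -> Cplx R,
          maximal_ideal_square x (fun y => \sum_(i < N) c i * h i y) ->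
          forall i, c i = 0].

End Maps.

Section Psh.
Context {R : realType}.

(* The function identically -oo is allowed (it is phi_I for I = 0). *)
Definition psh_on (N : nat) (U : set 'rV[Cplx R]_N)
    (phi : 'rV[Cplx R]_N -> \bar R) : Prop :=
  [/\ forall z, U z -> (phi z < +oo)%E,
      forall z, U z -> forall t : R, (phi z < t%:E)%E ->
        \forall w \near z, (phi w < t%:E)%E &
      forall a b : 'rV[Cplx R]_N,
        (forall zeta : Cplx R, `|zeta| <= 1 -> U (a + zeta *: b)) ->
        (phi a <= ((2 * pi)^-1)%:E *
          \int[lebesgue_measure]_(theta in `[0%R, (2 * pi)%R])
             phi (a + ((cos theta +i* sin theta : R[i]) : Cplx R) *: b)%R)%E].

Definition psh_near0 (N : nat) (phi : 'rV[Cplx R]_N -> \bar R) : Prop :=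
  exists U : set 'rV[Cplx R]_N, [/\ open U, U 0 & psh_on U phi].

Definition psh_germ (N : nat) := {phi : 'rV[Cplx R]_N -> \bar R | psh_near0 phi}.

(* sup_U |phi - psi| < +oo on some neighborhood U of 0, written as two
   inequalities so that points where phi = psi = -oo are harmless. *)
Definition singularity_equiv (N : nat) (phi psi : 'rV[Cplx R]_N -> \bar R) : Prop :=
  exists M : R, \forall z \near (0 : 'rV[Cplx R]_N),
    (phi z <= psi z + M%:E)%E /\ (psi z <= phi z + M%:E)%E.

(* A function on PSH_0 is a function on psh germs respecting
   singularity_equiv.  In the second clause psi is any psh representative of the
   class of phi \o H. *)
Definition singularity_invariant (inv : forall N, psh_germ N -> \bar R) : Prop :=
  (forall N (phi psi : psh_germ N),
     singularity_equiv (sval phi) (sval psi) -> inv N phi = inv N psi) /\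
  (forall N (phi psi : psh_germ N) (H : 'rV[Cplx R]_N -> 'rV[Cplx R]_N),
     biholomorphic_germ H ->
     singularity_equiv (sval psi) (sval phi \o H) -> inv N psi = inv N phi).

(* I(B, Omega)_0 *)
Definition vanishing_ideal (N : nat) (B : set 'rV[Cplx R]_N) :
    set ('rV[Cplx R]_N -> Cplx R) :=
  [set h | holomorphic_near (0 : 'rV[Cplx R]_N) h /\
           \forall z \near (0 : 'rV[Cplx R]_N), B z -> h z = 0].

Definition generates (N m : nat) (I : set ('rV[Cplx R]_N -> Cplx R))
    (g : 'I_m -> 'rV[Cplx R]_N -> Cplx R) : Prop :=
  (forall j, I (g j)) /\
  forall h, I h -> exists a : 'I_m -> 'rV[Cplx R]_N -> Cplx R,
    (forall j, holomorphic_near (0 : 'rV[Cplx R]_N) (a j)) /\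
    \forall z \near (0 : 'rV[Cplx R]_N), h z = \sum_(j < m) a j z * g j z.

(* lne 0 = -oo *)
Definition phi_gen (N m : nat) (g : 'I_m -> 'rV[Cplx R]_N -> Cplx R)
    (z : 'rV[Cplx R]_N) : \bar R :=
  ((2^-1)%:E * lne (\sum_(j < m) (ComplexField.Normc.normc (g j z : R[i])) ^+ 2)%:E)%E.

(* v = inv(X, x), computed with some choice of the data: a biholomorphism c from
   a neighborhood A = chart_dom c of x onto an analytic subset B = chart_img c of
   a domain Omega = chart_ambient c of C^N, N = N(X, x), sending x to 0 (c is
   biholomorphic exactly when it is compatible with the charts of X), and
   generators g of I(B, Omega)_0; phi is phi_I as an element of PSH_0. *)
Definition is_inv_at (inv : forall N, psh_germ N -> \bar R) (X : complex_space R)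
    (x : X) (v : \bar R) : Prop :=
  exists c : chart R X,
    [/\ forall d, atlas X d -> compatible c d,
        connected (chart_ambient c), chart_dom c x, chart_map c x = 0 &
        embedding_dimension x (chart_dim c) /\
        exists (m : nat) (g : 'I_m -> 'rV[Cplx R]_(chart_dim c) -> Cplx R)
               (phi : psh_germ (chart_dim c)),
          [/\ generates (vanishing_ideal (chart_img c)) g,
              (\forall z \near (0 : 'rV[Cplx R]_(chart_dim c)),
                 sval phi z = phi_gen g z) &
              v = inv (chart_dim c) phi]].

(* inv(X, x), for some choice of the data *)
Definition inv_at (inv : forall N, psh_germ N -> \bar R) (X : complex_space R)
    (x : X) : \bar R :=
  get [set v | is_inv_at inv x v].

End Psh.

Arguments psh_germ R N : clear implicits.
Arguments singularity_invariant {R} inv.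
Arguments is_inv_at {R} inv X x v.
Arguments inv_at {R} inv X x.

(* Main.v *)
(* Two embeddings of minimal dimension N of the germ (X, x), with images B and B', differ by
   holomorphic germs F, F' of C^N that restrict to inverse bijections between B and B'.
   Minimality says that the coordinates form a basis of m/m^2, hence that every germ vanishing on B
   has zero differential at 0.  Applied to F' F - id, this shows that the differentials of F and F'
   are inverse to each other, so F is a biholomorphic germ by the inverse function theorem; it
   carries one vanishing ideal onto the other, and the functions phi attached to two systems of
   generators of the same ideal differ by a bounded amount.  The one variable input is Goursat's
   lemma, since holomorphic only means complex differentiable near a point. *)
From HB Require Import structures.
From mathcomp Require Import all_boot all_order all_algebra.
From mathcomp Require Import complex.
From mathcomp Require Import all_classical all_reals all_analysis.
From mathcomp Require Import ring lra.
Require Import Defs.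

Set Implicit Arguments.
Unset Strict Implicit.
Unset Printing Implicit Defensive.

Import Order.TTheory GRing.Theory Num.Theory.
Import numFieldNormedType.Exports.

Local Open Scope classical_set_scope.
Local Open Scope complex_scope.
Local Open Scope ring_scope.

(** * Real-valued norms and epsilon-delta differentiability *)

Section Nrm.
Context {R : realType}.
Implicit Types V W : normedModType (Cplx R).

(** The equality of the two invariants comes from transport alone: an embedding of (X, x),
    precomposed with the inverse of f, embeds (Y, f(x)) with the same image, so both sides are [get]
    of the same set of values. The comparison of embeddings shows that this set has at most one
    element. Its cost lies in m^2: placing a germ without linear part in m^2 takes explicit
    holomorphic factors. Hadamard's lemma provides them, and these factors, the directional
    derivatives and the local inverse are all built as limits of holomorphic functions. Such a limit
    stays differentiable when the second-order remainders are bounded uniformly, which is why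
    Cauchy's formula enters through Taylor estimates whose constants depend only on a bound and a
    radius. Norms of a module over [Cplx R] take values in [Cplx R], whose order is partial, so all
    estimates are made with the real number [nrm]. *)

Definition nrm V (v : V) : R := complex.Re (`|v| : R[i]).

Lemma normE V (v : V) : `|v| = (nrm v)%:C :> R[i].
Proof. by rewrite /nrm RRe_real//; apply: ger0_real; exact: normr_ge0. Qed.

Lemma nrm_ge0 V (v : V) : 0 <= nrm v.
Proof. by rewrite -ler0c -normE. Qed.

Lemma nrm0 V : nrm (0 : V) = 0.
Proof. by rewrite /nrm normr0. Qed.

Lemma nrm_eq0 V (v : V) : nrm v = 0 -> v = 0.
Proof. by move=> h; apply/normr0_eq0; rewrite normE h. Qed.

Lemma nrm_gt0 V (v : V) : v != 0 -> 0 < nrm v.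
Proof.
move=> v0; rewrite lt0r nrm_ge0 andbT; apply: contra v0 => /eqP h.
by apply/eqP/nrm_eq0.
Qed.

Lemma nrmD V (u v : V) : nrm (u + v) <= nrm u + nrm v.
Proof. by rewrite -lecR rmorphD/= -!normE; exact: ler_normD. Qed.

Lemma nrmN V (v : V) : nrm (- v) = nrm v.
Proof. by rewrite /nrm normrN. Qed.

Lemma nrmB V (u v : V) : nrm (u - v) <= nrm u + nrm v.
Proof. by rewrite -[nrm v]nrmN nrmD. Qed.

Lemma nrmC V (u v : V) : nrm (u - v) = nrm (v - u).
Proof. by rewrite -nrmN opprB. Qed.

Lemma nrmZ V (a : Cplx R) (v : V) : nrm (a *: v) = nrm (a : Cplx R) * nrm v.
Proof. by apply: complexI; rewrite rmorphM/= -!normE normrZ. Qed.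

Lemma nrmM (a b : Cplx R) : nrm (a * b) = nrm a * nrm b.
Proof. exact: nrmZ. Qed.

Lemma nrmV (a : Cplx R) : nrm a^-1 = (nrm a)^-1.
Proof. by apply: complexI; rewrite fmorphV/= -!normE normfV. Qed.

Lemma nrm1 : nrm (1 : Cplx R) = 1.
Proof. by rewrite /nrm normr1. Qed.

Lemma nrmX (a : Cplx R) n : nrm (a ^+ n) = nrm a ^+ n.
Proof.
by elim: n => [|n ih]; rewrite ?expr0 ?nrm1// !exprS nrmM ih.
Qed.

Lemma nrm_normc (a : Cplx R) : nrm a = ComplexField.Normc.normc (a : R[i]).
Proof. by []. Qed.

Lemma nrm_real (a : R) : nrm (a%:C : Cplx R) = `|a|.
Proof. by rewrite nrm_normc /= expr0n/= addr0 sqrtr_sqr. Qed.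

Lemma Re_le_nrm (a : Cplx R) : `|complex.Re (a : R[i])| <= nrm a.
Proof. by rewrite -lecR -normE; exact: normc_ge_Re. Qed.

Lemma Im_le_nrm (a : Cplx R) : `|complex.Im (a : R[i])| <= nrm a.
Proof.
rewrite nrm_normc; case: a => a b /=; rewrite -sqrtr_sqr ler_sqrt ?addr_ge0 ?sqr_ge0//.
by rewrite lerDr sqr_ge0.
Qed.

Lemma nrm_le_ReIm (a : Cplx R) :
  nrm a <= `|complex.Re (a : R[i])| + `|complex.Im (a : R[i])|.
Proof.
have -> : a = (complex.Re (a : R[i]))%:C + 'i%C * (complex.Im (a : R[i]))%:C :> Cplx R.
  exact: complexE.
apply: (le_trans (nrmD _ _)); rewrite nrmM !nrm_real.
have -> : nrm ('i%C : Cplx R) = 1.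
  by rewrite nrm_normc /= expr0n/= add0r expr1n sqrtr1.
by rewrite mul1r !raddfD/= !(mul0r,mulr0,mul1r,addr0,add0r,subr0).
Qed.

Lemma ler_nrm_sum V (I : Type) (r : seq I) (P : pred I) (F : I -> V) :
  nrm (\sum_(i <- r | P i) F i) <= \sum_(i <- r | P i) nrm (F i).
Proof.
elim/big_ind2: _ => [|a b c d h1 h2|//]; first by rewrite nrm0.
exact: le_trans (nrmD _ _) (lerD h1 h2).
Qed.

Lemma near_nrmP V (p : V) (P : set V) :
  (\forall z \near p, P z) <-> exists2 e : R, 0 < e & forall z, nrm (z - p) < e -> P z.
Proof.
split.
  move=> /nbhs_normP[e /= e0 he].
  have ee : e = (complex.Re (e : R[i]))%:C :> R[i].
    by rewrite RRe_real//; apply: gtr0_real.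
  exists (complex.Re (e : R[i])); first by rewrite -ltcR -ee.
  move=> z hz; apply: he => /=; rewrite distrC normE ee ltcR.
  exact: hz.
case=> e e0 he; apply/nbhs_normP; exists (e%:C : Cplx R) => /=.
  by rewrite ltcR.
move=> z /=; rewrite distrC normE ltcR; exact: he.
Qed.

Lemma continuous_nrmP V W (f : V -> W) (p : V) :
  {for p, continuous f} <-> forall e : R, 0 < e -> exists2 d : R, 0 < d &
    forall z, nrm (z - p) < d -> nrm (f z - f p) < e.
Proof.
split.
  move=> cf e e0; apply/(near_nrmP p (fun z => nrm (f z - f p) < e)).
  by apply: (cf (fun w => nrm (w - f p) < e)); apply/near_nrmP; exists e.
move=> h A /near_nrmP[e e0 he].
have [d d0 hd] := h e e0; apply/near_nrmP; exists d => // z /hd; exact: he.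
Qed.

Lemma linear_nrm_bound V W (L : {linear V -> W}) : continuous L ->
  exists2 k : R, 0 < k & forall v, nrm (L v) <= k * nrm v.
Proof.
move=> /linear_lipschitz[k k0 hk].
have ek : k = (complex.Re (k : R[i]))%:C :> R[i].
  by rewrite RRe_real//; apply: gtr0_real.
exists (complex.Re (k : R[i])); first by rewrite -ltcR -ek.
by move=> v; rewrite -lecR rmorphM/= -ek -!normE; exact: hk.
Qed.

Lemma linear_bound_continuous V W (L : {linear V -> W}) (k : R) :
  (forall v, nrm (L v) <= k * nrm v) -> continuous L.
Proof.
move=> hk p; apply/continuous_nrmP => e e0.
have k1 : 0 < `|k| + 1 by rewrite ltr_wpDl.
exists (e / (`|k| + 1)); first by rewrite divr_gt0.
move=> z hz; rewrite -linearB; apply: le_lt_trans (hk _) _.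
rewrite ltr_pdivlMr// in hz; apply: le_lt_trans hz.
rewrite mulrC ler_wpM2l ?nrm_ge0//.
by have := ler_norm k; lra.
Qed.

Lemma diff_nrm V W (f : V -> W) (p : V) : differentiable f p ->
  forall e : R, 0 < e -> exists2 d : R, 0 < d &
    forall v, nrm v < d -> nrm (f (p + v) - f p - 'd f p v) <= e * nrm v.
Proof.
move=> df e e0; have := diff_locally df => /eqaddoP /(_ (e%:C : Cplx R)).
rewrite ltcR => /(_ e0) /near_nrmP[d d0 hd]; exists d => // v hv.
have {hd} := hd v; rewrite subr0 => /(_ hv); rewrite !fctE /= => hd.
rewrite -lecR rmorphM/= -!normE; apply: le_trans hd.
by rewrite opprD addrA [v + p]addrC.
Qed.

(** The bound [k] makes [L] continuous, so uniqueness of differentials applies. Together with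
    [diff_nrm] this turns differentiability into a real epsilon-delta statement. *)
Lemma nrm_diff V W (f : V -> W) (p : V) (L : {linear V -> W}) (k : R) :
  (forall v, nrm (L v) <= k * nrm v) ->
  (forall e : R, 0 < e -> exists2 d : R, 0 < d &
    forall v, nrm v < d -> nrm (f (p + v) - f p - L v) <= e * nrm v) ->
  differentiable f p /\ 'd f p = L :> (V -> W).
Proof.
move=> Lk h; have cL := linear_bound_continuous Lk.
have hL : f \o shift p = cst (f p) + L +o_ 0 id.
  apply/eqaddoP => e e0.
  have ee : e = (complex.Re (e : R[i]))%:C :> R[i].
    by rewrite RRe_real//; apply: gtr0_real.
  have [|d d0 hd] := h (complex.Re (e : R[i])); first by rewrite -ltcR -ee.
  apply/near_nrmP; exists d => // v; rewrite subr0 => /hd.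
  by rewrite -lecR rmorphM/= -ee -!normE !fctE /= opprD addrA [v + p]addrC.
have dL := diff_unique cL hL; split=> //.
by apply/diff_locallyP; rewrite dL.
Qed.

Lemma nrm_coord (n : nat) (v : 'rV[Cplx R]_n) (i : 'I_n) : nrm (v 0 i : Cplx R) <= nrm v.
Proof.
rewrite -lecR -!normE [leRHS](mx_normE v) [leLHS](_ : _ = `|v 0 i|%:nng%:num)//.
rewrite [_ <= _%:num]num_le.
exact: (le_bigmax _ (fun ij : 'I_1 * 'I_n => `|v ij.1 ij.2|%:nng) (0, i)).
Qed.

Lemma nrm_rV_le (n : nat) (v : 'rV[Cplx R]_n) (M : R) : 0 <= M ->
  (forall i, nrm (v 0 i : Cplx R) <= M) -> nrm v <= M.
Proof.
move=> M0 h; have [v0|v0] := eqVneq (mx_norm v) 0.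
  by rewrite /nrm [`|v|]v0.
have [[j i] /= e] := mx_norm_neq0 v0.
by rewrite /nrm [`|v|]e ord1; exact: h.
Qed.

Lemma rV_linear_bound (n : nat) W (L : {linear 'rV[Cplx R]_n -> W}) :
  exists2 k : R, 0 <= k & forall v, nrm (L v) <= k * nrm v.
Proof.
exists (\sum_i nrm (L (delta_mx 0 i))) => [|v].
  by apply: sumr_ge0 => i _; exact: nrm_ge0.
rewrite {1}[v]row_sum_delta linear_sum; apply: le_trans (ler_nrm_sum _ _ _) _.
rewrite mulr_suml; apply: ler_sum => i _; rewrite linearZ nrmZ mulrC.
by rewrite ler_wpM2l ?nrm_ge0// nrm_coord.
Qed.

Lemma rV_linear_continuous (n : nat) W (L : {linear 'rV[Cplx R]_n -> W}) : continuous L.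
Proof.
by have [k _ hk] := rV_linear_bound L; exact: (linear_bound_continuous hk).
Qed.

Lemma differentiable_rV V (n : nat) (f : V -> 'rV[Cplx R]_n) (p : V) :
  (forall i, differentiable (fun z => f z 0 i : Cplx R) p) -> differentiable f p.
Proof.
move=> h.
have -> : f = \sum_(i < n) (fun z => (f z 0 i : Cplx R) *: (delta_mx 0 i : 'rV[Cplx R]_n)).
  by apply/funext => z; rewrite fct_sumE {1}[f z]row_sum_delta.
by apply: differentiable_sum => i; exact: differentiableZl.
Qed.

Lemma differentiable_rV_coord V (n : nat) (f : V -> 'rV[Cplx R]_n) (p : V) (i : 'I_n) :
  differentiable f p -> differentiable (fun z => f z 0 i : Cplx R) p.
Proof.
by move=> df; exact: (differentiable_comp df (differentiable_coord (f p) 0 i)).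
Qed.
End Nrm.

(** * Integrals of complex functions along segments *)

Section Cint.
Context {R : realType}.
Local Notation C := (Cplx R).
Local Notation mu := (@lebesgue_measure R).
Local Notation Re := (@complex.Re R).
Local Notation Im := (@complex.Im R).
Implicit Types (f g : R -> C) (a b : R).

Lemma ReB (u v : C) : Re (u - v) = Re u - Re v.
Proof. by case: u v => [? ?] []. Qed.

Lemma ImB (u v : C) : Im (u - v) = Im u - Im v.
Proof. by case: u v => [? ?] []. Qed.

Lemma Re_continuous : continuous (fun z : C => Re z).
Proof.
move=> z A /nbhs_ballP[e e0 he]; apply/(near_nrmP z (fun w => A (Re w))); exists e => // w hw; apply: he.
rewrite /ball/= distrC; apply: le_lt_trans hw; rewrite -ReB; exact: Re_le_nrm.
Qed.

Lemma Im_continuous : continuous (fun z : C => Im z).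
Proof.
move=> z A /nbhs_ballP[e e0 he]; apply/(near_nrmP z (fun w => A (Im w))); exists e => // w hw; apply: he.
rewrite /ball/= distrC; apply: le_lt_trans hw; rewrite -ImB; exact: Im_le_nrm.
Qed.

Lemma continuous_ReP f : continuous f -> continuous (Re \o f).
Proof. by move=> cf x; apply: continuous_comp; [exact: cf|exact: Re_continuous]. Qed.

Lemma continuous_ImP f : continuous f -> continuous (Im \o f).
Proof. by move=> cf x; apply: continuous_comp; [exact: cf|exact: Im_continuous]. Qed.

Lemma line_continuous (p u : C) : continuous (fun x : R => p + u * x%:C : C).
Proof.
move=> x A /near_nrmP[e e0 he].
have u1 : 0 < nrm u + 1 by rewrite ltr_wpDl// nrm_ge0.
apply/nbhs_ballP; exists (e / (nrm u + 1)) => [|y] /=; first by rewrite divr_gt0.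
rewrite /ball/= ltr_pdivlMr// => hy; apply: he.
have -> : p + u * y%:C - (p + u * x%:C) = u * (y - x)%:C :> C.
  by rewrite rmorphB/=; ring.
rewrite nrmM nrm_real distrC; apply: le_lt_trans hy.
rewrite mulrC ler_wpM2l//; lra.
Qed.

(** Componentwise, because the integral at hand is that of real functions. Paths are parametrized by
    a real variable, and the direction factor of dz is kept outside. *)
Definition cint a b f : C :=
  ((\int[mu]_(x in `[a, b]) Re (f x))%R +i* (\int[mu]_(x in `[a, b]) Im (f x))%R)%C.

Lemma continuous_integrable (h : R -> R) a b : continuous h ->
  mu.-integrable `[a, b] (EFin \o h).
Proof.
move=> ch; apply: continuous_compact_integrable; first exact: segment_compact.
exact: continuous_subspaceT.
Qed.

Lemma cintD a b f g : continuous f -> continuous g ->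
  cint a b (fun x => f x + g x) = cint a b f + cint a b g.
Proof.
move=> cf cg; rewrite /cint.
have e (h : C -> R) : (forall u v, h (u + v) = h u + h v) -> continuous (h \o f) -> continuous (h \o g) ->
   (\int[mu]_(x in `[a, b]) h (f x + g x) = \int[mu]_(x in `[a, b]) h (f x) +
     \int[mu]_(x in `[a, b]) h (g x))%R.
  move=> hD hf hg; rewrite -RintegralD//; [|exact: (@continuous_integrable (h \o f))..|exact: (@continuous_integrable (h \o g))].
  by apply: eq_Rintegral => x _; exact: hD.
rewrite (e Re) ?(e Im)//; try exact: continuous_ReP; try exact: continuous_ImP.
by case=> ? ? [].
by case=> ? ? [].
Qed.

Lemma cintZ a b f (k : C) : continuous f ->
  cint a b (fun x => k * f x) = k * cint a b f.
Proof.
move=> cf; rewrite /cint; case: k => k l /=.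
have iR := @continuous_integrable _ a b (continuous_ReP cf).
have iI := @continuous_integrable _ a b (continuous_ImP cf).
have cR := continuous_ReP cf; have cI := continuous_ImP cf.
have cZ (r : R) (h : R -> R) : continuous h -> continuous (fun x => r * h x).
  by move=> ch x; apply: cvgM; [exact: cvg_cst|exact: ch].
congr (_ +i* _)%C.
  rewrite -!RintegralZl// -RintegralB//.
  - by apply: eq_Rintegral => x _; case: (f x).
  - exact: (@continuous_integrable (fun x => k * (Re \o f) x) a b (cZ _ _ cR)).
  - exact: (@continuous_integrable (fun x => l * (Im \o f) x) a b (cZ _ _ cI)).
rewrite -!RintegralZl// -RintegralD//.
- by apply: eq_Rintegral => x _; case: (f x).
- exact: (@continuous_integrable (fun x => k * (Im \o f) x) a b (cZ _ _ cI)).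
- exact: (@continuous_integrable (fun x => l * (Re \o f) x) a b (cZ _ _ cR)).
Qed.

Lemma eq_cint a b f g : (forall x, a <= x <= b -> f x = g x) -> cint a b f = cint a b g.
Proof.
move=> fg; rewrite /cint; congr (_ +i* _)%C; apply: eq_Rintegral => x;
  by rewrite inE/= in_itv/= => /fg ->.
Qed.

Lemma cint_cat a b c f : continuous f -> a <= b -> b <= c ->
  cint a c f = cint a b f + cint b c f.
Proof.
move=> cf ab bc.
have e (h : R -> R) : continuous h ->
  (\int[mu]_(x in `[a, c]) h x = \int[mu]_(x in `[a, b]) h x + \int[mu]_(x in `[b, c]) h x)%R.
  move=> ch; apply/eqP; rewrite addrC -subr_eq; apply/eqP.
  have ic := @continuous_integrable _ a c ch.
  rewrite Rintegral_itvB ?bnd_simp// Rintegral_itv_obnd_cbnd//.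
  apply: integrableS (@continuous_integrable _ b c ch) => //.
  exact: subset_itv_oc_cc.
rewrite /cint (e (Re \o f)) ?(e (Im \o f))//.
  exact: continuous_ImP.
exact: continuous_ReP.
Qed.

(** The factor 2 comes from bounding the real and imaginary parts separately. *)
Lemma cint_bound a b f M : continuous f -> a <= b ->
  (forall x, a <= x <= b -> nrm (f x) <= M) -> nrm (cint a b f) <= 2 * M * (b - a).
Proof.
move=> cf ab hM.
have e (h : R -> R) : continuous h -> (forall x, a <= x <= b -> `|h x| <= M) ->
  `|(\int[mu]_(x in `[a, b]) h x)%R| <= M * (b - a).
  move=> ch hh; have ic := @continuous_integrable h a b ch.
  apply: (le_trans (le_normr_Rintegral _ ic)) => //.
  have -> : M * (b - a) = (\int[mu]_(x in `[a, b]) M)%R.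
    rewrite Rintegral_cst//= lebesgue_measure_itv/= lte_fin.
    by move: ab; rewrite le_eqVlt => /predU1P[->|->]; rewrite ?ltxx/= ?subrr.
  apply: le_Rintegral => //.
    apply: (@continuous_integrable (fun x => `|h x|)) => x.
    by apply: continuous_comp; [exact: ch|exact: norm_continuous].
  by apply: (@continuous_integrable (cst M)) => x; exact: cvg_cst.
apply: le_trans (nrm_le_ReIm _) _.
have := e _ (continuous_ReP cf); have := e _ (continuous_ImP cf) => /=.
move=> h1 h2; have {}h1 := h1 _; have {}h2 := h2 _.
have -> : 2 * M * (b - a) = M * (b - a) + M * (b - a) by ring.
apply: lerD; [apply: h2|apply: h1] => x /hM.
  exact/le_trans/Re_le_nrm.
exact/le_trans/Im_le_nrm.
Qed.

Lemma cint_FTC a b (F phi : C -> C) (p u : C) : a <= b ->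
  (forall x : R, differentiable F (p + u * x%:C : C) /\
     (forall h : C, 'd F (p + u * x%:C : C) h = phi (p + u * x%:C) * h)) ->
  continuous (fun x : R => phi (p + u * x%:C)) ->
  u * cint a b (fun x => phi (p + u * x%:C)) = F (p + u * b%:C) - F (p + u * a%:C).
Proof.
move=> ab dF cphi.
have cuphi : continuous (fun x : R => u * phi (p + u * x%:C)).
  by move=> x; apply: cvgM; [exact: cvg_cst|exact: cphi].
rewrite -cintZ//.
(* To be used with [r] equal to [Re] and [Im]: the composite of [r] with [F] along the line has a
   real derivative, and the real fundamental theorem applies. *)
have e (r : C -> R) : (forall z w, r (z - w) = r z - r w) ->
  (forall (k : R) (z : C), r (k%:C * z) = k * r z) ->
  (forall z, `|r z| <= nrm z) -> continuous (fun x : R => r (u * phi (p + u * x%:C))) ->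
  (\int[mu]_(x in `[a, b]) r (u * phi (p + u * x%:C)%R) = r (F (p + u * b%:C)) - r (F (p + u * a%:C)))%R.
  move=> rB rZ rN rc.
  have der (x : R) : is_derive (x : R^o) (1 : R^o) (fun y : R => r (F (p + u * y%:C))) (r (u * phi (p + u * x%:C))).
    suff cv : (fun h : R => h^-1 *: (r (F (p + u * (h *: 1 + x)%:C)) - r (F (p + u * x%:C)))) @ 0^' --> r (u * phi (p + u * x%:C)).
      by split; [apply/cvg_ex; eexists; exact: cv|exact: (cvg_lim _ cv)].
    have [dx ex] := dF x.
    apply/cvgrPdist_le => eps eps0.
    have u1 : 0 < nrm u + 1 by rewrite ltr_wpDl// nrm_ge0.
    have [d d0 hd] := diff_nrm dx (divr_gt0 eps0 u1).
    near=> h.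
    have h0 : h != 0 by near: h; exact: nbhs_dnbhs_neq.
    have hh : `|h| < d / (nrm u + 1).
      near: h; apply: dnbhs0_lt; exact: divr_gt0.
    have := hd (u * h%:C : C).
    rewrite ex nrmM nrm_real.
    rewrite ltr_pdivlMr// in hh.
    have h1 : nrm u * `|h| < d by apply: le_lt_trans hh; rewrite mulrC ler_wpM2l//; lra.
    move=> /(_ h1) hle.
    have -> : r (u * phi (p + u * x%:C)) = h^-1 * r (phi (p + u * x%:C) * (u * h%:C)).
      have -> : phi (p + u * x%:C) * (u * h%:C) = h%:C * (u * phi (p + u * x%:C)) by ring.
      by rewrite rZ mulKf.
    rewrite -[_ *: _]/(_ * _) -mulrBr normrM normfV distrC -!rB.
    have ehx : p + u * (h *: 1 + x)%:C = p + u * x%:C + u * h%:C.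
      by rewrite -[h *: 1]/(h * 1) mulr1 rmorphD/= mulrDr; ring.
    rewrite ehx ler_pdivrMl ?normr_gt0//; apply: le_trans (rN _) _.
    apply: le_trans hle _.
    rewrite mulrA mulrC ler_wpM2l// mulrAC ler_pdivrMr// ler_wpM2l ?(ltW eps0)//; lra.
  move: ab; rewrite le_eqVlt => /predU1P[->|ab].
    by rewrite set_itv1 Rintegral_set1 subrr.
  rewrite /Rintegral (@continuous_FTC2 _ _ (fun y : R => r (F (p + u * y%:C)))) //.
  - exact: continuous_subspaceT.
  - have cc : continuous (fun y : R => r (F (p + u * y%:C))).
      move=> x; apply: differentiable_continuous; apply/derivable1_diffP.
      by have [] := der x.
    split; first by move=> x _; have [] := der x.
      exact/cvg_at_right_filter/cc.
    exact/cvg_at_left_filter/cc.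
  - by move=> x _; rewrite derive1E; have [_ ->] := der x.
rewrite /cint (e Re) ?(e Im)//.
- by case: (F _) => ? ?; case: (F _) => ? ? /=.
- by case=> ? ? [].
- by move=> k [x y] /=; ring.
- exact: Im_le_nrm.
- exact: (continuous_ImP cuphi).
- by case=> ? ? [].
- by move=> k [x y] /=; ring.
- exact: Re_le_nrm.
- exact: (continuous_ReP cuphi).
Unshelve. all: by end_near. Qed.
End Cint.

(** * Goursat's lemma on rectangles *)

Lemma ex_lt_all (R : realFieldType) (s : seq R) :
  all (fun x => 0 < x) s -> exists2 e : R, 0 < e & all (fun x => e < x) s.
Proof.
elim: s => [_|x s ih /= /andP[x0 /ih[e e0 he]]]; first by exists 1.
exists (Num.min (x / 2) e); first by rewrite lt_min e0 divr_gt0.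
rewrite gt_min ltr_pdivrMr// ltr_pMr// ltr1n orTb/=.
by apply: sub_all he => y ey; rewrite gt_min ey orbT.
Qed.

Section Goursat.
Context {R : realType}.
Local Notation C := (Cplx R).
Implicit Types (f g : C -> C) (a b c d : R).

Definition pt (x y : R) : C := (x +i* y)%C.

(** Horizontal lines in the form [p + u * x] of [cint_FTC], with [u = 1]; vertical ones follow with
    [u = 'i]. *)
Lemma ptE (x y : R) : pt x y = pt 0 y + 1 * x%:C.
Proof. by rewrite mul1r /pt; congr (_ +i* _)%C; rewrite ?add0r ?addr0. Qed.

Lemma ptE' (x y : R) : pt x y = pt x 0 + 'i%C * y%:C.
Proof.
by rewrite /pt; congr (_ +i* _)%C; rewrite !(mul0r, mul1r, mulr0, subr0, addr0, add0r, oppr0).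
Qed.

Lemma nrm_pt (x y : R) : nrm (pt x y) <= `|x| + `|y|.
Proof. exact: nrm_le_ReIm. Qed.

Lemma ptB (x y x' y' : R) : pt x y - pt x' y' = pt (x - x') (y - y').
Proof. by []. Qed.

Lemma pt_hcont (y : R) : continuous (fun x : R => pt x y).
Proof. under eq_fun do rewrite ptE; exact: line_continuous. Qed.

Lemma pt_vcont (x : R) : continuous (fun y : R => pt x y).
Proof. under eq_fun do rewrite ptE'; exact: line_continuous. Qed.

(** The contour integral of f dz along the counterclockwise boundary of [a, b] x [c, d]: dz is dx on
    horizontal sides and i dy on vertical ones. *)
Definition rectint f a b c d : C :=
  cint a b (fun x => f (pt x c)) - cint a b (fun x => f (pt x d)) +
  'i%C * (cint c d (fun y => f (pt b y)) - cint c d (fun y => f (pt a y))).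

(** Continuity on the whole lines that carry the sides is what the lemmas on [cint] ask for. Kernels
    such as [(w - z)^-1] with [z] inside have it although they are discontinuous at [z]. *)
Definition sides_continuous f a b c d :=
  [/\ continuous (fun x => f (pt x c)), continuous (fun x => f (pt x d)),
      continuous (fun y => f (pt a y)) & continuous (fun y => f (pt b y))].

Lemma continuous_sides f a b c d : continuous f -> sides_continuous f a b c d.
Proof.
move=> cf; split=> x; (apply: continuous_comp; last exact: cf);
  by [exact: pt_hcont|exact: pt_vcont].
Qed.

Lemma rectintD f g a b c d : sides_continuous f a b c d -> sides_continuous g a b c d ->
  rectint (fun z => f z + g z) a b c d = rectint f a b c d + rectint g a b c d.
Proof.
move=> [f1 f2 f3 f4] [g1 g2 g3 g4]; rewrite /rectint.
by rewrite (cintD _ _ f1 g1) (cintD _ _ f2 g2) (cintD _ _ f3 g3) (cintD _ _ f4 g4); ring.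
Qed.

Lemma rectintZ (k : C) f a b c d : sides_continuous f a b c d ->
  rectint (fun z => k * f z) a b c d = k * rectint f a b c d.
Proof.
move=> [f1 f2 f3 f4]; rewrite /rectint.
by rewrite (cintZ _ _ k f1) (cintZ _ _ k f2) (cintZ _ _ k f3) (cintZ _ _ k f4); ring.
Qed.

Lemma sides_continuousZ (k : C) f a b c d : sides_continuous f a b c d ->
  sides_continuous (fun z => k * f z) a b c d.
Proof.
by move=> [h1 h2 h3 h4]; split=> x; (apply: cvgM; first exact: cvg_cst);
  [exact: h1|exact: h2|exact: h3|exact: h4].
Qed.

Definition boundary a b c d (z : C) :=
  exists x y, z = pt x y /\ [/\ a <= x <= b, c <= y <= d &
   ((x = a \/ x = b) \/ (y = c \/ y = d))].

Lemma boundary_bottom a b c d x : c <= d -> a <= x <= b -> boundary a b c d (pt x c).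
Proof. by move=> cd hx; exists x, c; split=> //; split; rewrite ?lexx//; right; left. Qed.

Lemma boundary_top a b c d x : c <= d -> a <= x <= b -> boundary a b c d (pt x d).
Proof. by move=> cd hx; exists x, d; split=> //; split; rewrite ?lexx ?cd//; right; right. Qed.

Lemma boundary_left a b c d y : a <= b -> c <= y <= d -> boundary a b c d (pt a y).
Proof. by move=> ab hy; exists a, y; split=> //; split; rewrite ?lexx//; left; left. Qed.

Lemma boundary_right a b c d y : a <= b -> c <= y <= d -> boundary a b c d (pt b y).
Proof. by move=> ab hy; exists b, y; split=> //; split; rewrite ?lexx ?ab//; left; right. Qed.

Lemma eq_rectint f g a b c d : a <= b -> c <= d ->
  (forall z, boundary a b c d z -> f z = g z) -> rectint f a b c d = rectint g a b c d.
Proof.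
move=> ab cd fg; rewrite /rectint; congr (_ - _ + _ * (_ - _)).
- apply: eq_cint => x hx; apply: fg; exact: boundary_bottom cd hx.
- apply: eq_cint => x hx; apply: fg; exact: boundary_top cd hx.
- apply: eq_cint => x hx; apply: fg; exact: boundary_right ab hx.
- apply: eq_cint => x hx; apply: fg; exact: boundary_left ab hx.
Qed.

(** The factor 4 is the 2 of [cint_bound] times two parallel sides. *)
Lemma rectint_bound f a b c d M : a <= b -> c <= d -> sides_continuous f a b c d ->
  (forall z, boundary a b c d z -> nrm (f z) <= M) ->
  nrm (rectint f a b c d) <= 4 * M * ((b - a) + (d - c)).
Proof.
move=> ab cd [h1 h2 h3 h4] hM; rewrite /rectint.
apply: le_trans (nrmD _ _) _; rewrite nrmM.
have -> : nrm ('i%C : C) = 1.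
  by rewrite nrm_normc /= expr0n/= add0r expr1n sqrtr1.
rewrite mul1r.
have e1 : nrm (cint a b (fun x => f (pt x c))) <= 2 * M * (b - a).
  apply: (cint_bound h1) => [|x hx]; first exact: ab.
  apply: hM; exact: boundary_bottom cd hx.
have e2 : nrm (cint a b (fun x => f (pt x d))) <= 2 * M * (b - a).
  apply: (cint_bound h2) => [|x hx]; first exact: ab.
  apply: hM; exact: boundary_top cd hx.
have e3 : nrm (cint c d (fun x => f (pt b x))) <= 2 * M * (d - c).
  apply: (cint_bound h4) => [|x hx]; first exact: cd.
  apply: hM; exact: boundary_right ab hx.
have e4 : nrm (cint c d (fun x => f (pt a x))) <= 2 * M * (d - c).
  apply: (cint_bound h3) => [|x hx]; first exact: cd.
  apply: hM; exact: boundary_left ab hx.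
have e5 := nrmB (cint a b (fun x => f (pt x c))) (cint a b (fun x => f (pt x d))).
have e6 := nrmB (cint c d (fun x => f (pt b x))) (cint c d (fun x => f (pt a x))).
lra.
Qed.

(** Each side contributes an increment of the primitive, and the increments cancel at the
    corners. *)
Lemma rectint_primitive (F f : C -> C) a b c d : a <= b -> c <= d ->
  sides_continuous f a b c d ->
  (forall x y, (x = a \/ x = b) \/ (y = c \/ y = d) ->
    differentiable F (pt x y) /\ forall h, 'd F (pt x y) h = f (pt x y) * h) ->
  rectint f a b c d = 0.
Proof.
move=> ab cd [h1 h2 h3 h4] dF.
have hE y : y = c \/ y = d -> continuous (fun x => f (pt x y)) ->
   cint a b (fun x => f (pt x y)) = F (pt b y) - F (pt a y).
  move=> hy cy; have := @cint_FTC R a b F f (pt 0 y) 1 ab.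
  rewrite -!ptE mul1r => <-.
  - by apply: eq_cint => x _; rewrite ptE.
  - by move=> x; rewrite -ptE; apply: dF; right.
  - by move: cy; under eq_fun do rewrite ptE.
have vE x : x = a \/ x = b -> continuous (fun y => f (pt x y)) ->
   'i%C * cint c d (fun y => f (pt x y)) = F (pt x d) - F (pt x c).
  move=> hx cx; have := @cint_FTC R c d F f (pt x 0) 'i%C cd.
  rewrite -!ptE' => <-.
  - by congr (_ * _); apply: eq_cint => y _; rewrite ptE'.
  - by move=> y; rewrite -ptE'; apply: dF; left.
  - by move: cx; under eq_fun do rewrite ptE'.
rewrite /rectint mulrBr !hE ?vE; try tauto.
ring.
Qed.

Lemma rectint_hsplit f a b c d m : continuous f -> a <= m -> m <= b ->
  rectint f a b c d = rectint f a m c d + rectint f m b c d.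
Proof.
move=> cf am mb; rewrite /rectint.
have [h1 h2 _ _] := continuous_sides a b c d cf.
by rewrite (cint_cat h1 am mb) (cint_cat h2 am mb); ring.
Qed.

Lemma rectint_vsplit f a b c d m : continuous f -> c <= m -> m <= d ->
  rectint f a b c d = rectint f a b c m + rectint f a b m d.
Proof.
move=> cf am mb; rewrite /rectint.
have [_ _ h1 h2] := continuous_sides a b c d cf.
by rewrite (cint_cat h1 am mb) (cint_cat h2 am mb); ring.
Qed.

Let rect := (R * R * (R * R))%type.
Let subrect (t t' : rect) :=
  [/\ t.1.1 <= t'.1.1, t'.1.2 <= t.1.2, t.2.1 <= t'.2.1 & t'.2.2 <= t.2.2].
Let halved (t t' : rect) :=
  t'.1.2 - t'.1.1 = (t.1.2 - t.1.1) / 2 /\ t'.2.2 - t'.2.1 = (t.2.2 - t.2.1) / 2.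

(** The point is the supremum of the left endpoints. Besides bisection, this is the source of
    completeness for the limits below. *)
Lemma nested_point (a b : nat -> R) :
  (forall n, a n <= a n.+1) -> (forall n, b n.+1 <= b n) -> (forall n, a n <= b n) ->
  exists p, forall n, a n <= p <= b n.
Proof.
move=> ha hb hab.
have amono m n : (m <= n)%N -> a m <= a n.
  by move=> /subnK <-; elim: (n - m)%N => [//|k ih]; rewrite addSn; apply: le_trans (ha _).
have bmono m n : (m <= n)%N -> b n <= b m.
  by move=> /subnK <-; elim: (n - m)%N => [//|k ih]; rewrite addSn; apply: le_trans (hb _) _.
have hub n : ubound (range a) (b n).
  move=> _ [m _ <-]; have [mn|/ltnW nm] := leqP m n.
    exact: le_trans (amono _ _ mn) (hab n).
  exact: le_trans (hab m) (bmono _ _ nm).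
have ne : range a !=set0 by exists (a 0), 0.
exists (sup (range a)) => n; apply/andP; split.
  by apply: ub_le_sup; [exists (b 0); exact: hub|exists n].
by apply: ge_sup.
Qed.

(** The subdivision argument of Goursat for an arbitrary property inherited from the four quarters:
    if it fails on a rectangle it fails on some quarter, and the nested failing rectangles close in
    on a point. *)
Lemma rect_bisection (P : R -> R -> R -> R -> Prop) a b c d :
  (forall a b c d, let m := (a + b) / 2 in let n := (c + d) / 2 in
     a <= b -> c <= d -> P a m c n -> P a m n d -> P m b c n -> P m b n d -> P a b c d) ->
  a <= b -> c <= d -> ~ P a b c d ->
  exists p1 p2, [/\ a <= p1 <= b, c <= p2 <= d &
   forall e, 0 < e -> exists a' b' c' d', [/\ a' <= p1 <= b', c' <= p2 <= d',
     b' - a' < e, d' - c' < e & ~ P a' b' c' d']].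
Proof.
move=> hP ab cd nP.
pose Q (t : rect) := [/\ t.1.1 <= t.1.2, t.2.1 <= t.2.2 & ~ P t.1.1 t.1.2 t.2.1 t.2.2].
(* Outside [Q] the step returns the rectangle itself, only to make the choice function total. *)
have /choice[step hstep] : forall t : rect, exists t', Q t -> [/\ subrect t t', halved t t' & Q t'].
  move=> [[x y] [z w]]; have [q|nq] := pselect (Q ((x, y), (z, w))); last by exists ((x,y),(z,w)).
  have [/= xy zw npq] := q.
  apply: contrapT => hno; apply: npq; apply: hP => //; apply: contrapT => hn; apply: hno.
  - exists ((x, (x + y) / 2), (z, (z + w) / 2)) => _.
    by split; [split => /=; lra|split => /=; lra|split => //=; lra].
  - exists ((x, (x + y) / 2), ((z + w) / 2, w)) => _.
    by split; [split => /=; lra|split => /=; lra|split => //=; lra].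
  - exists (((x + y) / 2, y), (z, (z + w) / 2)) => _.
    by split; [split => /=; lra|split => /=; lra|split => //=; lra].
  - exists (((x + y) / 2, y), ((z + w) / 2, w)) => _.
    by split; [split => /=; lra|split => /=; lra|split => //=; lra].
pose s n := iter n step ((a, b), (c, d)).
have Qs n : Q (s n).
  by elim: n => [|n ih]; [split|have [] := hstep _ ih].
have size n : (s n).1.2 - (s n).1.1 = (b - a) / 2 ^+ n /\
              (s n).2.2 - (s n).2.1 = (d - c) / 2 ^+ n.
  elim: n => [|n [ih1 ih2]]; first by rewrite expr0 !divr1.
  have [_ [-> ->] _] := hstep _ (Qs n).
  by rewrite ih1 ih2 exprSr invfM !mulrA.
have [p1 hp1] : exists p, forall n, (s n).1.1 <= p <= (s n).1.2.
  apply: nested_point => n; try by have [[]] := hstep _ (Qs n).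
  by have [] := Qs n.
have [p2 hp2] : exists p, forall n, (s n).2.1 <= p <= (s n).2.2.
  apply: nested_point => n; try by have [[]] := hstep _ (Qs n).
  by have [] := Qs n.
exists p1, p2; split; [exact: (hp1 0)|exact: (hp2 0)|].
move=> e e0.
have [n hn] : exists n, (b - a) + (d - c) < e * 2 ^+ n.
  have [n hn] : exists n : nat, ((b - a) + (d - c)) / e < n%:R.
    by exists (Num.truncn (((b - a) + (d - c)) / e)).+1; exact: truncnS_gt.
  exists n; rewrite mulrC -ltr_pdivrMr//; apply: lt_trans hn _.
  by rewrite -natrX ltr_nat ltn_expl.
exists (s n).1.1, (s n).1.2, (s n).2.1, (s n).2.2.
have p0 : (0 : R) < 2 ^+ n by rewrite exprn_gt0.
have [-> ->] := size n; have [_ _ nPn] := Qs n.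
by split => //; rewrite ltr_pdivrMr//; lra.
Qed.

Lemma affine_primitive (k l p z : C) :
  differentiable (fun w : C => k * w + l / 2 * (w - p) ^+ 2) z /\
  forall h, 'd (fun w : C => k * w + l / 2 * (w - p) ^+ 2) z h = (k + l * (z - p)) * h.
Proof.
have dsub : is_diff z (fun w : C => w - p) (fun h : C => h).
  have := is_diffB (is_diff_id z) (is_diff_cst p z).
  by move=> h; apply: is_diff_eq h _; apply/funext => h /=; rewrite !fctE subr0.
have d1 := is_diffZ k (is_diff_id z).
have d2 := is_diffZ (l / 2) (is_diffX 1 dsub).
have [dd ev] := is_diffD d1 d2; split; first exact: dd.
move=> h; have -> : 'd (fun w : C => k * w + l / 2 * (w - p) ^+ 2) z h =
  'd (k *: id + (l / 2) *: (fun w : C => w - p) ^+ 2) z h by [].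
rewrite ev !fctE /= expr1.
change (k * h + l / 2 * (2 * (z - p) * h) = (k + l * (z - p)) * h).
by field.
Qed.

Lemma diff_CE f (p h : C) : 'd f p h = 'd f p 1 * h.
Proof. by rewrite -[h in LHS]mulr1 -[h * 1]/(h *: (1 : C)) linearZ mulrC. Qed.

Lemma continuous_affine (k l p : C) : continuous (fun z : C => k + l * (z - p)).
Proof.
move=> z; apply: (@differentiable_continuous _ C C).
have d1 : differentiable (cst k : C -> C) z by exact: differentiable_cst.
have d2 : differentiable (cst p : C -> C) z by exact: differentiable_cst.
have d3 : differentiable (id : C -> C) z by exact: ex_diff.
exact: (differentiableD d1 (differentiableZ l (differentiableB d3 d2))).
Qed.

Lemma rectint_affine (k l p : C) a b c d : a <= b -> c <= d ->
  rectint (fun z => k + l * (z - p)) a b c d = 0.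
Proof.
move=> ab cd.
have hs := continuous_sides a b c d (@continuous_affine k l p).
apply: (rectint_primitive (F := fun w : C => k * w + l / 2 * (w - p) ^+ 2) ab cd hs) => x y _.
exact: affine_primitive.
Qed.

(** The first-order Taylor polynomial at the point has a primitive and integrates to 0; what remains
    is small compared with the size of the rectangle, and so is its length of integration. *)
Lemma rectint_local f (p1 p2 : R) : continuous f -> differentiable f (pt p1 p2) ->
  forall e, 0 < e -> exists2 r, 0 < r & forall a b c d,
    a <= p1 <= b -> c <= p2 <= d -> b - a < r -> d - c < r ->
    nrm (rectint f a b c d) <= e * ((b - a) ^+ 2 + (d - c) ^+ 2).
Proof.
move=> cf df e e0.
have [|r r0 hr] := diff_nrm df (e := e / 8); first by lra.
exists (r / 2) => [|a b c d /andP[ap pb] /andP[cp pd] hab hcd]; first lra.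
have ab : a <= b by lra.
have cd : c <= d by lra.
set p := pt p1 p2 in df hr.
pose A (z : C) : C := f p + 'd f p 1 * (z - p).
pose g (z : C) : C := f z - A z.
have cA : continuous A by exact: continuous_affine.
have cg : continuous g by move=> z; exact: (@cvgB _ C _ _ _ _ _ _ _ (cf z) (cA z)).
have -> : f = fun z => A z + g z by apply/funext => z; rewrite addrC subrK.
rewrite rectintD; try exact: continuous_sides.
rewrite rectint_affine// add0r.
set s := (b - a) + (d - c).
have s0 : 0 <= s by rewrite /s; lra.
(* With [s] the sum of the two sides, the bound is e s^2 / 2, and s^2 is at most twice the sum of
   the squares of the sides. *)
have : nrm (rectint g a b c d) <= 4 * (e / 8 * s) * s.
  apply: rectint_bound => //; first exact: continuous_sides.
  move=> z [x [y [-> [/andP[ax xb] /andP[cy yd] _]]]].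
  have hz : nrm (pt x y - p) <= s.
    rewrite ptB; apply: le_trans (nrm_pt _ _) _; rewrite /s.
    by apply: lerD; rewrite ler_norml; apply/andP; split; lra.
  have := hr (pt x y - p); rewrite [p + _]addrC subrK diff_CE => h.
  have {}h : nrm (f (pt x y) - f p - 'd f p 1 * (pt x y - p)) <= e / 8 * nrm (pt x y - p).
    by apply: h; apply: le_lt_trans hz _; rewrite /s; lra.
  rewrite /g /A opprD addrA; apply: le_trans h _.
  by rewrite ler_wpM2l//; lra.
have : 0 <= e * ((b - a) - (d - c)) ^+ 2 by rewrite mulr_ge0 ?sqr_ge0// ltW.
rewrite /s; nra.
Qed.

Lemma goursat f a b c d : continuous f -> a <= b -> c <= d ->
  (forall x y, a <= x <= b -> c <= y <= d -> differentiable f (pt x y)) ->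
  rectint f a b c d = 0.
Proof.
move=> cf ab cd df; apply: nrm_eq0; apply/eqP; rewrite eq_le nrm_ge0 andbT.
suff h e : 0 < e -> nrm (rectint f a b c d) <= e * ((b - a) ^+ 2 + (d - c) ^+ 2).
  set S := (b - a) ^+ 2 + (d - c) ^+ 2 in h.
  have S0 : 0 <= S by rewrite addr_ge0// sqr_ge0.
  apply/ler_addgt0Pr => e e0; rewrite add0r.
  have S1 : 0 < S + 1 by lra.
  have := h (e / (S + 1)) (divr_gt0 e0 S1) => /le_trans; apply.
  rewrite mulrAC ler_pdivrMr//; nra.
(* The bound is quadratic in the sides: a quarter gets exactly a quarter of it, so the four bounds
   add up to that of the whole rectangle. *)
pose P a b c d : Prop := nrm (rectint f a b c d) <= e * ((b - a) ^+ 2 + (d - c) ^+ 2).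
move=> e0; apply: (contrapT (P := P a b c d)) => nP.
have step : forall a b c d, let m := (a + b) / 2 in let n := (c + d) / 2 in
     a <= b -> c <= d -> P a m c n -> P a m n d -> P m b c n -> P m b n d -> P a b c d.
  clear nP df ab cd; move=> {}a {}b {}c {}d m n ab cd q1 q2 q3 q4.
  have am : a <= m by rewrite /m; lra.
  have mb : m <= b by rewrite /m; lra.
  have cn : c <= n by rewrite /n; lra.
  have nd : n <= d by rewrite /n; lra.
  rewrite /P (rectint_hsplit c d cf am mb) (rectint_vsplit a m cf cn nd) (rectint_vsplit m b cf cn nd).
  have h1 := nrmD (rectint f a m c n + rectint f a m n d) (rectint f m b c n + rectint f m b n d).
  have h2 := nrmD (rectint f a m c n) (rectint f a m n d).
  have h3 := nrmD (rectint f m b c n) (rectint f m b n d).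
  have qE : e * (((b - a) / 2) ^+ 2 + ((d - c) / 2) ^+ 2) =
    e * ((b - a) ^+ 2 + (d - c) ^+ 2) / 4 by field.
  move: q1 q2 q3 q4; rewrite /P.
  have -> : m - a = (b - a) / 2 by rewrite /m; clear; lra.
  have -> : b - m = (b - a) / 2 by rewrite /m; clear; lra.
  have -> : n - c = (d - c) / 2 by rewrite /n; clear; lra.
  have -> : d - n = (d - c) / 2 by rewrite /n; clear; lra.
  rewrite qE; move: (e * _) => S; lra.
have [p1 [p2 [hp1 hp2 hp]]] := rect_bisection step ab cd nP.
have [r r0 hr] := rectint_local cf (df _ _ hp1 hp2) e0.
have [a' [b' [c' [d' [h1 h2 h3 h4]]]]] := hp r r0.
by apply; exact: hr.
Qed.

(** Away from the exceptional point Goursat's lemma applies, so the integral equals that over an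
    arbitrarily small square around it, where continuity keeps [f] bounded while the perimeter
    shrinks. *)
Lemma goursat_punctured f a b c d p1 p2 : continuous f ->
  a < p1 < b -> c < p2 < d ->
  (forall x y, a <= x <= b -> c <= y <= d -> pt x y <> pt p1 p2 ->
     differentiable f (pt x y)) ->
  rectint f a b c d = 0.
Proof.
move=> cf /andP[ap pb] /andP[cp pd] df.
set p := pt p1 p2 in df.
have /continuous_nrmP/(_ 1 ltr01)[r r0 hr] := cf p.
pose M := nrm (f p) + 1.
have M0 : 0 < M by rewrite /M; have := nrm_ge0 (f p); lra.
(* The square of half-side [e] contributes at most 4 M (2e + 2e). The condition [e < r / 2] keeps it
   in the ball where [f] is bounded by [M]. *)
suff h e : 0 < e -> e < r / 2 -> e < p1 - a -> e < b - p1 -> e < p2 - c -> e < d - p2 ->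
    nrm (rectint f a b c d) <= 16 * M * e.
  apply: nrm_eq0; apply/eqP; rewrite eq_le nrm_ge0 andbT.
  apply/ler_addgt0Pr => e e0; rewrite add0r.
  have eM : 0 < e / (16 * M) by apply: divr_gt0 => //; lra.
  have [|m m0] := @ex_lt_all _ [:: e / (16 * M); r / 2; p1 - a; b - p1; p2 - c; d - p2].
    by rewrite /= eM/= !subr_gt0 ap pb cp pd divr_gt0.
  rewrite /= ltr_pdivlMr; last lra.
  move=> /and5P[k1 k2 k3 k4 /and3P[k5 k6 _]].
  have : nrm (rectint f a b c d) <= 16 * M * m by exact: h.
  lra.
move=> e0 er e1 e2 e3 e4.
have hor c' d' a' b' : a <= a' -> a' <= b' -> b' <= b -> c <= c' -> c' <= d' -> d' <= d ->
  (p1 < a' \/ b' < p1 \/ p2 < c' \/ d' < p2) -> rectint f a' b' c' d' = 0.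
  move=> h1 h2 h3 h4 h5 h6 h7; apply: (goursat cf h2 h5) => x y /andP[h8 h9] /andP[h10 h11].
  apply: df; [lra|lra|]; case=> ex ey; lra.
(* Four cuts remove the strips to the left, to the right, below and above the small square; none of
   the strips contains the exceptional point. *)
rewrite (@rectint_hsplit f a b c d (p1 - e))//; [|lra..].
rewrite hor; [|lra..]; rewrite add0r.
rewrite (@rectint_hsplit f (p1 - e) b c d (p1 + e))//; [|lra..].
rewrite (@hor c d (p1 + e) b); [|lra..]; rewrite addr0.
rewrite (@rectint_vsplit f (p1 - e) _ c d (p2 - e))//; [|lra..].
rewrite hor; [|lra..]; rewrite add0r.
rewrite (@rectint_vsplit f (p1 - e) _ (p2 - e) d (p2 + e))//; [|lra..].
rewrite (@hor (p2 + e) d); [|lra..]; rewrite addr0.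
have -> : 16 * M * e = 4 * M * (((p1 + e) - (p1 - e)) + ((p2 + e) - (p2 - e))) by lra.
apply: rectint_bound; [lra|lra|exact: continuous_sides|].
move=> z [x [y [-> [/andP[h1 h2] /andP[h3 h4] _]]]].
have hz : nrm (pt x y - p) < r.
  rewrite ptB; apply: le_lt_trans (nrm_pt _ _) _.
  have : `|x - p1| <= e by rewrite ler_norml; lra.
  have : `|y - p2| <= e by rewrite ler_norml; lra.
  lra.
have := hr _ hz; have := nrmD (f (pt x y) - f p) (f p); rewrite subrK /M; lra.
Qed.
End Goursat.

(** * Differentiability depends only on the germ *)

Section NearEq.
Context {R : realType}.
Implicit Types V W : normedModType (Cplx R).

Lemma near_eq_differentiable V W (f g : V -> W) (p : V) :
  (\forall z \near p, f z = g z) -> differentiable f p ->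
  differentiable g p /\ 'd g p = 'd f p :> (V -> W).
Proof.
move=> /near_nrmP[r r0 fg] df.
have [k _ hk] := linear_nrm_bound (diff_continuous df).
apply: (nrm_diff hk) => e e0; have [d d0 hd] := diff_nrm df e0.
exists (Num.min r d); first by rewrite lt_min r0.
move=> v; rewrite lt_min => /andP[vr vd].
rewrite -!fg; first exact: hd.
  by rewrite subrr nrm0.
by rewrite addrC addKr.
Qed.
End NearEq.

(** * Integrals of the Cauchy kernel around the square of half-side 1 *)

Section Cauchy.
Context {R : realType}.
Local Notation C := (Cplx R).
Local Notation Re := (@complex.Re R).
Local Notation Im := (@complex.Im R).
Implicit Types (f g : C -> C) (z w : C).
Local Notation rint f := (rectint f (-1) 1 (-1) 1).
Local Notation sides f := (sides_continuous f (-1) 1 (-1) 1).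
Local Notation bd := (boundary (-1) 1 (-1) 1).

Lemma sides_continuous_at f a b c d :
  (forall x y, (x = a \/ x = b) \/ (y = c \/ y = d) -> {for pt x y, continuous f}) ->
  sides_continuous f a b c d.
Proof.
by move=> h; split=> x; (apply: continuous_comp;
  [by [exact: pt_hcont|exact: pt_vcont]|apply: h; tauto]).
Qed.

Lemma square_side_far z (x y : R) : nrm z <= 1 / 2 ->
  (x = -1 \/ x = 1) \/ (y = -1 \/ y = 1) -> 1 / 2 <= nrm (pt x y - z).
Proof.
move=> hz h.
have hR := Re_le_nrm (pt x y - z); have hI := Im_le_nrm (pt x y - z).
have zR := Re_le_nrm z; have zI := Im_le_nrm z.
rewrite ReB /= in hR; rewrite ImB /= in hI.
have zR' : `|Re z| <= 1 / 2 by lra.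
have zI' : `|Im z| <= 1 / 2 by lra.
move: zR' zI'; rewrite !ler_norml => /andP[a1 a2] /andP[a3 a4].
case: h => -[e|e]; subst.
- apply: le_trans hR; rewrite ler_normr; apply/orP; right; lra.
- apply: le_trans hR; rewrite ler_normr; apply/orP; left; lra.
- apply: le_trans hI; rewrite ler_normr; apply/orP; right; lra.
- apply: le_trans hI; rewrite ler_normr; apply/orP; left; lra.
Qed.

Lemma square_side_far0 (x y : R) :
  (x = -1 \/ x = 1) \/ (y = -1 \/ y = 1) -> 1 <= nrm (pt x y).
Proof.
have hR := Re_le_nrm (pt x y); have hI := Im_le_nrm (pt x y).
rewrite /= in hR hI.
case=> -[e|e]; subst.
- by apply: le_trans hR; rewrite normrN1.
- by apply: le_trans hR; rewrite normr1.
- by apply: le_trans hI; rewrite normrN1.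
- by apply: le_trans hI; rewrite normr1.
Qed.

Lemma boundary_side w : bd w -> exists x y, w = pt x y /\
  ((x = -1 \/ x = 1) \/ (y = -1 \/ y = 1)).
Proof. by move=> [x [y [-> [_ _ h]]]]; exists x, y. Qed.

Lemma kernel_diff z w : w != z ->
  differentiable (fun w : C => (w - z)^-1) w /\
  forall h, 'd (fun w : C => (w - z)^-1) w h = - (w - z) ^- 2 * h.
Proof.
move=> wz; have dsub : is_diff w (fun w : C => w - z) (fun h : C => h).
  have := is_diffB (is_diff_id w) (is_diff_cst z w).
  by move=> h; apply: is_diff_eq h _; apply/funext => h /=; rewrite !fctE subr0.
have nz : w - z != 0 by rewrite subr_eq0.
have ds : differentiable (fun w : C => w - z) w by exact: ex_diff.
split; first exact: (@differentiableV C C (fun w : C => w - z) w ds nz).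
move=> h; rewrite (@diffV C C (fun w : C => w - z) w ds nz) /=.
by rewrite diff_val.
Qed.

Lemma kernel_continuous z w : w != z -> {for w, continuous (fun w : C => (w - z)^-1)}.
Proof. by move=> /kernel_diff[d _]; exact: differentiable_continuous d. Qed.

Lemma kernel2_continuous z w : w != z -> {for w, continuous (fun w : C => (w - z)^-1 ^+ 2)}.
Proof.
move=> /kernel_diff[d _]; apply: (@differentiable_continuous C C C).
exact: (@differentiableX C C (fun w : C => (w - z)^-1) 1 w d).
Qed.

Lemma far_neq (z w : C) : 1 / 2 <= nrm (w - z) -> w != z.
Proof.
move=> h; apply/eqP => e; move: h; rewrite e subrr nrm0; lra.
Qed.

Lemma cint_cst a b (k : C) : a <= b -> cint a b (fun=> k) = k * (b - a)%:C.
Proof.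
move=> ab; rewrite /cint !Rintegral_cst//= lebesgue_measure_itv/= lte_fin.
move: ab; rewrite le_eqVlt => /predU1P[->|ab]; rewrite ?ltxx ?ab/= ?subrr;
  by case: k => k l /=; congr (_ +i* _)%C; ring.
Qed.

(* This is 2 pi i inside the square; only its constancy and nonvanishing are used. *)
Definition winding z : C := rint (fun w => (w - z)^-1).

Lemma cintB a b (f g : R -> C) : continuous f -> continuous g ->
  cint a b f - cint a b g = cint a b (fun x => f x - g x).
Proof.
move=> cf cg.
have cfg : continuous (fun x => f x - g x).
  by move=> x; exact: (@cvgB _ C _ _ _ _ _ _ _ (cf x) (cg x)).
apply/eqP; rewrite subr_eq -cintD//; apply/eqP.
by apply: eq_cint => x _; rewrite subrK.
Qed.

(** Pairing opposite sides turns the integral into 4i times that of 1 / (1 + x^2) over [-1, 1], and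
    a crude lower bound replaces its exact value. *)
Lemma winding0_ge : 2 <= nrm (winding 0).
Proof.
pose h (x : R) : C := ((1 + x ^+ 2)^-1)%:C.
have h0 (x : R) : 0 < 1 + x ^+ 2 by rewrite ltr_wpDr// sqr_ge0.
have sides0 : sides (fun w => (w - 0)^-1).
  apply: sides_continuous_at => x y /square_side_far0 hw; apply: kernel_continuous.
  by apply/eqP => e; move: hw; rewrite e nrm0; lra.
have [k1 k2 k3 k4] := sides0.
have key (u v n : C) : u * v = n -> n != 0 -> (u - 0)^-1 - (v - 0)^-1 = (v - u) * n^-1.
  move=> <-; rewrite mulf_eq0 negb_or => /andP[u0 v0]; rewrite !subr0.
  by field; rewrite u0 v0.
have i1 (x : R) : (pt x (-1) - 0)^-1 - (pt x 1 - 0)^-1 = pt 0 2 * h x.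
  rewrite (key _ _ (1 + x ^+ 2)%:C).
  - rewrite /h fmorphV/=; congr (_ * _).
    by rewrite /pt; congr (_ +i* _)%C; ring.
  - by rewrite /pt; congr (_ +i* _)%C; ring.
  - by rewrite -[0]/(0%:C) (inj_eq (@complexI _)) gt_eqF.
have i2 (y : R) : (pt 1 y - 0)^-1 - (pt (-1) y - 0)^-1 = pt 2 0 * h y.
  rewrite (key _ _ (- (1 + y ^+ 2))%:C).
  - rewrite /h rmorphN/= invrN fmorphV/= mulrN -mulNr; congr (_ * _).
    by rewrite /pt; congr (_ +i* _)%C; ring.
  - by rewrite /pt; congr (_ +i* _)%C; ring.
  - by rewrite -[0]/(0%:C) (inj_eq (@complexI _)) oppr_eq0 gt_eqF.
have ch : continuous h.
  have -> : h = fun x => (pt 0 2)^-1 * ((pt x (-1) - 0)^-1 - (pt x 1 - 0)^-1).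
    apply/funext => x; rewrite i1 mulKf//; apply/eqP => -[] /eqP.
    by rewrite pnatr_eq0.
  move=> x; apply: cvgM; first exact: cvg_cst.
  exact: (@cvgB _ C _ _ _ _ _ _ _ (k1 x) (k2 x)).
have -> : winding 0 = pt 0 4 * cint (-1) 1 h.
  rewrite /winding /rectint (cintB _ _ k1 k2) (cintB _ _ k4 k3).
  rewrite (eq_cint (g := fun x => pt 0 2 * h x)); last by move=> x _; exact: i1.
  rewrite (eq_cint (f := fun y => (pt 1 y - 0)^-1 - _) (g := fun x => pt 2 0 * h x)); last by move=> x _; exact: i2.
  rewrite (cintZ _ _ (pt 0 2) ch) (cintZ _ _ (pt 2 0) ch) mulrA -mulrDl; congr (_ * _).
  by rewrite /pt; congr (_ +i* _)%C; ring.
(* On [-1, 1] the function [h] takes values in [1/2, 1], hence stays within 1/4 of 3/4. Its integral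
   is at least 3/2 - 1 in absolute value, where the 1 is the bound [b1]. *)
pose q : C := (3 / 4 : R)%:C.
have cc : continuous (fun _ : R => q) by move=> x; exact: (cvg_cst q).
have cg : continuous (fun x => h x - q).
  by move=> x; exact: (@cvgB _ C _ _ _ _ _ _ _ (ch x) (cc x)).
have b1 : nrm (cint (-1) 1 (fun x => h x - q)) <= 2 * (1 / 4) * (1 - -1).
  apply: (cint_bound cg) => [|x /andP[x1 x2]]; first lra.
  have -> : h x - q = ((1 + x ^+ 2)^-1 - 3 / 4)%:C by rewrite rmorphB.
  rewrite nrm_real ler_norml.
  have x21 : x ^+ 2 <= 1 by nra.
  have i21 : (1 + x ^+ 2)^-1 <= 1 by rewrite invf_le1//; have := sqr_ge0 x; lra.
  have i22 : 1 / 2 <= (1 + x ^+ 2)^-1.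
    by rewrite div1r lef_pV2 ?posrE//; lra.
  by apply/andP; split; lra.
rewrite nrmM.
have n4 : nrm (pt 0 4 : C) = 4.
  by rewrite [LHS]nrm_normc /= expr0n/= add0r sqrtr_sqr ger0_norm.
have n3 : nrm (cint (-1) 1 (fun=> q)) = 3 / 2.
  rewrite (@cint_cst (-1) 1 q); last lra.
  rewrite nrmM !nrm_real !ger0_norm; lra.
rewrite -(cintB _ _ ch cc) in b1.
have := nrmB (cint (-1) 1 h - cint (-1) 1 (fun=> q)) (cint (-1) 1 h).
have -> : cint (-1) 1 h - cint (-1) 1 (fun=> q) - cint (-1) 1 h =
   - cint (-1) 1 (fun=> q) by ring.
rewrite n4 nrmN n3; lra.
Qed.

Lemma sides_continuousD f g a b c d : sides_continuous f a b c d ->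
  sides_continuous g a b c d -> sides_continuous (fun w => f w + g w) a b c d.
Proof.
move=> [h1 h2 h3 h4] [k1 k2 k3 k4]; split=> x.
- exact: (@cvgD _ C _ _ _ _ _ _ _ (h1 x) (k1 x)).
- exact: (@cvgD _ C _ _ _ _ _ _ _ (h2 x) (k2 x)).
- exact: (@cvgD _ C _ _ _ _ _ _ _ (h3 x) (k3 x)).
- exact: (@cvgD _ C _ _ _ _ _ _ _ (h4 x) (k4 x)).
Qed.

(** Expand 1 / (w - z') in powers of z' - z, with second-order remainder [r]. The linear term [k]
    has the primitive -1 / (w - z) up to a constant factor and integrates to 0. *)
Lemma winding_local z z' : nrm z <= 1 / 2 -> nrm z' <= 1 / 2 ->
  nrm (winding z' - winding z) <= 128 * nrm (z' - z) ^+ 2.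
Proof.
move=> hz hz'.
pose k (w : C) := (z' - z) * (w - z)^-1 ^+ 2.
pose r (w : C) := (z' - z) ^+ 2 * ((w - z)^-1 ^+ 2 * (w - z')^-1).
have s1 : sides (fun w => (w - z)^-1).
  by apply: sides_continuous_at => x y /(square_side_far hz)/far_neq/kernel_continuous.
have s2 : sides (fun w => (w - z)^-1 ^+ 2).
  by apply: sides_continuous_at => x y /(square_side_far hz)/far_neq/kernel2_continuous.
have s3 : sides (fun w => (w - z)^-1 ^+ 2 * (w - z')^-1).
  apply: sides_continuous_at => x y hxy.
  exact: cvgM (kernel2_continuous (far_neq (square_side_far hz hxy)))
    (kernel_continuous (far_neq (square_side_far hz' hxy))).
have s4 := sides_continuousZ (z' - z) s2.
have s5 := sides_continuousZ ((z' - z) ^+ 2) s3.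
have lt1 : -1 <= 1 :> R by lra.
have e1 : winding z' = winding z + (rint k + rint r).
  rewrite /winding -(rectintD s4 s5) -(rectintD s1 (sides_continuousD s4 s5)).
  apply: eq_rectint => // w /boundary_side[x [y [-> hxy]]].
  have := far_neq (square_side_far hz hxy); have := far_neq (square_side_far hz' hxy).
  rewrite -!(subr_eq0 (pt x y)) /k /r => n1 n2.
  by field; rewrite n1 n2.
have e2 : rint k = 0.
  suff e0 : rint (fun w => (w - z)^-1 ^+ 2) = 0 by rewrite /k (rectintZ _ s2) e0 mulr0.
  apply: (rectint_primitive (F := fun w => - (w - z)^-1) lt1 lt1 s2) => x y hxy.
  have [d1 d2] := kernel_diff (far_neq (square_side_far hz hxy)).
  split; first exact: (@differentiableN C C C _ _ d1).
  move=> h; rewrite (@diffN C C C _ _ d1) fctE d2.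
  by rewrite mulNr opprK exprVn.
rewrite e1 e2 add0r addrAC subrr add0r /r (rectintZ _ s3) nrmM nrmX mulrC.
rewrite ler_wpM2r ?exprn_ge0 ?nrm_ge0//.
(* The remaining kernel is at most 2^2 * 2 = 8, since both points are at distance at least 1/2 from
   the boundary; the rest is [rectint_bound] on sides of length 2. *)
have -> : 128 = 4 * 8 * ((1 - -1) + (1 - -1)) :> R by lra.
apply: rectint_bound => // w /boundary_side[x [y [-> hxy]]].
have := square_side_far hz hxy; have := square_side_far hz' hxy.
rewrite nrmM nrmX !nrmV => n1 n2.
have e3 (t : R) : 1 / 2 <= t -> t^-1 <= 2.
  move=> ht; rewrite -[2]invrK lef_pV2 ?posrE ?invr_gt0//; lra.
have i0 (v : C) : 0 <= (nrm v)^-1 by rewrite invr_ge0 nrm_ge0.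
have -> : 8 = 2 ^+ 2 * 2 :> R by ring.
by apply: ler_pM; rewrite ?exprn_ge0 ?e3// lerXn2r ?nnegrE ?e3.
Qed.

(** Quadratic increments force constancy: cutting the segment from 0 to [z] into n pieces gives a
    total variation of at most n * 128 (|z| / n)^2. *)
Lemma winding_cst z : nrm z <= 1 / 2 -> winding z = winding 0.
Proof.
move=> hz; apply/eqP; rewrite -subr_eq0; apply/eqP/nrm_eq0/eqP.
rewrite eq_le nrm_ge0 andbT.
pose u (n j : nat) : C := (j%:R / n%:R)%:C * z.
have hu n j : (j <= n.+1)%N -> nrm (u n.+1 j) <= 1 / 2.
  move=> jn; rewrite nrmM nrm_real ger0_norm ?divr_ge0//.
  apply: le_trans hz; rewrite ler_piMl ?nrm_ge0//.
  by rewrite ler_pdivrMr// mul1r ler_nat.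
have step n j : (j <= n.+1)%N ->
    nrm (winding (u n.+1 j) - winding 0) <= j%:R * (128 * (nrm z / n.+1%:R) ^+ 2).
  elim: j => [_|j ih jn].
    by rewrite /u mul0r mul0r subrr nrm0 mul0r.
  have -> : winding (u n.+1 j.+1) - winding 0 =
     (winding (u n.+1 j.+1) - winding (u n.+1 j)) + (winding (u n.+1 j) - winding 0) by rewrite addrA subrK.
  apply: le_trans (nrmD _ _) _; rewrite -[j.+1%:R]natr1 mulrDl mul1r addrC.
  apply: lerD; first exact/ih/ltnW.
  apply: le_trans (winding_local (hu _ _ (ltnW jn)) (hu _ _ jn)) _.
  rewrite ler_wpM2l//.
  rewrite /u -mulrBl -rmorphB/= nrmM nrm_real -mulrBl -natrB// subSnn div1r.
  by rewrite ger0_norm ?invr_ge0// mulrC.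
apply/ler_addgt0Pr => e e0; rewrite add0r.
pose n := Num.truncn (128 / e).
have hn : 128 / e < n.+1%:R by exact: truncnS_gt.
have := step n n.+1 (leqnn _).
rewrite {1}/u divff ?pnatr_eq0// mul1r => /le_trans; apply.
have n0 : 0 < n.+1%:R :> R by rewrite ltr0n.
have -> : n.+1%:R * (128 * (nrm z / n.+1%:R) ^+ 2) = 128 * nrm z ^+ 2 / n.+1%:R.
  by field; rewrite gt_eqF.
rewrite ler_pdivrMr// ltr_pdivrMr// in hn *.
have : nrm z ^+ 2 <= 1 by have := nrm_ge0 z; nra.
rewrite mulrC in hn; lra.
Qed.
End Cauchy.

(** * Cauchy's formula and estimates *)

Section Taylor.
Context {R : realType}.
Local Notation C := (Cplx R).
Local Notation Re := (@complex.Re R).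
Local Notation Im := (@complex.Im R).
Implicit Types (f g : C -> C) (z w : C).
Local Notation rint f := (rectint f (-1) 1 (-1) 1).
Local Notation sides f := (sides_continuous f (-1) 1 (-1) 1).
Local Notation bd := (boundary (-1) 1 (-1) 1).

(** The value at [w = z] removes the singularity: the quotient becomes continuous there, which is
    all that [goursat_punctured] asks at one point. *)
Definition divided f z w : C := if w == z then 'd f z 1 else (f w - f z) * (w - z)^-1.

Lemma near_neq z w : w != z -> \forall v \near w, (v : C) != z.
Proof.
move=> wz; apply/near_nrmP; exists (nrm (w - z)).
  by rewrite nrm_gt0// subr_eq0.
move=> v; rewrite nrmC => hv; apply/eqP => vz; move: hv.
by rewrite vz ltxx.
Qed.

Lemma divided_near f z w : w != z ->
  \forall v \near w, (f v - f z) * (v - z)^-1 = divided f z v.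
Proof.
by move=> /near_neq; apply: filterS => v vz; rewrite /divided (negbTE vz).
Qed.

Lemma divided_continuous f z : continuous f -> differentiable f z ->
  continuous (divided f z).
Proof.
move=> cf df w; have [->|wz] := eqVneq w z.
  apply/continuous_nrmP => e e0; have e2 : 0 < e / 2 by lra.
  have [d d0 hd] := diff_nrm df e2; exists d => // v hv.
  rewrite /divided eqxx; case: eqP => [_|/eqP vz]; first by rewrite subrr nrm0.
  have nz : 0 < nrm (v - z) by rewrite nrm_gt0// subr_eq0.
  have nz' : v - z != 0 by rewrite subr_eq0.
  have -> : (f v - f z) / (v - z) - 'd f z 1 = (f v - f z - 'd f z 1 * (v - z)) / (v - z).
    by field.
  rewrite nrmM nrmV ltr_pdivrMr//.
  have h1 := hd _ hv; rewrite [z + _]addrC subrK (diff_CE f z (v - z)) in h1.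
  by apply: (le_lt_trans h1); rewrite ltr_pM2r//; lra.
have cq : {for w, continuous (fun v : C => (f v - f z) * (v - z)^-1)}.
  exact: cvgM (@cvgB _ C _ _ _ _ _ _ _ (cf w) (cvg_cst (f z))) (kernel_continuous wz).
apply: cvg_trans (near_eq_cvg (divided_near f wz)) _.
by rewrite /divided (negbTE wz); exact: cq.
Qed.

Lemma divided_differentiable f z w : w != z -> differentiable f w ->
  differentiable (divided f z) w.
Proof.
move=> wz df; apply: (near_eq_differentiable (divided_near f wz) _).1.
have [dk _] := kernel_diff wz.
have dc : differentiable (cst (f z) : C -> C) w by exact: differentiable_cst.
exact: (@differentiableM C C _ _ w (differentiableB df dc) dk).
Qed.

(** On the boundary f(w) / (w - z) is the divided difference plus f(z) / (w - z), and the divided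
    difference integrates to 0. The factor [winding z] stands in for 2 pi i. *)
Lemma cauchy_formula f z : continuous f -> nrm z <= 1 / 2 ->
  (forall x y : R, -1 <= x <= 1 -> -1 <= y <= 1 -> differentiable f (pt x y)) ->
  rint (fun w => f w * (w - z)^-1) = f z * winding z.
Proof.
move=> cf hz df.
have [zR zI] : `|Re z| <= 1 / 2 /\ `|Im z| <= 1 / 2.
  by split; apply: le_trans hz; [exact: Re_le_nrm|exact: Im_le_nrm].
have zE : z = pt (Re z) (Im z) by case: (z).
move: zR zI; rewrite !ler_norml => zR zI.
have dz : differentiable f z by rewrite zE; apply: df; lra.
have cd := divided_continuous cf dz.
have s1 : sides (fun w => (w - z)^-1).
  by apply: sides_continuous_at => x y /(square_side_far hz)/far_neq/kernel_continuous.
have lt1 : -1 <= 1 :> R by lra.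
have e0 : rint (divided f z) = 0.
  have p1 : -1 < Re z < 1 by lra.
  have p2 : -1 < Im z < 1 by lra.
  apply: (goursat_punctured cd p1 p2) => x y hx hy; rewrite -zE => hxy; apply: divided_differentiable.
    exact/eqP.
  exact: df.
have -> : f z * winding z = rint (divided f z) + rint (fun w => f z * (w - z)^-1).
  by rewrite e0 add0r (rectintZ _ s1).
rewrite -(rectintD (continuous_sides _ _ _ _ cd) (sides_continuousZ (f z) s1)).
apply: eq_rectint => // w /boundary_side[x [y [-> /(square_side_far hz)/far_neq hw]]].
by rewrite /divided (negbTE hw) -mulrDl subrK.
Qed.

(** Cauchy's formulas at [z] and at 0 share the constant [c = winding 0], so they can be subtracted
    and the kernel expanded to second order at 0. The integrals [B] and [rint r] are at most 16 M
    and 32 M, and dividing by [c], of modulus at least 2, gives 8 M and 16 M. *)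
Lemma taylor_continuous f (M : R) : continuous f ->
  (forall x y : R, -1 <= x <= 1 -> -1 <= y <= 1 ->
     differentiable f (pt x y) /\ nrm (f (pt x y)) <= M) ->
  nrm ('d f (0 : C) 1) <= 8 * M /\
  forall z, nrm z <= 1 / 2 -> nrm (f z - f 0 - 'd f (0 : C) 1 * z) <= 16 * M * nrm z ^+ 2.
Proof.
move=> cf hf.
have df (x y : R) : -1 <= x <= 1 -> -1 <= y <= 1 -> differentiable f (pt x y).
  by move=> hx hy; have [] := hf _ _ hx hy.
have lt1 : -1 <= 1 :> R by lra.
have M0 : 0 <= M.
  have h01 : -1 <= (0 : R) <= 1 by lra.
  have [_] := hf 0 0 h01 h01; apply: le_trans; exact: nrm_ge0.
have h0 : nrm (0 : C) <= 1 / 2 by rewrite nrm0; lra.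
have sk0 : sides (fun w => f w * (w - 0)^-1).
  apply: sides_continuous_at => x y /(square_side_far h0)/far_neq hw.
  exact: cvgM (cf (pt x y)) (kernel_continuous hw).
have sk1 : sides (fun w => f w * (w - 0)^-1 ^+ 2).
  apply: sides_continuous_at => x y /(square_side_far h0)/far_neq hw.
  exact: cvgM (cf (pt x y)) (kernel2_continuous hw).
have bM w : bd w -> nrm (f w) <= M /\ 1 <= nrm w.
  move=> [x [y [-> [hx hy hxy]]]]; split; last exact: square_side_far0.
  by have [] := hf _ _ hx hy.
pose c := winding (0 : C).
have c2 : 2 <= nrm c by exact: winding0_ge.
have c0 : c != 0 by apply/eqP => e; move: c2; rewrite e nrm0; lra.
pose B := rint (fun w => f w * (w - 0)^-1 ^+ 2).
have inv1 (t : R) : 1 <= t -> 0 <= t^-1 <= 1.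
  move=> ht; rewrite invr_ge0 (le_trans _ ht)//= invf_le1//; lra.
have hB : nrm B <= 16 * M.
  have -> : 16 * M = 4 * M * ((1 - -1) + (1 - -1)) by lra.
  apply: (rectint_bound lt1 lt1 sk1) => w /bM[w1 w2].
  rewrite subr0 nrmM nrmX nrmV -[leRHS]mulr1.
  have /andP[i0 i1] := inv1 _ w2.
  by apply: ler_pM; rewrite ?nrm_ge0 ?exprn_ge0 ?exprn_ile1.
have key z : nrm z <= 1 / 2 -> nrm (f z - f 0 - B / c * z) <= 16 * M * nrm z ^+ 2.
  move=> hz.
  have e1 := cauchy_formula cf hz df.
  have e0 := cauchy_formula cf h0 df.
  rewrite (winding_cst hz) -/c in e1; rewrite -/c in e0.
  pose r (w : C) := f w * ((w - 0)^-1 ^+ 2 * (w - z)^-1).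
  have sr : sides r.
    apply: sides_continuous_at => x y hxy.
    have k1 := kernel2_continuous (far_neq (square_side_far h0 hxy)).
    have k2 := kernel_continuous (far_neq (square_side_far hz hxy)).
    exact: cvgM (cf (pt x y)) (cvgM k1 k2).
  have e2 : rint (fun w => f w * (w - z)^-1) =
      rint (fun w => f w * (w - 0)^-1) + (z * B + z ^+ 2 * rint r).
    rewrite /B -(rectintZ _ sk1) -(rectintZ _ sr).
    rewrite -(rectintD (sides_continuousZ z sk1) (sides_continuousZ (z ^+ 2) sr)).
    rewrite -(rectintD sk0 (sides_continuousD (sides_continuousZ z sk1) (sides_continuousZ (z ^+ 2) sr))).
    apply: eq_rectint => // w /boundary_side[x [y [-> hxy]]].
    have := far_neq (square_side_far hz hxy); have := far_neq (square_side_far h0 hxy).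
    rewrite /r !subr0 -(subr_eq0 _ z) => n1 n2.
    by field; rewrite n1 n2.
  rewrite e1 e0 in e2.
  have -> : f z - f 0 - B / c * z = z ^+ 2 * rint r / c.
    apply: (mulIf c0); rewrite divfK// !mulrBl e2.
    by field.
  rewrite nrmM nrmV [nrm (_ * rint r)]nrmM nrmX ler_pdivrMr; last lra.
  have hr : nrm (rint r) <= 4 * (M * 2) * ((1 - -1) + (1 - -1)).
    apply: (rectint_bound lt1 lt1 sr) => w bw; have [w1 w2] := bM _ bw.
    have [x [y [e hxy]]] := boundary_side bw.
    have w3 := square_side_far hz hxy; rewrite -e in w3.
    rewrite /r subr0 nrmM [nrm (w^-1 ^+ 2 * _)]nrmM nrmX !nrmV.
    have /andP[i0 i1] := inv1 _ w2.
    have i2 : (nrm (w - z))^-1 <= 2.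
      rewrite -[2]invrK lef_pV2 ?posrE ?invr_gt0//; lra.
    apply: ler_pM; rewrite ?mulr_ge0 ?nrm_ge0 ?exprn_ge0 ?invr_ge0 ?nrm_ge0//.
    by rewrite -[2]mul1r; apply: ler_pM; rewrite ?exprn_ge0 ?exprn_ile1 ?invr_ge0 ?nrm_ge0.
  have z2 : 0 <= nrm z ^+ 2 by rewrite sqr_ge0.
  have hr2 : nrm (rint r) <= 32 * M by lra.
  have := ler_wpM2l z2 hr2.
  have : 0 <= 16 * M * nrm z ^+ 2 * (nrm c - 2) by rewrite mulr_ge0 ?subr_ge0// mulr_ge0// mulr_ge0.
  lra.
(* Both slopes approximate [f] at 0 to first order, hence agree: compare the two approximations at a
   small real [t]. The choice of [t] makes 16 M t at most e / 2. *)
have dB : 'd f (0 : C) 1 = B / c.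
  have d0 : differentiable f (0 : C).
    by have -> : (0 : C) = pt 0 0 by []; apply: df; lra.
  apply/eqP; rewrite -subr_eq0; apply/eqP/nrm_eq0/eqP.
  rewrite eq_le nrm_ge0 andbT; apply/ler_addgt0Pr => e e0; rewrite add0r.
  have e2 : 0 < e / 2 by lra.
  have [d d00 hd] := diff_nrm d0 e2.
  have M1 : 0 < 32 * M + 1 by lra.
  have [|t t0 /= /and4P[t1 t2 t3 _]] := @ex_lt_all _ [:: d; 1 / 2; e / (32 * M + 1)].
    by rewrite /= d00 divr_gt0//= divr_gt0.
  have nt : nrm (t%:C : C) = t by rewrite nrm_real (ger0_norm (ltW t0)).
  have h1 := hd t%:C; rewrite nt add0r in h1; have {}h1 := h1 t1.
  have h2 := key t%:C; rewrite nt in h2; have {}h2 := h2 (ltW t2).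
  rewrite diff_CE in h1.
  have := nrmB (f t%:C - f 0 - B / c * t%:C) (f t%:C - f 0 - 'd f (0 : C) 1 * t%:C).
  have -> : f t%:C - f 0 - B / c * t%:C - (f t%:C - f 0 - 'd f (0 : C) 1 * t%:C) =
    ('d f (0 : C) 1 - B / c) * t%:C by ring.
  rewrite nrmM nt => h3.
  rewrite ltr_pdivlMr// in t3.
  have : nrm ('d f (0 : C) 1 - B / c) * t <= e * t by nra.
  by rewrite ler_pM2r.
rewrite dB; split=> //.
rewrite nrmM nrmV ler_pdivrMr; last lra.
nra.
Qed.
End Taylor.

(** * Cauchy estimates on discs and on balls of normed spaces *)

Section CauchyEstimates.
Context {R : realType}.
Local Notation C := (Cplx R).
Local Notation Re := (@complex.Re R).
Local Notation Im := (@complex.Im R).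
Implicit Types (V : normedModType C).

(* Composing with the retraction onto a square makes a function holomorphic near it continuous on C,
   as Goursat's lemma requires. *)
Definition clamp (x : R) : R := Num.max (- (3 / 2)) (Num.min (3 / 2) x).

Lemma clamp_bound x : `|clamp x| <= 3 / 2.
Proof.
rewrite ler_norml /clamp le_max lexx/= ge_max ge_min lexx/= andbT.
lra.
Qed.

Lemma clamp_id x : `|x| <= 3 / 2 -> clamp x = x.
Proof. by rewrite ler_norml => /andP[a b]; rewrite /clamp min_r// max_r. Qed.

Lemma clamp_lip x y : `|clamp x - clamp y| <= `|x - y|.
Proof.
wlog xy : x y / x <= y.
  move=> h; have [xy|/ltW yx] := leP x y; first exact: h.
  by rewrite distrC [leRHS]distrC; exact: h.
have -> : `|x - y| = y - x by rewrite ler0_norm; lra.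
rewrite ler_norml.
have spec t : [\/ t <= - (3 / 2) /\ clamp t = - (3 / 2),
    - (3 / 2) <= t <= 3 / 2 /\ clamp t = t | 3 / 2 <= t /\ clamp t = 3 / 2].
  rewrite /clamp; have [h|h] := leP (3 / 2) t.
    by constructor 3; rewrite max_r//; lra.
  have [h'|h'] := leP (- (3 / 2)) t; [constructor 2|constructor 1]; lra.
by case: (spec x) => -[hx ->]; case: (spec y) => -[hy ->]; lra.
Qed.

Definition clampC (z : C) : C := pt (clamp (Re z)) (clamp (Im z)).

Lemma clampC_continuous : continuous clampC.
Proof.
move=> p; apply/continuous_nrmP => e e0; exists (e / 2); first lra.
move=> z hz; rewrite /clampC ptB; apply: le_lt_trans (nrm_pt _ _) _.
have h1 := clamp_lip (Re z) (Re p); have h2 := clamp_lip (Im z) (Im p).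
have h3 := Re_le_nrm (z - p); have h4 := Im_le_nrm (z - p).
rewrite ReB in h3; rewrite ImB in h4; lra.
Qed.

(** The retraction has values in the square of half-side 3/2, hence in the disc of radius 3. That
    square is a neighborhood of the unit one, so near each point of the latter [g] agrees with [f]
    and inherits its differentiability. *)
Lemma taylor_disc (f : C -> C) (M : R) :
  (forall w : C, nrm w <= 3 -> differentiable f w /\ nrm (f w) <= M) ->
  nrm ('d f (0 : C) 1) <= 8 * M /\
  forall z : C, nrm z <= 1 / 2 -> nrm (f z - f 0 - 'd f (0 : C) 1 * z) <= 16 * M * nrm z ^+ 2.
Proof.
move=> hf; pose g (w : C) := f (clampC w).
have n3 w : nrm (clampC w) <= 3.
  apply: le_trans (nrm_pt _ _) _.
  by have := clamp_bound (Re w); have := clamp_bound (Im w); lra.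
have near_id (w : C) : `|Re w| <= 1 -> `|Im w| <= 1 -> \forall v \near w, f v = g v.
  move=> w1 w2; apply/near_nrmP; exists (1 / 2); first lra.
  move=> v hv; rewrite /g /clampC.
  have h3 := Re_le_nrm (v - w); have h4 := Im_le_nrm (v - w).
  rewrite ReB in h3; rewrite ImB in h4.
  have h5 := ler_normD (Re v - Re w) (Re w); have h6 := ler_normD (Im v - Im w) (Im w).
  rewrite !subrK in h5 h6.
  rewrite !clamp_id; [by case: (v)|lra|lra].
have cg : continuous g.
  move=> w; apply: continuous_comp; first exact: clampC_continuous.
  exact: (differentiable_continuous (hf _ (n3 w)).1).
have near0 : \forall v \near (0 : C), f v = g v.
  by apply: near_id; rewrite /= normr0.
have d0 : differentiable f (0 : C) by apply: (hf _ _).1; rewrite nrm0.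
have /(congr1 (fun k => k 1)) e1 := (near_eq_differentiable near0 d0).2.
rewrite -e1.
have key := @taylor_continuous R g M cg.
have [|k1 k2] := key.
  move=> x y hx hy; split; last exact: (hf _ (n3 _)).2.
  have nx : `|x| <= 1 by rewrite ler_norml.
  have ny : `|y| <= 1 by rewrite ler_norml.
  apply: (near_eq_differentiable (near_id (pt x y) nx ny) _).1.
  apply: (hf _ _).1; apply: le_trans (nrm_pt _ _) _; lra.
split; first exact: k1.
move=> z hz; have k3 := k2 z hz.
have fg w : nrm w <= 1 / 2 -> g w = f w.
  move=> hw; rewrite /g /clampC.
  have := Re_le_nrm w; have := Im_le_nrm w => h1 h2.
  rewrite !clamp_id; [by case: (w)|lra|lra].
have h0 : nrm (0 : C) <= 1 / 2 by rewrite nrm0; lra.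
by rewrite (fg z hz) (fg 0 h0) in k3.
Qed.

(** Restrict [h] to the complex line through [p] directed by [v], with a direction [u] of length r /
    4 so that parameters up to 3 stay in the ball. Then v = 4 (|v| / r) u, which turns 8 M and 16 M
    into 32 M and 256 M, and the condition |v| <= r / 8 into a parameter of size at most 1/2. *)
Lemma taylor_ball V (h : V -> C) (p : V) (r M : R) : 0 < r ->
  (forall q, nrm (q - p) < r -> differentiable h q /\ nrm (h q) <= M) ->
  (forall v, nrm ('d h p v) <= 32 * M * (nrm v / r)) /\
  (forall v, nrm v <= r / 8 -> nrm (h (p + v) - h p - 'd h p v) <= 256 * M * (nrm v / r) ^+ 2).
Proof.
move=> r0 hh.
have hp : nrm (p - p) < r by rewrite subrr nrm0.
have [dp hM] := hh _ hp.
have M0 : 0 <= M by apply: le_trans hM; exact: nrm_ge0.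
suff key v : v != 0 -> nrm ('d h p v) <= 32 * M * (nrm v / r) /\
  (nrm v <= r / 8 -> nrm (h (p + v) - h p - 'd h p v) <= 256 * M * (nrm v / r) ^+ 2).
  split=> v; have [->|v0] := eqVneq v 0.
  - by rewrite linear0 !nrm0 mul0r mulr0.
  - exact: (key v v0).1.
  - by rewrite addr0 linear0 subr0 subrr !nrm0 mul0r expr0n/= mulr0.
  - exact: (key v v0).2.
move=> v0; have nv := nrm_gt0 v0.
pose u := (r / 4 / nrm v)%:C *: v.
have nu : nrm u = r / 4.
  by rewrite nrmZ nrm_real ger0_norm ?divfK ?gt_eqF// !divr_ge0// ltW.
pose f (t : C) := h (p + t *: u).
have dline (t : C) : is_diff t (fun t : C => p + t *: u) (fun t => t *: u).
  have := is_diffD (is_diff_cst p t) (is_diff_scalel t u).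
  by move=> hd; apply: is_diff_eq hd _; rewrite add0r.
have hball (t : C) : nrm t <= 3 -> nrm (p + t *: u - p) < r.
  move=> ht; rewrite addrAC subrr add0r nrmZ nu; nra.
have df (t : C) : nrm t <= 3 -> differentiable f t /\ nrm (f t) <= M.
  move=> ht; have [d1 d2] := hh _ (hball t ht); split=> //.
  exact: (@differentiable_comp _ _ _ _ _ h t (ex_diff (is_diff_def := dline t)) d1).
have df0 (t : C) : 'd f (0 : C) t = t * 'd h p u.
  have d1 : differentiable (fun t : C => p + t *: u) (0 : C) := ex_diff (is_diff_def := dline 0).
  have d2 : differentiable h (p + 0 *: u) by rewrite scale0r addr0.
  have := @diff_comp _ _ _ _ (fun t : C => p + t *: u) h (0 : C) d1 d2.
  move=> e; rewrite [LHS](congr1 (fun k => k t) e) /= (diff_val (is_diff_def := dline 0)).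
  by rewrite scale0r addr0 linearZ.
have [k1 k2] := taylor_disc df.
rewrite df0 mul1r in k1.
have vE : v = (4 * (nrm v / r))%:C *: u.
  rewrite scalerA -rmorphM/=.
  have -> : 4 * (nrm v / r) * (r / 4 / nrm v) = 1 by field; rewrite !gt_eqF.
  by rewrite scale1r.
have t0 : 0 <= nrm v / r by rewrite divr_ge0// ltW.
have nt : nrm ((4 * (nrm v / r))%:C : C) = 4 * (nrm v / r) by rewrite nrm_real ger0_norm// mulr_ge0.
split.
  have e1 : 'd h p v = (4 * (nrm v / r))%:C * 'd h p u by rewrite {1}vE linearZ.
  rewrite e1 nrmM nt; nra.
move=> hv; have := k2 (4 * (nrm v / r))%:C; rewrite nt.
have : nrm v / r <= 1 / 8 by rewrite ler_pdivrMr//; lra.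
move=> h8 /(_ ltac:(lra)).
rewrite /f -vE scale0r addr0 df0 mul1r.
have e1 : 'd h p v = (4 * (nrm v / r))%:C * 'd h p u by rewrite {1}vE linearZ.
rewrite [_ * _%:C]mulrC -e1.
by rewrite exprMn; lra.
Qed.
End CauchyEstimates.

(** * Limits of holomorphic functions *)

Section Weierstrass.
Context {R : realType}.
Local Notation C := (Cplx R).
Local Notation Re := (@complex.Re R).
Local Notation Im := (@complex.Im R).
Implicit Types (V : normedModType C).

Lemma le_limP (x y K : R) : 0 <= K -> (forall n, x <= y + K / 2 ^+ n) -> x <= y.
Proof.
move=> K0 h; apply/ler_addgt0Pr => e e0.
pose n := Num.truncn (K / e).
have hn : K / e < n.+1%:R by exact: truncnS_gt.
apply: le_trans (h n.+1) _; rewrite lerD2l.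
have p0 : (0 : R) < 2 ^+ n.+1 by rewrite exprn_gt0.
rewrite ler_pdivrMr// mulrC -ler_pdivrMr//; apply: (le_trans (ltW hn)).
by rewrite -natrX ler_nat ltnW// ltn_expl.
Qed.

(** The intervals of radius 2 K / 2^n around [a n] are nested: the radius drops by K / 2^n, which
    covers the step. *)
Lemma real_geometric_cvg (a : nat -> R) K : 0 <= K ->
  (forall n, `|a n.+1 - a n| <= K / 2 ^+ n) ->
  exists l, forall n, `|l - a n| <= 2 * (K / 2 ^+ n).
Proof.
move=> K0 h.
have e n : K / 2 ^+ n.+1 = K / 2 ^+ n / 2 by rewrite exprSr invfM mulrA.
have k0 n : 0 <= K / 2 ^+ n by rewrite divr_ge0// exprn_ge0.
have [p hp] := @nested_point R (fun n => a n - 2 * (K / 2 ^+ n)) (fun n => a n + 2 * (K / 2 ^+ n))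
  (fun n => ltac:(have := h n; rewrite ler_norml e; lra))
  (fun n => ltac:(have := h n; rewrite ler_norml e; lra))
  (fun n => ltac:(have := k0 n; lra)).
by exists p => n; have := hp n; rewrite ler_norml; lra.
Qed.

Lemma complex_geometric_cvg (u : nat -> C) K : 0 <= K ->
  (forall n, nrm (u n.+1 - u n) <= K / 2 ^+ n) ->
  exists l, forall n, nrm (l - u n) <= 4 * K / 2 ^+ n.
Proof.
move=> K0 h.
have hR n : `|Re (u n.+1) - Re (u n)| <= K / 2 ^+ n.
  by rewrite -ReB; apply: le_trans (h n); exact: Re_le_nrm.
have hI n : `|Im (u n.+1) - Im (u n)| <= K / 2 ^+ n.
  by rewrite -ImB; apply: le_trans (h n); exact: Im_le_nrm.
have [x hx] := real_geometric_cvg K0 hR; have [y hy] := real_geometric_cvg K0 hI.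
exists (pt x y) => n; apply: le_trans (nrm_le_ReIm _) _.
by rewrite ReB ImB /=; have := hx n; have := hy n; lra.
Qed.

(** By the Cauchy estimates for [h n.+1 - h n] the differentials converge geometrically too. Their
    limit is the differential of [g], because the second-order remainder of [h n] has a bound free
    of [n] that survives in the limit. *)
Lemma weierstrass V (h : nat -> V -> C) (p : V) (r M K : R) : 0 <= K ->
  (forall n q, nrm (q - p) < r -> differentiable (h n) q) ->
  (forall q, nrm (q - p) < r -> nrm (h 0%N q) <= M) ->
  (forall n q, nrm (q - p) < r -> nrm (h n.+1 q - h n q) <= K / 2 ^+ n) ->
  exists g : V -> C, forall q, nrm (q - p) < r ->
    differentiable g q /\ forall n, nrm (g q - h n q) <= 4 * K / 2 ^+ n.
Proof.
move=> K0 dh hM hK.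
(* The value 0 outside the ball is a default. *)
have /choice[g hg] : forall q, exists l : C, nrm (q - p) < r ->
    forall n, nrm (l - h n q) <= 4 * K / 2 ^+ n.
  move=> q; have [hq|hq] := pselect (nrm (q - p) < r); last by exists 0 => /hq.
  have [l hl] := complex_geometric_cvg K0 (fun n => hK n q hq); by exists l.
exists g => q hq; split; last exact: hg.
pose s := r - nrm (q - p).
have s0 : 0 < s by rewrite subr_gt0.
have sub v : nrm (v - q) < s -> nrm (v - p) < r.
  move=> hv; have := nrmD (v - q) (q - p); rewrite addrA subrK /s in hv *; lra.
have pow1 n : (0 : R) < 2 ^+ n by rewrite exprn_gt0.
have powle n : K / 2 ^+ n <= K.
  by rewrite ler_pdivrMr// ler_peMr// exprn_ege1// ler1n.
(* A bound common to all [h n]: both [h n] and [h 0] lie within 4 K of the limit. *)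
pose M' := M + 8 * K.
have hM' n v : nrm (v - p) < r -> nrm (h n v) <= M'.
  move=> hv; have h1 := hg v hv n; have h2 := hg v hv 0%N; have h3 := hM v hv.
  have h4 := nrmB (h n v - g v) (h 0%N v - g v).
  have h5 := nrmD (h n v - g v - (h 0%N v - g v)) (h 0%N v).
  have e5 : h n v - g v - (h 0%N v - g v) + h 0%N v = h n v by ring.
  rewrite e5 in h5; rewrite nrmC in h1; rewrite nrmC in h2.
  rewrite -!mulrA in h1 h2; have := powle n; have := powle 0%N; rewrite /M'; lra.
have hball n v : nrm (v - q) < s -> differentiable (h n) v /\ nrm (h n v) <= M'.
  by move=> /sub hv; split; [exact: dh|exact: hM'].
have T n := taylor_ball s0 (hball n).
have M'0 : 0 <= M' by apply: le_trans (hM' 0%N q hq); exact: nrm_ge0.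
have diffL n v : nrm ('d (h n.+1) q v - 'd (h n) q v) <= 32 * K * (nrm v / s) / 2 ^+ n.
  have d1 := dh n.+1 q hq; have d2 := dh n q hq.
  have hb w : nrm (w - q) < s -> differentiable (h n.+1 \- h n) w /\ nrm ((h n.+1 \- h n) w) <= K / 2 ^+ n.
    by move=> /sub hw; split; [exact: (differentiableB (dh _ _ hw) (dh _ _ hw))|exact: hK].
  have [k1 _] := taylor_ball s0 hb.
  have e1 : 'd (h n.+1 \- h n) q v = 'd (h n.+1) q v - 'd (h n) q v.
    by have /(congr1 (fun k => k v)) := diffB d1 d2.
  by rewrite -e1; apply: le_trans (k1 v) _; lra.
have vs0 (v : V) : 0 <= nrm v / s by rewrite divr_ge0 ?nrm_ge0// ltW.
have /choice[L hL] : forall v, exists l : C, forall n, nrm (l - 'd (h n) q v) <= 4 * (32 * K * (nrm v / s)) / 2 ^+ n.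
  move=> v; apply: complex_geometric_cvg => [|n]; last exact: diffL.
  by apply: mulr_ge0 (vs0 v); rewrite mulr_ge0.
have Llin : linear L.
  move=> a u v; apply/eqP; rewrite -subr_eq0; apply/eqP/nrm_eq0/eqP.
  rewrite eq_le nrm_ge0 andbT.
  pose K' := 128 * K * (nrm (a *: u + v) / s + nrm a * (nrm u / s) + nrm v / s).
  have K'0 : 0 <= K'.
    apply: mulr_ge0; first by rewrite mulr_ge0.
    apply: addr_ge0 (vs0 v); apply: addr_ge0 (vs0 _) _.
    exact: mulr_ge0 (nrm_ge0 _) (vs0 _).
  apply: (le_limP K'0) => n; rewrite add0r.
  have h1 := hL (a *: u + v) n; have h2 := hL u n; have h3 := hL v n.
  rewrite linearP in h1.
  have h4 := nrmB (L (a *: u + v) - (a *: 'd (h n) q u + 'd (h n) q v)) (a *: (L u - 'd (h n) q u) + (L v - 'd (h n) q v)).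
  have h5 := nrmD (a *: (L u - 'd (h n) q u)) (L v - 'd (h n) q v).
  rewrite nrmZ in h5.
  have e4 : L (a *: u + v) - (a *: 'd (h n) q u + 'd (h n) q v) - (a *: (L u - 'd (h n) q u) + (L v - 'd (h n) q v)) = L (a *: u + v) - (a *: L u + L v).
    by rewrite scalerBr; ring.
  rewrite e4 in h4; apply: le_trans h4 _.
  have h6 := ler_wpM2l (nrm_ge0 a) h2.
  rewrite /K'; lra.
pose LM := GRing.isLinear.Build _ _ _ _ _ Llin.
pose LL : {linear V -> C} := HB.pack L LM.
have Lb v : nrm (LL v) <= (32 * M' + 128 * K) / s * nrm v.
  have [k1 _] := T 0%N; have := k1 v; have := hL v 0%N.
  have := nrmD (L v - 'd (h 0%N) q v) ('d (h 0%N) q v).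
  rewrite subrK expr0 divr1 /=.
  have -> : (32 * M' + 128 * K) / s * nrm v = (32 * M' + 128 * K) * (nrm v / s) by rewrite mulrAC mulrA.
  lra.
(* Replacing [h n] by [g] and its differential by [L] costs a multiple of 1 / 2^n, which disappears
   in the limit. *)
have est v : nrm v <= s / 8 -> nrm (g (q + v) - g q - L v) <= 256 * M' * (nrm v / s) ^+ 2.
  move=> hv; apply: (@le_limP _ _ (8 * K + 128 * K * (nrm v / s))) => [|n].
    apply: addr_ge0; first by rewrite mulr_ge0.
    by apply: mulr_ge0 (vs0 v); rewrite mulr_ge0.
  have [_ k2] := T n; have {}k2 := k2 v hv.
  have hqv : nrm (q + v - p) < r.
    apply: sub; rewrite addrAC subrr add0r; lra.
  have h1 := hg _ hqv n; have h2 := hg q hq n; have h3 := hL v n.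
  have h4 := nrmD (g (q + v) - g q - L v - (h n (q + v) - h n q - 'd (h n) q v)) (h n (q + v) - h n q - 'd (h n) q v).
  rewrite subrK in h4.
  have e5 : g (q + v) - g q - L v - (h n (q + v) - h n q - 'd (h n) q v) =
    g (q + v) - h n (q + v) - (g q - h n q) - (L v - 'd (h n) q v) by ring.
  rewrite e5 in h4.
  have h6 := nrmB (g (q + v) - h n (q + v) - (g q - h n q)) (L v - 'd (h n) q v).
  have h7 := nrmB (g (q + v) - h n (q + v)) (g q - h n q).
  lra.
apply: (nrm_diff Lb _).1 => e e0.
pose X := 256 * M' / s ^+ 2.
have X0 : 0 <= X by exact: (divr_ge0 (mulr_ge0 (ler0n _ 256) M'0) (sqr_ge0 s)).
have X1 : 0 < X + 1 by lra.
have [|d d0 /= /and3P[d1 d2 _]] := @ex_lt_all _ [:: s / 8; e / (X + 1)].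
  by rewrite /= !divr_gt0.
exists d => [//|v hv]; apply: le_trans (est v _) _; first lra.
have -> : 256 * M' * (nrm v / s) ^+ 2 = X * nrm v * nrm v.
  by rewrite /X expr_div_n; ring.
apply: ler_wpM2r; first exact: nrm_ge0.
rewrite ltr_pdivlMr// in d2; have n0 := nrm_ge0 v.
have : X * nrm v <= X * d by apply: ler_wpM2l => //; exact: ltW.
lra.
Qed.
End Weierstrass.

(** * Hadamard's lemma *)

Section Hadamard.
Context {R : realType}.
Local Notation C := (Cplx R).
Implicit Types (V : normedModType C).

Lemma holomorphic_near_ball V (W : normedModType C) (h : V -> W) (p : V) : holomorphic_near p h ->
  exists r M : R, [/\ 0 < r, 0 <= M & forall q, nrm (q - p) < r -> differentiable h q /\ nrm (h q) <= M].
Proof.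
move=> hh; have /differentiable_continuous/continuous_nrmP/(_ 1 ltr01)[d d0 hd] := nbhs_singleton hh.
have /near_nrmP[r r0 hr] := hh.
exists (Num.min r d), (nrm (h p) + 1); split.
- by rewrite lt_min r0.
- by rewrite addr_ge0 ?nrm_ge0.
- move=> q; rewrite lt_min => /andP[q1 q2]; split; first exact: hr.
  by have := nrmD (h q - h p) (h p); rewrite subrK; have := hd q q2; lra.
Qed.

(** The differential contributes 32; for |v| / r at most 1/8 the remainder contributes 256 / 8 = 32
    more. *)
Lemma lipschitz_ball V (h : V -> C) (p : V) (r M : R) : 0 < r ->
  (forall q, nrm (q - p) < r -> differentiable h q /\ nrm (h q) <= M) ->
  forall v, nrm v <= r / 8 -> nrm (h (p + v) - h p) <= 64 * M * (nrm v / r).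
Proof.
move=> r0 hh v hv; have [k1 k2] := taylor_ball r0 hh.
have := k1 v; have := k2 v hv.
have := nrmD (h (p + v) - h p - 'd h p v) ('d h p v); rewrite subrK => h1 h2 h3.
have M0 : 0 <= M.
  by have [|_] := hh p; [rewrite subrr nrm0|apply: le_trans; exact: nrm_ge0].
have v0 : 0 <= nrm v / r by rewrite divr_ge0 ?nrm_ge0// ltW.
have v8 : nrm v / r <= 1 / 8 by rewrite ler_pdivrMr//; lra.
have : M * (nrm v / r) ^+ 2 <= M * (1 / 8 * (nrm v / r)).
  by apply: ler_wpM2l => //; rewrite expr2; apply: ler_wpM2r.
lra.
Qed.

Lemma ball_shift V (p q : V) (r s : R) : nrm (q - p) + s <= r ->
  forall v, nrm (v - q) < s -> nrm (v - p) < r.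
Proof.
move=> h v hv; have := nrmD (v - q) (q - p); rewrite addrA subrK; lra.
Qed.

(** The directional derivative is the limit of difference quotients with steps eta / 2^n. They are
    holomorphic, and the second-order remainder makes their convergence geometric, so [weierstrass]
    applies. *)
Lemma diff_holomorphic V (h : V -> C) (p : V) (r M : R) : 0 < r ->
  (forall q, nrm (q - p) < r -> differentiable h q /\ nrm (h q) <= M) ->
  forall e q, nrm (q - p) < r / 2 ->
    differentiable (fun q => 'd h q e : C) q /\ nrm ('d h q e) <= 64 * M * (nrm e / r).
Proof.
move=> r0 hh e.
have M0 : 0 <= M.
  by have [|_] := hh p; [rewrite subrr nrm0|apply: le_trans; exact: nrm_ge0].
have s0 : 0 < r / 2 by lra.
have T q : nrm (q - p) < r / 2 -> forall v, nrm (v - q) < r / 2 -> differentiable h v /\ nrm (h v) <= M.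
  by move=> hq v hv; apply/hh/(ball_shift _ hv); lra.
have bound q : nrm (q - p) < r / 2 -> nrm ('d h q e) <= 64 * M * (nrm e / r).
  move=> hq; have [k1 _] := taylor_ball s0 (T q hq); apply: le_trans (k1 e) _.
  by rewrite invfM invrK; lra.
have ne0 := nrm_ge0 e.
(* Every increment [v n] then has length at most r / 16, as [taylor_ball] with radius r / 2
   requires; the added 1 covers [e = 0]. *)
pose eta := r / (16 * (nrm e + 1)).
have e1 : 0 < 16 * (nrm e + 1) by lra.
have eta0 : 0 < eta by rewrite divr_gt0.
have etae : eta * nrm e <= r / 16.
  rewrite /eta mulrAC ler_pdivrMr//.
  have -> : r / 16 * (16 * (nrm e + 1)) = r * nrm e + r by field.
  lra.
have pow0 n : (0 : R) < 2 ^+ n by rewrite exprn_gt0.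
have pow1 n : (1 : R) <= 2 ^+ n by rewrite exprn_ege1// ler1n.
pose v n : V := (eta / 2 ^+ n)%:C *: e.
have nv n : nrm (v n) = eta * nrm e / 2 ^+ n.
  by rewrite nrmZ nrm_real ger0_norm ?divr_ge0 ?ltW// mulrAC.
have nv8 n : nrm (v n) <= r / 2 / 8.
  rewrite nv ler_pdivrMr//; apply: le_trans etae _.
  by have := pow1 n; nra.
pose q_ (n : nat) (q : V) : C := (2 ^+ n / eta)%:C * (h (q + v n) - h q).
pose K := 1024 * M * (eta * nrm e * nrm e / r / r).
have K0 : 0 <= K.
  have n1 : 0 <= eta * nrm e by exact: mulr_ge0 (ltW eta0) ne0.
  have n2 := mulr_ge0 n1 ne0.
  have n3 := divr_ge0 (divr_ge0 n2 (ltW r0)) (ltW r0).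
  by apply: mulr_ge0 n3; lra.
have est n q : nrm (q - p) < r / 2 -> nrm (q_ n q - 'd h q e) <= K / 2 ^+ n.
  move=> hq; have [_ k2] := taylor_ball s0 (T q hq).
  have {}k2 := k2 _ (nv8 n).
  have e2 : 'd h q (v n) = (eta / 2 ^+ n)%:C * 'd h q e by rewrite linearZ.
  have e3 : q_ n q - 'd h q e = (2 ^+ n / eta)%:C * (h (q + v n) - h q - 'd h q (v n)).
    rewrite e2 /q_ [RHS]mulrBr; congr (_ - _).
    rewrite mulrA -rmorphM/= (_ : 2 ^+ n / eta * (eta / 2 ^+ n) = 1) ?mul1r//.
    by field; rewrite !gt_eqF.
  have pe : 0 <= 2 ^+ n / eta := divr_ge0 (ltW (pow0 n)) (ltW eta0).
  rewrite e3 nrmM nrm_real (ger0_norm pe).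
  apply: (@le_trans _ _ (2 ^+ n / eta * (256 * M * (nrm (v n) / (r / 2)) ^+ 2))).
    exact: ler_wpM2l.
  rewrite nv /K le_eqVlt; apply/orP; left; apply/eqP.
  by field; rewrite !gt_eqF.
have hballs n q : nrm (q - p) < r / 2 -> nrm (q + v n - p) < r.
  move=> hq; have := nrmD (q - p) (v n); rewrite addrAC; have := nv8 n; lra.
have dq n q : nrm (q - p) < r / 2 -> differentiable (q_ n) q.
  move=> hq.
  have d1 : differentiable h q by apply: (hh _ _).1; lra.
  have d2 : differentiable (fun q => q + v n) q by exact: ex_diff.
  have d3 : differentiable h (q + v n) := (hh _ (hballs n q hq)).1.
  have d4 := differentiable_comp d2 d3.
  exact: (differentiableZ ((2 ^+ n / eta)%:C : C) (differentiableB d4 d1)).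
have b0 q : nrm (q - p) < r / 2 -> nrm (q_ 0%N q) <= K + 64 * M * (nrm e / r).
  move=> hq; have := est 0%N q hq; have := bound q hq.
  have := nrmD (q_ 0%N q - 'd h q e) ('d h q e); rewrite subrK expr0 divr1; lra.
have step n q : nrm (q - p) < r / 2 -> nrm (q_ n.+1 q - q_ n q) <= 2 * K / 2 ^+ n.
  move=> hq; have := est n q hq; have := est n.+1 q hq.
  have := nrmB (q_ n.+1 q - 'd h q e) (q_ n q - 'd h q e).
  have -> : q_ n.+1 q - 'd h q e - (q_ n q - 'd h q e) = q_ n.+1 q - q_ n q by ring.
  have : K / 2 ^+ n.+1 <= K / 2 ^+ n.
    by apply: ler_wpM2l => //; rewrite lef_pV2 ?posrE// exprS; have := pow0 n; lra.
  have -> : 2 * K / 2 ^+ n = K / 2 ^+ n + K / 2 ^+ n by ring.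
  lra.
have K2 : 0 <= 2 * K by lra.
have [g hg] := weierstrass K2 dq b0 step.
have gE q : nrm (q - p) < r / 2 -> g q = 'd h q e.
  move=> hq; apply/eqP; rewrite -subr_eq0; apply/eqP/nrm_eq0/eqP.
  rewrite eq_le nrm_ge0 andbT.
  have K9 : 0 <= 9 * K by lra.
  apply: (le_limP K9) => n; rewrite add0r.
  have [_ /(_ n) h1] := hg q hq; have h2 := est n q hq.
  have := nrmD (g q - q_ n q) (q_ n q - 'd h q e).
  have -> : g q - q_ n q + (q_ n q - 'd h q e) = g q - 'd h q e by ring.
  have -> : 9 * K / 2 ^+ n = 4 * (2 * K) / 2 ^+ n + K / 2 ^+ n by ring.
  lra.
move=> q hq; split; last exact: bound.
have hn : \forall z \near q, g z = 'd h z e.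
  apply/near_nrmP; exists (r / 2 - nrm (q - p)); first lra.
  by move=> z hz; apply/gE/(ball_shift _ hz); lra.
exact: (near_eq_differentiable hn (hg q hq).1).1.
Qed.

Lemma sum_double (F : nat -> C) n :
  \sum_(j < n.*2) F j = \sum_(j < n) (F j.*2 + F j.*2.+1).
Proof.
elim: n => [|n ih]; first by rewrite !big_ord0.
by rewrite doubleS !big_ord_recr/= ih addrA.
Qed.

Lemma nrm_delta_mx N (i : 'I_N) : nrm (delta_mx 0 i : 'rV[C]_N) <= 1.
Proof.
apply: nrm_rV_le => // j; rewrite mxE eqxx/=.
by case: (j == i); rewrite ?nrm1 ?nrm0.
Qed.

Lemma diff_rVE N (W : normedModType C) (h : 'rV[C]_N -> W) (q z : 'rV[C]_N) :
  'd h q z = \sum_(i < N) z 0 i *: 'd h q (delta_mx 0 i : 'rV[C]_N).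
Proof.
rewrite {1}[z]row_sum_delta linear_sum; apply: eq_bigr => i _.
by rewrite linearZ.
Qed.

Lemma nrm_sum_le (n : nat) (F : 'I_n -> C) (B : R) : (forall j, nrm (F j) <= B) ->
  nrm (\sum_(j < n) F j) <= n%:R * B.
Proof.
move=> h; apply: le_trans (ler_nrm_sum _ _ _) _.
apply: le_trans (ler_sum _ (fun j _ => h j)) _.
by rewrite sumr_const card_ord mulr_natl.
Qed.

(* The coefficients are the integrals of the partial derivatives along the segment from 0 to z,
   obtained as limits of dyadic Riemann sums. *)
Lemma hadamard N (h : 'rV[C]_N -> C) : holomorphic_near (0 : 'rV[C]_N) h ->
  exists b : 'I_N -> 'rV[C]_N -> C,
  [/\ forall i, holomorphic_near (0 : 'rV[C]_N) (b i),
      forall i, b i 0 = 'd h (0 : 'rV[C]_N) (delta_mx 0 i) &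
      \forall z \near (0 : 'rV[C]_N), h z = h 0 + \sum_(i < N) z 0 i * b i z].
Proof.
move=> /holomorphic_near_ball[r [M [r0 M0 hh]]].
pose D (i : 'I_N) (q : 'rV[C]_N) : C := 'd h q (delta_mx 0 i : 'rV[C]_N).
have hD i q : nrm q < r / 2 -> differentiable (D i) q /\ nrm (D i q) <= 64 * M / r.
  move=> hq; have hq' : nrm (q - 0) < r / 2 by rewrite subr0.
  have [k1 k2] := diff_holomorphic r0 hh (delta_mx 0 i : 'rV[C]_N) hq'.
  split=> //; apply: le_trans k2 _; rewrite mulrA ler_wpM2r ?invr_ge0 ?(ltW r0)//.
  by rewrite ler_piMr ?nrm_delta_mx// mulr_ge0.
pose M1 := 64 * M / r.
have M10 : 0 <= M1 by apply: divr_ge0 (ltW r0); rewrite mulr_ge0.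
have LD i q v : nrm q < r / 4 -> nrm v <= r / 32 ->
    nrm (D i (q + v) - D i q) <= 256 * M1 * (nrm v / r).
  move=> hq hv.
  have r4 : 0 < r / 4 by lra.
  have hb w : nrm (w - q) < r / 4 -> differentiable (D i) w /\ nrm (D i w) <= M1.
    by move=> hw; apply: hD; have := nrmD (w - q) q; rewrite subrK; lra.
  have hv' : nrm v <= r / 4 / 8 by lra.
  apply: le_trans (lipschitz_ball r4 hb hv') _.
  by rewrite invfM invrK; lra.
have pow0 n : (0 : R) < 2 ^+ n by rewrite exprn_gt0.
have pow1 n : (1 : R) <= 2 ^+ n by rewrite exprn_ege1// ler1n.
have two : 2 = (2 : R)%:C :> C by rewrite rmorph_nat.
have powC n : (2 ^ n)%:R = (2 ^+ n : R)%:C :> C by rewrite rmorphXn/= -two natrX.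
pose w (n : nat) (z : 'rV[C]_N) : 'rV[C]_N := ((2 ^+ n)^-1 : R)%:C *: z.
have nw n z : nrm (w n z) = nrm z / 2 ^+ n.
  by rewrite nrmZ nrm_real ger0_norm ?invr_ge0 ?(ltW (pow0 n))// mulrC.
have nwle n z : nrm (w n z) <= nrm z.
  by rewrite nw ler_pdivrMr// ler_peMr ?nrm_ge0.
have njw n j z : (j <= 2 ^ n)%N -> nrm ((j%:R : C) *: w n z) <= nrm z.
  move=> jn; rewrite nrmZ nw.
  have -> : nrm (j%:R : C) = j%:R.
    by rewrite (_ : (j%:R : C) = (j%:R : R)%:C) ?nrm_real ?ger0_norm// rmorph_nat.
  rewrite mulrCA ler_piMr ?nrm_ge0// ler_pdivrMr// mul1r -natrX ler_nat//.
(* The Riemann sum of [D i] at the left ends of the 2^n equal pieces of the segment from 0 to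
   [z]. *)
pose b_ i (n : nat) (z : 'rV[C]_N) : C :=
  ((2 ^+ n)^-1 : R)%:C * \sum_(j < 2 ^ n) D i ((j%:R : C) *: w n z).
have db i n z : nrm (z - 0) < r / 32 -> differentiable (b_ i n) z.
  rewrite subr0 => hz.
  have dsum : differentiable (\sum_(j < 2 ^ n) (fun z => D i ((j%:R : C) *: w n z))) z.
    apply: differentiable_sum => j.
    have d1 : differentiable (fun z => (j%:R : C) *: w n z) z.
      by rewrite /w; apply: differentiableZ; apply: differentiableZ; exact: ex_diff.
    have d2 : differentiable (D i) ((j%:R : C) *: w n z).
      by apply: (hD _ _ _).1; apply: le_lt_trans (njw _ _ _ (ltnW (ltn_ord j))) _; lra.
    exact: (differentiable_comp d1 d2).
  have := differentiableZ (((2 ^+ n)^-1 : R)%:C : C) dsum.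
  by rewrite /b_ fct_sumE.
have b0 i z : nrm (z - 0) < r / 32 -> nrm (b_ i 0%N z) <= M1.
  move=> _; rewrite /b_ expr0 invr1 mul1r expn0 big_ord1 scale0r.
  by apply: (hD _ _ _).2; rewrite nrm0; lra.
have step i n z : nrm (z - 0) < r / 32 -> nrm (b_ i n.+1 z - b_ i n z) <= 2 * M1 / 2 ^+ n.
  rewrite subr0 => hz.
  have wE : w n z = 2 *: w n.+1 z.
    rewrite /w scalerA; congr (_ *: _); rewrite two -rmorphM/=.
    by congr (_%:C); rewrite exprS invfM mulrA divff ?mul1r.
  (* The sample points of level [n] are those of even index at level [n.+1]. Only the differences
     between odd points and their left neighbours remain, and [LD] bounds each by a multiple of 1 /
     2^n. *)
  have -> : b_ i n.+1 z - b_ i n z = ((2 ^+ n.+1)^-1 : R)%:C *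
     \sum_(j < 2 ^ n) (D i ((j.*2%:R : C) *: w n.+1 z + w n.+1 z) - D i ((j.*2%:R : C) *: w n.+1 z)).
    rewrite /b_ expnS mul2n (sum_double (fun j => D i ((j%:R : C) *: w n.+1 z))).
    have -> : ((2 ^+ n)^-1 : R)%:C = ((2 ^+ n.+1)^-1 : R)%:C * 2 :> C.
      rewrite two -rmorphM/=; congr (_%:C).
      by rewrite exprS invfM mulrAC mulVf ?mul1r.
    rewrite -mulrA -mulrBr; congr (_ * _); rewrite mulr_sumr -sumrB.
    apply: eq_bigr => j _.
    have -> : (j%:R : C) *: w n z = (j.*2%:R : C) *: w n.+1 z by rewrite wE scalerA -natrM muln2.
    have -> : (j.*2.+1%:R : C) *: w n.+1 z = (j.*2%:R : C) *: w n.+1 z + w n.+1 z.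
      by rewrite -natr1 scalerDl scale1r.
    move: (D i (_ *: _)) (D i (_ + _)) => A B; ring.
  rewrite nrmM nrm_real ger0_norm ?invr_ge0 ?(ltW (pow0 _))//.
  have hs : nrm (\sum_(j < 2 ^ n) (D i ((j.*2%:R : C) *: w n.+1 z + w n.+1 z) - D i ((j.*2%:R : C) *: w n.+1 z))) <= (2 ^ n)%:R * (256 * M1 * (nrm (w n.+1 z) / r)).
    apply: nrm_sum_le => j; apply: LD.
      apply: le_lt_trans (njw _ _ _ _) _; last lra.
      by rewrite expnS mul2n leq_double ltnW.
    by apply: le_trans (nwle _ _) _; lra.
  rewrite natrX in hs.
  rewrite ler_pdivrMl//; apply: le_trans hs _.
  have -> : 2 ^+ n.+1 * (2 * M1 / 2 ^+ n) = 4 * M1.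
    by rewrite exprS; field; rewrite gt_eqF.
  rewrite nw.
  have -> : 2 ^+ n * (256 * M1 * (nrm z / 2 ^+ n.+1 / r)) = 128 * M1 * (nrm z / r).
    by rewrite exprS; field; rewrite !gt_eqF.
  have zr : nrm z / r <= 1 / 32 by rewrite ler_pdivrMr//; lra.
  have := ler_wpM2l M10 zr; lra.
have M12 : 0 <= 2 * M1 by lra.
have /choice[b hb] : forall i, exists g : 'rV[C]_N -> C, forall q, nrm (q - 0) < r / 32 ->
    differentiable g q /\ forall n, nrm (g q - b_ i n q) <= 4 * (2 * M1) / 2 ^+ n.
  by move=> i; exact: (weierstrass M12 (db i) (b0 i) (step i)).
have r32 : 0 < r / 32 by lra.
exists b; split.
- move=> i; apply/near_nrmP; exists (r / 32) => [//|z hz]; exact: (hb i z hz).1.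
- move=> i; apply/eqP; rewrite -subr_eq0; apply/eqP/nrm_eq0/eqP.
  rewrite eq_le nrm_ge0 andbT.
  have M8 : 0 <= 4 * (2 * M1) by lra.
  apply: (le_limP M8) => n; rewrite add0r.
  have z0 : nrm ((0 : 'rV[C]_N) - 0) < r / 32 by rewrite subrr nrm0.
  have := (hb i 0 z0).2 n.
  suff -> : b_ i n 0 = 'd h (0 : 'rV[C]_N) (delta_mx 0 i) by [].
  rewrite /b_ /w (eq_bigr (fun=> D i 0)); last by move=> j _; rewrite !scaler0.
  rewrite sumr_const card_ord -[D i 0 *+ _]mulr_natl mulrA.
  rewrite powC.
  by rewrite -rmorphM/= mulVf ?gt_eqF// mul1r.
- apply/near_nrmP; exists (r / 32) => [//|z hz].
  apply/eqP; rewrite -subr_eq0; apply/eqP/nrm_eq0/eqP.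
  rewrite eq_le nrm_ge0 andbT.
  pose K := M + N%:R * (r / 32 * (4 * (2 * M1))).
  have K0 : 0 <= K.
    by apply: addr_ge0 => //; apply: mulr_ge0 => //; apply: mulr_ge0; lra.
  apply: (le_limP K0) => n; rewrite add0r.
  have hz' : nrm z < r / 32 by rewrite subr0 in hz.
  (* On each piece the increment of [h] is its differential at the left end up to O(4^-n). Summed
     over 2^n pieces, the error is O(2^-n). *)
  have tel : h z - h 0 = \sum_(j < 2 ^ n) (h ((j%:R : C) *: w n z + w n z) - h ((j%:R : C) *: w n z)).
    have -> : \sum_(j < 2 ^ n) (h ((j%:R : C) *: w n z + w n z) - h ((j%:R : C) *: w n z)) =
      \sum_(0 <= j < 2 ^ n) (h ((j.+1%:R : C) *: w n z) - h ((j%:R : C) *: w n z)).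
      by rewrite big_mkord; apply: eq_bigr => j _; rewrite -natr1 scalerDl scale1r.
    rewrite telescope_sumr// scale0r; congr (h _ - _).
    rewrite /w scalerA powC.
    by rewrite -rmorphM/= mulfV ?gt_eqF// scale1r.
  have e1 : \sum_(i < N) z 0 i * b_ i n z = \sum_(j < 2 ^ n) ('d h ((j%:R : C) *: w n z) (w n z) : C).
    rewrite /b_; under eq_bigr => i _ do rewrite mulrCA mulr_sumr mulr_sumr.
    rewrite exchange_big/=; apply: eq_bigr => j _.
    move: ((j%:R : C) *: w n z) => q.
    have -> : 'd h q (w n z) = ((2 ^+ n)^-1 : R)%:C * 'd h q z by rewrite /w linearZ.
    rewrite (diff_rVE h q z) mulr_sumr; apply: eq_bigr => i _.
    by rewrite mulrCA.
  have hj (j : 'I_(2 ^ n)) : nrm (h ((j%:R : C) *: w n z + w n z) - h ((j%:R : C) *: w n z) - 'd h ((j%:R : C) *: w n z) (w n z)) <= 256 * M * (nrm (w n z) / (r / 2)) ^+ 2.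
    have r2 : 0 < r / 2 by lra.
    have hq : nrm ((j%:R : C) *: w n z) < r / 2.
      by apply: le_lt_trans (njw _ _ _ (ltnW (ltn_ord j))) _; lra.
    have hbq v : nrm (v - (j%:R : C) *: w n z) < r / 2 -> differentiable h v /\ nrm (h v) <= M.
      move=> hv; apply: hh; rewrite subr0.
      by have := nrmD (v - (j%:R : C) *: w n z) ((j%:R : C) *: w n z); rewrite subrK; lra.
    apply: (taylor_ball r2 hbq).2; apply: le_trans (nwle _ _) _; lra.
  have s1 := nrm_sum_le hj; rewrite sumrB -tel -e1 natrX nw in s1.
  have s2 : nrm (\sum_(i < N) z 0 i * b_ i n z - \sum_(i < N) z 0 i * b i z) <= N%:R * (r / 32 * (4 * (2 * M1) / 2 ^+ n)).
    rewrite -sumrB; apply: nrm_sum_le => i; rewrite -mulrBr nrmM.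
    apply: ler_pM; rewrite ?nrm_ge0//.
      by apply: le_trans (nrm_coord _ _) _; exact: ltW.
    by rewrite nrmC; exact: (hb i z hz).2.
  have := nrmD (h z - h 0 - \sum_(i < N) z 0 i * b_ i n z) (\sum_(i < N) z 0 i * b_ i n z - \sum_(i < N) z 0 i * b i z).
  rewrite addrA subrK -[_ - _ - _]addrA -opprD => h1.
  apply: le_trans h1 _.
  have -> : K / 2 ^+ n = M / 2 ^+ n + N%:R * (r / 32 * (4 * (2 * M1) / 2 ^+ n)) by rewrite /K; ring.
  apply: lerD s2; apply: le_trans s1 _.
  have -> : 2 ^+ n * (256 * M * (nrm z / 2 ^+ n / (r / 2)) ^+ 2) = 1024 * M * (nrm z / r) ^+ 2 / 2 ^+ n.
    by field; rewrite !gt_eqF.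
  rewrite ler_wpM2r ?invr_ge0 ?(ltW (pow0 n))//.
  have zr : nrm z / r <= 1 / 32 by rewrite ler_pdivrMr//; lra.
  have zr0 : 0 <= nrm z / r by apply: divr_ge0 (ltW r0); exact: nrm_ge0.
  have zr2 : (nrm z / r) ^+ 2 <= 1 / 1024.
    by have := ler_pM zr0 zr0 zr zr; rewrite -expr2; lra.
  have := ler_wpM2l M0 zr2; lra.
Qed.
End Hadamard.

(** * Inverse function theorem *)

Section InverseFunction.
Context {R : realType}.
Local Notation C := (Cplx R).
Implicit Types (V W U : normedModType C).

Lemma holomorphic_near_comp V W U (F : V -> W) (G : W -> U) (p : V) :
  holomorphic_near p F -> holomorphic_near (F p) G -> holomorphic_near p (G \o F).
Proof.
move=> hF hG; have cF := differentiable_continuous (nbhs_singleton hF).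
have h2 : \forall z \near p, differentiable G (F z) := cF _ hG.
by apply: filterS2 hF h2 => z d1 d2; exact: differentiable_comp d1 d2.
Qed.

(** Picard iteration for x = y - e(x). The contraction property of [e] comes from a bound on its
    size through the Cauchy estimates. The iterates are holomorphic in [y] and converge
    geometrically, so the limit is holomorphic by [weierstrass], one coordinate at a time. *)
Lemma inverse_near_id N (K : 'rV[C]_N -> 'rV[C]_N) :
  holomorphic_near (0 : 'rV[C]_N) K -> K 0 = 0 ->
  (forall v, 'd K (0 : 'rV[C]_N) v = v) ->
  exists G : 'rV[C]_N -> 'rV[C]_N, [/\ G 0 = 0, holomorphic_near (0 : 'rV[C]_N) G,
    \forall z \near (0 : 'rV[C]_N), G (K z) = z &
    \forall z \near (0 : 'rV[C]_N), K (G z) = z].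
Proof.
move=> hK K0 dK.
(* With [e] at most r / 256 on the ball of radius [r], [lipschitz_ball] at radius r / 2 gives the
   constant 64 * 2 / 256 = 1/2. *)
have e256 : 0 < 1 / 256 :> R by lra.
have [d d0 hd] := diff_nrm (nbhs_singleton hK) e256.
have /near_nrmP[r1 r10 hr1] := hK.
have [|r r0 /= /and3P[rd rr1 _]] := @ex_lt_all _ [:: d; r1]; first by rewrite /= d0 r10.
pose e (z : 'rV[C]_N) := K z - z.
have dife z : nrm z < r -> differentiable e z.
  move=> hz; have d1 : differentiable K z by apply: hr1; rewrite subr0; lra.
  have d2 : differentiable (id : 'rV[C]_N -> 'rV[C]_N) z by exact: ex_diff.
  exact: differentiableB d1 d2.
have smalle z : nrm z < r -> nrm (e z) <= r / 256.
  move=> hz; have hz' : nrm z < d by lra.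
  have := hd z hz'; rewrite add0r K0 subr0 dK /e; lra.
have Lip x y : nrm x < r / 32 -> nrm y < r / 32 -> nrm (e x - e y) <= 1 / 2 * nrm (x - y).
  move=> hx hy.
  apply: nrm_rV_le => [|i]; first by rewrite mulr_ge0 ?nrm_ge0//; lra.
  have r2 : 0 < r / 2 by lra.
  have hb q : nrm (q - y) < r / 2 -> differentiable (fun z => e z 0 i : C) q /\ nrm (e q 0 i : C) <= r / 256.
    move=> hq; have hq' : nrm q < r by have := nrmD (q - y) y; rewrite subrK; lra.
    split; first exact: differentiable_rV_coord (dife q hq').
    by apply: le_trans (nrm_coord _ _) _; exact: smalle.
  have hv : nrm (x - y) <= r / 2 / 8 by have := nrmB x y; lra.
  have := lipschitz_ball r2 hb hv; rewrite [y + _]addrC subrK !mxE => h1.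
  apply: le_trans h1 _; rewrite le_eqVlt; apply/orP; left; apply/eqP.
  by field; rewrite gt_eqF.
have e0 : e 0 = 0 by rewrite /e K0 subrr.
have Lip0 x : nrm x < r / 32 -> nrm (e x) <= 1 / 2 * nrm x.
  move=> hx; have h0 : nrm (0 : 'rV[C]_N) < r / 32 by rewrite nrm0; lra.
  by have := Lip x 0 hx h0; rewrite e0 !subr0.
(* The iterates satisfy |G_n y| <= 2 |y|, so |y| < r / 64 keeps them in the ball of radius r / 32
   where [e] contracts. *)
pose G_ (n : nat) (y : 'rV[C]_N) := iter n (fun x => y - e x) 0.
have GS n y : G_ n.+1 y = y - e (G_ n y) by [].
have Gb n y : nrm y < r / 64 -> nrm (G_ n y) <= 2 * nrm y /\ nrm (G_ n y) < r / 32.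
  move=> hy; suff h : nrm (G_ n y) <= 2 * nrm y by split=> //; lra.
  elim: n => [|n ih]; first by rewrite nrm0 mulr_ge0 ?nrm_ge0.
  rewrite GS; have := nrmB y (e (G_ n y)).
  have hG : nrm (G_ n y) < r / 32 by lra.
  have := Lip0 _ hG; lra.
have Gstep n y : nrm y < r / 64 -> nrm (G_ n.+1 y - G_ n y) <= r / 2 ^+ n.
  move=> hy; elim: n => [|n ih].
    by rewrite GS [G_ 0%N y]/= e0 !subr0 expr0 divr1; lra.
  rewrite GS {2}GS.
  have -> : y - e (G_ n.+1 y) - (y - e (G_ n y)) = e (G_ n y) - e (G_ n.+1 y).
    move: (e (G_ n.+1 y)) (e (G_ n y)) => A B.
    by apply/rowP => i; rewrite !mxE; ring.
  have := Lip _ _ (Gb n y hy).2 (Gb n.+1 y hy).2; rewrite [nrm (G_ n y - _)]nrmC.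
  rewrite exprSr invfM mulrA; lra.
have dG n y : nrm y < r / 64 -> differentiable (G_ n) y.
  move=> hy; elim: n => [|n ih]; first exact: (@differentiable_cst _ _ _ (0 : 'rV[C]_N)).
  have d1 : differentiable e (G_ n y) by apply: dife; have := (Gb n y hy).2; lra.
  have d2 : differentiable (id : 'rV[C]_N -> 'rV[C]_N) y by exact: ex_diff.
  exact: differentiableB d2 (differentiable_comp ih d1).
have rge0 : 0 <= r := ltW r0.
have /choice[g hg] : forall i, exists g : 'rV[C]_N -> C, forall q, nrm (q - 0) < r / 64 ->
    differentiable g q /\ forall n, nrm (g q - (G_ n q 0 i : C)) <= 4 * r / 2 ^+ n.
  move=> i; apply: (@weierstrass _ _ (fun n q => G_ n q 0 i : C) 0 (r / 64) 0 r rge0).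
  - move=> n q; rewrite subr0 => hq; exact: differentiable_rV_coord (dG n q hq).
  - by move=> q _; rewrite /= mxE nrm0.
  - move=> n q; rewrite subr0 => hq; apply: le_trans (Gstep n q hq).
    have -> : (G_ n.+1 q 0 i : C) - G_ n q 0 i = (G_ n.+1 q - G_ n q) 0 i by rewrite !mxE.
    exact: nrm_coord.
pose G (y : 'rV[C]_N) : 'rV[C]_N := \row_i g i y.
have GG n y : nrm y < r / 64 -> nrm (G y - G_ n y) <= 4 * r / 2 ^+ n.
  move=> hy; have hy' : nrm (y - 0) < r / 64 by rewrite subr0.
  apply: nrm_rV_le => [|i]; first by rewrite divr_ge0 ?exprn_ge0// mulr_ge0.
  by rewrite !mxE; exact: (hg i y hy').2.
have Gle y : nrm y < r / 64 -> nrm (G y) <= 2 * nrm y.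
  move=> hy; apply: (@le_limP _ _ _ (4 * r)) => [|n]; first lra.
  have := GG n y hy; have := (Gb n y hy).1; have := nrmD (G y - G_ n y) (G_ n y).
  rewrite subrK; lra.
have r64 : 0 < r / 64 by lra.
have KG y : nrm y < r / 64 -> K (G y) = y.
  move=> hy; apply/eqP; rewrite -subr_eq0; apply/eqP/nrm_eq0/eqP.
  rewrite eq_le nrm_ge0 andbT; apply: (@le_limP _ _ _ (4 * r)) => [|n]; first lra.
  rewrite add0r.
  have h1 : nrm (G y) < r / 32 by have := Gle y hy; lra.
  have h2 := Lip _ _ h1 (Gb n y hy).2.
  have h3 := GG n y hy; have h4 := GG n.+1 y hy.
  have h5 := nrmD (G y - G_ n.+1 y) (e (G y) - e (G_ n y)).
  have e5 : K (G y) - y = G y - G_ n.+1 y + (e (G y) - e (G_ n y)).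
    rewrite GS {2}/e opprB !addrA; apply/rowP => i; rewrite !mxE; ring.
  rewrite e5; rewrite exprSr invfM mulrA in h4; lra.
have nb0 y : nrm (y - 0) < r / 64 = (nrm y < r / 64) by rewrite subr0.
exists G; split.
- apply: nrm_eq0; apply/eqP; rewrite eq_le nrm_ge0 andbT.
  by apply: le_trans (Gle 0 _) _; rewrite nrm0 ?mulr0.
- apply/near_nrmP; exists (r / 64) => [//|y hy].
  apply: differentiable_rV => i.
  have -> : (fun z => G z 0 i : C) = g i by apply/funext => z; rewrite mxE.
  exact: (hg i y hy).1.
- apply/near_nrmP; exists (r / 128) => [|x]; first lra.
  rewrite subr0 => hx.
  have h1 : nrm x < r / 32 by lra.
  have h2 : nrm (K x) < r / 64.
    have := Lip0 x h1; have := nrmD (e x) x; rewrite {1}/e subrK; lra.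
  have h3 : nrm (G (K x)) < r / 32 by have := Gle _ h2; lra.
  (* Since [x] and [G (K x)] have the same image under [K], their distance equals that of their
     values under [e], hence is at most half of itself. *)
  have h4 := KG _ h2; have h5 := Lip _ _ h3 h1.
  apply/eqP; rewrite -subr_eq0; apply/eqP/nrm_eq0/eqP.
  rewrite eq_le nrm_ge0 andbT.
  have e5 : e (G (K x)) - e x = x - G (K x).
    by rewrite /e h4; apply/rowP => i; rewrite !mxE; ring.
  rewrite e5 [nrm (x - _)]nrmC in h5.
  by move: h5; move: (nrm _) => u; lra.
- apply/near_nrmP; exists (r / 64) => [//|y hy]; apply: KG; by rewrite -nb0.
Qed.

(** Composing [F] with the linear map [L], the differential of [F'] at 0, reduces to a map tangent
    to the identity. If [G] inverts [L \o F], then [G \o L] inverts [F]. *)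
Lemma biholomorphic_germ_of_diff N (F F' : 'rV[C]_N -> 'rV[C]_N) :
  F 0 = 0 -> F' 0 = 0 -> holomorphic_near (0 : 'rV[C]_N) F -> holomorphic_near (0 : 'rV[C]_N) F' ->
  (forall v, 'd F' (0 : 'rV[C]_N) ('d F (0 : 'rV[C]_N) v) = v) ->
  (forall v, 'd F (0 : 'rV[C]_N) ('d F' (0 : 'rV[C]_N) v) = v) ->
  biholomorphic_germ F.
Proof.
move=> F0 F'0 hF hF' d1 d2; split=> //; split=> //.
pose L : {linear 'rV[C]_N -> 'rV[C]_N} := 'd F' (0 : 'rV[C]_N).
have cL : continuous L by exact: rV_linear_continuous.
have dL z : differentiable L z by exact: linear_differentiable.
have hL p : holomorphic_near p L by apply: filterE.
pose K := L \o F.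
have hK : holomorphic_near (0 : 'rV[C]_N) K := holomorphic_near_comp hF (hL _).
have K0 : K 0 = 0 by rewrite /K /= F0 linear0.
have dK v : 'd K (0 : 'rV[C]_N) v = v.
  have /(congr1 (fun k => k v)) e1 := diff_comp (nbhs_singleton hF) (dL (F 0)).
  have /(congr1 (fun k => k ('d F (0 : 'rV[C]_N) v))) e2 := diff_lin (F 0) cL.
  by rewrite e1 /= e2; exact: d1.
have [G [G0 hG GK KG]] := inverse_near_id hK K0 dK.
exists (G \o L); split.
- by rewrite /= linear0.
- have hGL : holomorphic_near (L 0) G by rewrite linear0.
  exact: (@holomorphic_near_comp _ _ _ L G 0 (hL 0) hGL).
- exact: GK.
- have cL0 : L z @[z --> (0 : 'rV[C]_N)] --> (0 : 'rV[C]_N) by have := cL 0; rewrite /continuous_at linear0.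
  have hKG : \forall z \near (0 : 'rV[C]_N), K (G (L z)) = L z := cL0 _ KG.
  apply: filterS hKG => z hz.
  (* The two points have the same image under [L], and [L] is injective by [d2]. *)
  by rewrite -[LHS]d2 -[RHS]d2; congr ('d F _ _).
Qed.
End InverseFunction.

(** * Germs on complex spaces *)

Section HolAt.
Context {R : realType}.
Local Notation C := (Cplx R).
Implicit Types (V W U : normedModType C).

(* psi \o phi^-1 extends holomorphically near phi y; on charts this is the pointwise form of
   holomorphic_through. *)
Definition hol_at (T : topologicalType) V W (phi : T -> V) (psi : T -> W) (y : T) :=
  exists F : V -> W, holomorphic_near (phi y) F /\ \forall z \near y, psi z = F (phi z).

Lemma hol_at_comp (T : topologicalType) V W U (phi : T -> V) (psi : T -> W) (chi : T -> U) y :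
  hol_at phi psi y -> hol_at psi chi y -> hol_at phi chi y.
Proof.
move=> [F [hF eF]] [G [hG eG]]; exists (G \o F); split.
  by apply: holomorphic_near_comp hF _; rewrite -(nbhs_singleton eF).
by apply: filterS2 eF eG => z e1 e2; rewrite e2 e1.
Qed.

Lemma hol_at_pullback (T T' : topologicalType) V W (phi : T -> V) (psi : T -> W) (g : T' -> T) y :
  {for y, continuous g} -> hol_at phi psi (g y) -> hol_at (phi \o g) (psi \o g) y.
Proof. by move=> cg [F [hF eF]]; exists F; split=> //; exact: cg _ eF. Qed.

Lemma hol_at_eq (T : topologicalType) V W (phi : T -> V) (psi psi' : T -> W) y :
  (\forall z \near y, psi z = psi' z) -> hol_at phi psi y -> hol_at phi psi' y.
Proof.
by move=> e [F [hF eF]]; exists F; split=> //; apply: filterS2 e eF => z <- ->.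
Qed.

Lemma hol_at_post (T : topologicalType) V W U (phi : T -> V) (psi : T -> W) (G : W -> U) y :
  hol_at phi psi y -> holomorphic_near (psi y) G -> hol_at phi (G \o psi) y.
Proof.
move=> h hG; apply: hol_at_comp h _; exists G; split=> //; exact: filterE.
Qed.

Lemma hol_at_through (T : topologicalType) V W (D : set T) (phi : T -> V) (psi : T -> W) y :
  {for y, continuous phi} -> nbhs y D -> holomorphic_through D phi psi -> hol_at phi psi y.
Proof.
move=> cphi nD [g [hg eg]].
have [|F [hF eF]] := hg (phi y); first by exists y => //; exact: nbhs_singleton.
exists F; split=> //.
have eF' : \forall z \near y, (phi @` D) (phi z) -> g (phi z) = F (phi z) := cphi _ eF.
apply: filterS2 nD eF' => z Dz h.
by rewrite -eg// h//; exists z.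
Qed.

Variable X : topologicalType.
Implicit Types (c d : chart R X).

Lemma chart_continuous_at c y : chart_dom c y -> {for y, continuous c}.
Proof.
move=> cy; have := @chart_continuous _ _ c.
rewrite continuous_open_subspace; last exact: chart_dom_open.
by apply; rewrite inE.
Qed.

Lemma chart_inj c y z : chart_dom c y -> chart_dom c z -> c y = c z -> y = z.
Proof.
by move=> cy cz; have [_ inj _] := chart_bij c; apply: inj; rewrite inE.
Qed.

(** Injectivity of the chart makes [g] well defined on the image, with default 0 elsewhere.
    Continuity of the inverse chart turns agreement near [y] in the space into agreement near [c y]
    on the image. *)
Lemma through_hol_at W c (D : set X) (psi : X -> W) : D `<=` chart_dom c ->
  (forall y, D y -> hol_at c psi y) -> holomorphic_through D c psi.
Proof.
move=> Dc hD.
have /choice[g hg] : forall p, exists w, forall y, D y -> c y = p -> psi y = w.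
  move=> p; have [[y [Dy ey]]|no] := pselect (exists y, D y /\ c y = p).
    exists (psi y) => z Dz ez; congr (psi _); apply: (chart_inj (Dc _ Dz) (Dc _ Dy)).
    by rewrite ez.
  by exists 0 => y Dy ey; exfalso; apply: no; exists y.
exists g; split; last by move=> y Dy; rewrite -(hg _ y Dy).
move=> _ [y Dy <-]; have [F [hF eF]] := hD y Dy; exists F; split=> //.
have hinv : \forall p \near c y, chart_img c p ->
    (c @` ([set z | psi z = F (c z)] `&` chart_dom c)) p := chart_inv_continuous (Dc _ Dy) eF.
apply: filterS hinv => p hp [z Dz ez].
have [bfun _ _] := chart_bij c.
have [|z' [ez' cz'] ezz'] := hp; first by rewrite -ez; exact: bfun (Dc _ Dz).
have zz' : z' = z by apply: (chart_inj cz' (Dc _ Dz)); rewrite ezz' ez.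
by rewrite -(hg _ z Dz ez) -ez -zz'.
Qed.

Lemma compatible_hol_at c d y : compatible c d -> chart_dom c y -> chart_dom d y ->
  hol_at c d y /\ hol_at d c y.
Proof.
move=> [h1 h2] cy dy.
have n : nbhs y (chart_dom c `&` chart_dom d).
  by apply: filterI; apply: open_nbhs_nbhs; split=> //; exact: chart_dom_open.
by split; [exact: hol_at_through (chart_continuous_at cy) n h1
          |exact: hol_at_through (chart_continuous_at dy) n h2].
Qed.

(** Used to read the vanishing ideal of the image as a condition on the space itself, where
    different charts can be compared. *)
Lemma near_chart_img c x (P : set 'rV[C]_(chart_dim c)) : chart_dom c x ->
  (\forall z \near c x, chart_img c z -> P z) <-> (\forall y \near x, P (c y)).
Proof.
move=> cx; have [bfun _ _] := chart_bij c.
split.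
  move=> h; have h' := chart_continuous_at cx h.
  have n : nbhs x (chart_dom c).
    by apply: open_nbhs_nbhs; split=> //; exact: chart_dom_open.
  by apply: filterS2 n h' => y cy; apply; exact: bfun.
move=> h; have hinv : \forall z \near c x, chart_img c z ->
    (c @` ([set y | P (c y)] `&` chart_dom c)) z := chart_inv_continuous cx h.
apply: filterS hinv => z hz cz.
by have [y [Py _] <-] := hz cz.
Qed.
End HolAt.

(** * Maximal ideals and their squares read in one chart *)

Section Germs.
Context {R : realType}.
Local Notation C := (Cplx R).
Variable X : complex_space R.
Implicit Types (c d : chart R X) (x : X).

(** Membership in the maximal atlas, the condition that [is_inv_at] puts on embeddings. *)
Definition admissible c := forall d, atlas X d -> compatible c d.

Lemma admissible_hol_at c c' x : admissible c -> admissible c' ->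
  chart_dom c x -> chart_dom c' x -> hol_at c c' x.
Proof.
move=> ac ac' cx cx'; have [d ad dx] := atlas_cover x.
apply: hol_at_comp (compatible_hol_at (ac d ad) cx dx).1 _.
exact: (compatible_hol_at (ac' d ad) cx' dx).2.
Qed.

(** Germs are defined through all charts of the atlas; a single admissible chart at [x] decides, by
    the transition maps at nearby points. *)
Lemma germ_hol_at c x (h : X -> C) : admissible c -> chart_dom c x ->
  holomorphic_function_germ x h <-> hol_at c h x.
Proof.
move=> ac cx; split.
  move=> [W [oW Wx hW]]; have [d ad dx] := atlas_cover x.
  have n : nbhs x (chart_dom d `&` W).
    by apply: filterI; apply: open_nbhs_nbhs; split=> //; exact: chart_dom_open.
  apply: hol_at_comp (compatible_hol_at (ac d ad) cx dx).1 _.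
  exact: hol_at_through (chart_continuous_at dx) n (hW d ad).
move=> [F [hF eF]].
have hF' : \forall y \near x, holomorphic_near (c y) F.
  have hFF : \forall p \near c x, holomorphic_near p F by apply: near_join.
  exact: (chart_continuous_at cx) _ hFF.
have nc : nbhs x (chart_dom c).
  by apply: open_nbhs_nbhs; split=> //; exact: chart_dom_open.
(* On [W] the same [F] represents [h] near every point, so each atlas chart can be treated
   pointwise. *)
pose W := interior [set y | [/\ chart_dom c y, holomorphic_near (c y) F & h y = F (c y)]].
have Wx : W x by apply: filterS3 nc hF' eF.
exists W; split; [exact: open_interior|exact: Wx|].
move=> d ad; apply: through_hol_at => [y []//|y [dy Wy]].
have [cy Fy _] := nbhs_singleton Wy.
apply: hol_at_comp (compatible_hol_at (ac d ad) cy dy).2 _.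
by exists F; split=> //; apply: filterS Wy => z [].
Qed.

Lemma maximal_idealP c x (h : X -> C) : admissible c -> chart_dom c x ->
  maximal_ideal x h <-> hol_at c h x /\ h x = 0.
Proof.
by move=> ac cx; split=> -[h1 h2]; split; [exact/(germ_hol_at _ ac cx)| |exact/(germ_hol_at _ ac cx)|].
Qed.

Lemma space_admissible c : atlas X c -> admissible c.
Proof. by move=> ac d ad; exact: atlas_compatible. Qed.

Lemma maximal_idealZ x (k : C) (u : X -> C) : maximal_ideal x u -> maximal_ideal x (fun y => k * u y).
Proof.
have [d /space_admissible ad dx] := atlas_cover x.
move=> /(maximal_idealP _ ad dx)[hu u0]; apply/(maximal_idealP _ ad dx); split.
  apply: (hol_at_post hu (G := fun w : C => k * w)); apply: filterE => z.
  by apply: (@differentiableZ C C C id k z); exact: ex_diff.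
by rewrite u0 mulr0.
Qed.

Lemma square_near x (u v : X -> C) : (\forall y \near x, u y = v y) ->
  maximal_ideal_square x u -> maximal_ideal_square x v.
Proof.
move=> e [k [a [b [hab hu]]]]; exists k, a, b; split=> //.
by apply: filterS2 e hu => y <-.
Qed.

Lemma square_sum (I : finType) x (u : I -> X -> C) :
  (forall i, maximal_ideal_square x (u i)) -> maximal_ideal_square x (fun y => \sum_i u i y).
Proof.
move=> hu.
have h0 : maximal_ideal_square x (fun=> 0).
  exists 0%N, (fun _ _ => 0), (fun _ _ => 0); split; first by case.
  by apply: filterE => y; rewrite big_ord0.
have hD (v w : X -> C) : maximal_ideal_square x v -> maximal_ideal_square x w ->
    maximal_ideal_square x (fun y => v y + w y).
  move=> [k [a [b [hab hv]]]] [l [a' [b' [hab' hw]]]].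
  exists (k + l)%N, (fun i => match fintype.split i with inl j => a j | inr j => a' j end),
    (fun i => match fintype.split i with inl j => b j | inr j => b' j end); split.
    by move=> i; case: (fintype.split i).
  apply: filterS2 hv hw => y -> ->; rewrite big_split_ord/=; congr (_ + _).
    by apply: eq_bigr => i _; rewrite (unsplitK (inl _ i)).
  by apply: eq_bigr => i _; rewrite (unsplitK (inr _ i)).
suff h (r : seq I) : maximal_ideal_square x (fun y => \sum_(i <- r) u i y).
  exact: h.
elim: r => [|i r ih]; first by apply: square_near h0; apply: filterE => y; rewrite big_nil.
by apply: square_near (hD _ _ (hu i) ih); apply: filterE => y; rewrite big_cons.
Qed.

Lemma squareZ x (k : C) (u : X -> C) : maximal_ideal_square x u ->
  maximal_ideal_square x (fun y => k * u y).
Proof.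
move=> [n [a [b [hab hu]]]]; exists n, (fun i y => k * a i y), b; split.
  by move=> i; have [h1 h2] := hab i; split=> //; exact: maximal_idealZ.
by apply: filterS hu => y ->; rewrite mulr_sumr; apply: eq_bigr => i _; rewrite mulrA.
Qed.

Lemma squareD x (u v : X -> C) : maximal_ideal_square x u -> maximal_ideal_square x v ->
  maximal_ideal_square x (fun y => u y + v y).
Proof.
move=> hu hv; have := @square_sum bool x (fun b => if b then u else v).
have -> : (fun y => \sum_(b : bool) (if b then u else v) y) = fun y => u y + v y.
  by apply/funext => y; rewrite big_bool.
by apply; case.
Qed.

Lemma square_mul_sum (I : finType) x (a b : I -> X -> C) :
  (forall i, maximal_ideal x (a i)) -> (forall i, maximal_ideal x (b i)) ->
  maximal_ideal_square x (fun y => \sum_i a i y * b i y).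
Proof.
move=> ha hb; apply: square_sum => i.
exists 1%N, (fun=> a i), (fun=> b i); split=> //.
by apply: filterE => y; rewrite big_ord1.
Qed.

(** * Coordinates of an embedding modulo m^2 *)

Section Coordinates.
Variables (c : chart R X) (x : X).
Hypotheses (ac : admissible c) (cx : chart_dom c x) (c0 : c x = 0).
Local Notation N := (chart_dim c).
Local Notation z_ := (fun (i : 'I_N) (y : X) => c y 0 i : C).
Local Notation e_ i := (delta_mx 0 i : 'rV[C]_N).

Lemma coordinate_ideal (i : 'I_N) : maximal_ideal x (z_ i).
Proof.
apply/(maximal_idealP _ ac cx); split; last by rewrite c0 mxE.
exists (fun p : 'rV[C]_N => p 0 i : C); split; last exact: filterE.
by apply: filterE => p; exact: differentiable_coord.
Qed.

(** Hadamard's lemma writes [F] as the sum of z_i b_i, so the difference is the sum of z_i (b_i -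
    b_i(0)), in which both factors lie in the maximal ideal. *)
Lemma linear_part_square (F : 'rV[C]_N -> C) (u : X -> C) :
  holomorphic_near (0 : 'rV[C]_N) F -> F 0 = 0 -> (\forall y \near x, u y = F (c y)) ->
  maximal_ideal_square x (fun y => u y - \sum_i 'd F (0 : 'rV[C]_N) (e_ i) * z_ i y).
Proof.
move=> hF F0 uF; have [b [hb b0 hFb]] := hadamard hF.
apply: (@square_near x (fun y => \sum_i z_ i y * (b i (c y) - b i 0))).
  have hc : \forall y \near x, F (c y) = F (c x) + \sum_i c y 0 i * b i (c y).
    by rewrite -c0 in hFb; exact: (chart_continuous_at cx) _ hFb.
  apply: filterS2 uF hc => y -> ->; rewrite c0 F0 add0r -sumrB.
  by apply: eq_bigr => i _; rewrite -b0 mulrBr [b i 0 * _]mulrC.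
apply: square_mul_sum => [|i]; first exact: coordinate_ideal.
apply/(maximal_idealP _ ac cx); split; last by rewrite c0 subrr.
exists (fun p => b i p - b i 0); split; last exact: filterE.
rewrite c0; apply: filterS (hb i) => p dp.
have dc : differentiable (cst (b i 0) : 'rV[C]_N -> C) p by exact: differentiable_cst.
exact: differentiableB dp dc.
Qed.

(** The coordinates span m/m^2 by [linear_part_square], and their number is its dimension.
    Concretely, independence of the given basis [h] yields [MB *m MA = 1], and for square matrices a
    one-sided inverse is two-sided. *)
Lemma coordinates_independent : embedding_dimension x N ->
  forall l : 'I_N -> C, maximal_ideal_square x (fun y => \sum_i l i * z_ i y) ->
  forall i, l i = 0.
Proof.
move=> [h [hm hspan hind]] l hl.
have /choice[A hA] : forall i, exists a : 'I_N -> C,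
    maximal_ideal_square x (fun y => z_ i y - \sum_k a k * h k y).
  by move=> i; apply: hspan; exact: coordinate_ideal.
have /choice[B hB] : forall j, exists b : 'I_N -> C,
    maximal_ideal_square x (fun y => h j y - \sum_i b i * z_ i y).
  move=> j; have /(maximal_idealP _ ac cx)[[F [hF eF]] h0] := hm j.
  rewrite c0 in hF; exists (fun i => 'd F (0 : 'rV[C]_N) (e_ i)).
  apply: linear_part_square => //.
  by rewrite -c0 -(nbhs_singleton eF).
pose MA : 'M[C]_N := \matrix_(i, k) A i k.
pose MB : 'M[C]_N := \matrix_(j, i) B j i.
(* Turns a linear relation among the coordinates modulo m^2 into one among the [h k], whose
   coefficients must vanish. *)
have sq (v : 'I_N -> C) : maximal_ideal_square x (fun y => \sum_i v i * z_ i y) ->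
    maximal_ideal_square x (fun y => \sum_k (\sum_i v i * A i k) * h k y).
  move=> hv.
  have h1 : maximal_ideal_square x (fun y => \sum_i - v i * (z_ i y - \sum_k A i k * h k y)).
    by apply: square_sum => i; apply: squareZ; exact: hA.
  apply: square_near (squareD hv h1); apply: filterE => y.
  under [in X in _ + X]eq_bigr => i _ do rewrite mulrBr mulNr.
  rewrite sumrB sumrN addrA subrr add0r -sumrN.
  under eq_bigr => i _ do rewrite mulNr opprK mulr_sumr.
  rewrite exchange_big/=; apply: eq_bigr => k _; rewrite mulr_suml.
  by apply: eq_bigr => i _; rewrite mulrA.
have BA : MB *m MA = 1%:M.
  apply/matrixP => j k; rewrite !mxE.
  apply/eqP; rewrite eq_sym -subr_eq0; apply/eqP.
  pose l' k := ((j == k)%:R - \sum_i B j i * A i k : C).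
  rewrite (_ : _ - _ = l' k); last first.
    by rewrite /l'; congr (_ - _); apply: eq_bigr => i _; rewrite !mxE.
  apply: hind; rewrite /l'.
  have h1 : maximal_ideal_square x (fun y => \sum_i B j i * (z_ i y - \sum_k A i k * h k y)).
    by apply: square_sum => i; apply: squareZ; exact: hA.
  apply: square_near (squareD (hB j) h1); apply: filterE => y.
  under [RHS]eq_bigr => i _ do rewrite mulrBl.
  rewrite sumrB.
  have -> : \sum_i (j == i)%:R * h i y = h j y.
    rewrite (bigD1 j)//= eqxx mul1r big1 ?addr0// => i ij.
    by rewrite eq_sym (negbTE ij) mul0r.
  under [X in _ + X = _]eq_bigr => i _ do rewrite mulrBr.
  rewrite sumrB addrA subrK; congr (_ - _).
  under eq_bigr => i _ do rewrite mulr_sumr.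
  rewrite exchange_big/=; apply: eq_bigr => i _; rewrite mulr_suml.
  by apply: eq_bigr => m _; rewrite mulrA.
have AB := mulmx1C BA.
pose L : 'rV[C]_N := \row_i l i.
have LA : L *m MA = 0.
  apply/rowP => k; rewrite !mxE.
  apply: etrans (hind _ (sq _ hl) k).
  by apply: eq_bigr => i _; rewrite !mxE.
have L0 : L = 0 by rewrite -[L]mulmx1 -AB mulmxA LA mul0mx.
by move=> i; have /rowP/(_ i) := L0; rewrite !mxE.
Qed.

Lemma vanishing_diff0 (F : 'rV[C]_N -> C) : embedding_dimension x N ->
  holomorphic_near (0 : 'rV[C]_N) F -> (\forall y \near x, F (c y) = 0) ->
  forall v, 'd F (0 : 'rV[C]_N) v = 0.
Proof.
move=> eN hF F0 v.
have F00 : F 0 = 0 by rewrite -c0 (nbhs_singleton F0).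
have F0' : \forall y \near x, (fun=> 0 : C) y = F (c y) by apply: filterS F0 => y ->.
have h1 := squareZ (-1) (linear_part_square hF F00 F0').
have h2 : forall i, 'd F (0 : 'rV[C]_N) (e_ i) = 0.
  apply: (coordinates_independent eN); apply: square_near h1; apply: filterE => y.
  by rewrite sub0r mulN1r opprK.
by rewrite diff_rVE big1// => i _; rewrite h2 scaler0.
Qed.
End Coordinates.
End Germs.

(** * Uniqueness *)

Section Comparison.
Context {R : realType}.
Local Notation C := (Cplx R).

(** When x = 0 the left side is -oo; when x > 0 the hypothesis forces y > 0 and both logarithms are
    finite. *)
Lemma half_lne_le (x y K : R) : 0 <= x -> 0 < K -> x <= K * y ->
  ((2^-1)%:E * lne x%:E <= (2^-1)%:E * lne y%:E + (2^-1 * ln K)%:E)%E.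
Proof.
move=> x0 K0 xKy; rewrite /lne.
have [x0'|xpos] := leP x 0; first by rewrite gt0_muleNy ?leNye// lte_fin invr_gt0.
have ypos : 0 < y by rewrite -(pmulr_rgt0 y K0); apply: lt_le_trans xKy.
rewrite (leNgt y 0) ypos/= -!EFinM -EFinD lee_fin -mulrDr ler_pM2l ?invr_gt0//.
rewrite addrC -lnM ?posrE// ler_ln ?posrE//.
exact: mulr_gt0.
Qed.

(** Holomorphic coefficients are bounded near [p], and each |v_k| is at most the square root of the
    sum on the right. *)
Lemma sum_sqr_le (V : normedModType C) (p : V) m n (u : 'I_m -> V -> C) (v : 'I_n -> V -> C)
    (a : 'I_m -> 'I_n -> V -> C) :
  (forall j k, holomorphic_near p (a j k)) ->
  (forall j, \forall z \near p, u j z = \sum_k a j k z * v k z) ->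
  exists2 K : R, 0 < K & \forall z \near p,
    \sum_j nrm (u j z) ^+ 2 <= K * \sum_k nrm (v k z) ^+ 2.
Proof.
move=> ha hu.
have /choice[A hA] : forall jk : 'I_m * 'I_n, exists A : R, 0 <= A /\ \forall z \near p, nrm (a jk.1 jk.2 z) <= A.
  move=> [j k]; have [r [M [r0 M0 h]]] := holomorphic_near_ball (ha j k).
  by exists M; split=> //; apply/near_nrmP; exists r => // z /h[].
pose B := \sum_jk A jk.
have B0 : 0 <= B by apply: sumr_ge0 => jk _; exact: (hA jk).1.
have AB jk : A jk <= B.
  by rewrite /B (bigD1 jk)//= lerDl; apply: sumr_ge0 => jk' _; exact: (hA jk').1.
(* The first term comes from |u_j| <= n B s. The added 1 keeps the constant positive, as its
   logarithm requires, even when [m], [n] or [B] is 0. *)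
exists (m%:R * (n%:R * B) ^+ 2 + 1); first by rewrite ltr_wpDl// mulr_ge0 ?sqr_ge0.
have h1 : \forall z \near p, forall jk : 'I_m * 'I_n, nrm (a jk.1 jk.2 z) <= A jk.
  by apply: filter_forall => jk; exact: (hA jk).2.
have h2 : \forall z \near p, forall j, u j z = \sum_k a j k z * v k z.
  by apply: filter_forall.
apply: filterS2 h1 h2 => z haz huz.
set S := \sum_k nrm (v k z) ^+ 2.
have S0 : 0 <= S by apply: sumr_ge0 => k _; exact: sqr_ge0.
pose s := Num.sqrt S.
have s0 : 0 <= s by exact: sqrtr_ge0.
have ss : s ^+ 2 = S by exact: sqr_sqrtr.
have vs k : nrm (v k z) <= s.
  rewrite -(@ler_pXn2r _ 2) ?nnegrE ?nrm_ge0// ss.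
  by rewrite /S (bigD1 k)//= lerDl; apply: sumr_ge0 => k' _; exact: sqr_ge0.
have us j : nrm (u j z) <= n%:R * B * s.
  rewrite huz -mulrA; apply: nrm_sum_le => k; rewrite nrmM.
  by apply: ler_pM; rewrite ?nrm_ge0//; exact: le_trans (haz (j, k)) (AB _).
have -> : (m%:R * (n%:R * B) ^+ 2 + 1) * S = m%:R * (n%:R * B * s) ^+ 2 + S.
  by rewrite -ss; ring.
have : \sum_j nrm (u j z) ^+ 2 <= \sum_(j < m) (n%:R * B * s) ^+ 2.
  apply: ler_sum => j _; rewrite lerXn2r ?nnegrE ?nrm_ge0//.
  by apply: le_trans (us j); exact: nrm_ge0.
rewrite sumr_const card_ord -mulr_natl; lra.
Qed.

Lemma phi_gen_le N m n (u : 'I_m -> 'rV[C]_N -> C) (v : 'I_n -> 'rV[C]_N -> C)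
  (K : R) (z w : 'rV[C]_N) : 0 < K ->
  \sum_j nrm (u j w) ^+ 2 <= K * \sum_k nrm (v k z) ^+ 2 ->
  (phi_gen u w <= phi_gen v z + (2^-1 * ln K)%:E)%E.
Proof.
move=> K0 h; apply: half_lne_le => //; apply: sumr_ge0 => j _; exact: sqr_ge0.
Qed.

(** The pullbacks by [H] of the generators of [J] and the generators of [I] are combinations of each
    other with holomorphic coefficients, so the two sums of squares bound each other up to
    constants, which the logarithm makes additive. *)
Lemma singularity_equiv_generators N m n (I J : set ('rV[C]_N -> C)) (H : 'rV[C]_N -> 'rV[C]_N)
   (g : 'I_m -> 'rV[C]_N -> C) (g' : 'I_n -> 'rV[C]_N -> C) (phi phi' : 'rV[C]_N -> \bar R) :
  holomorphic_near (0 : 'rV[C]_N) H -> H 0 = 0 ->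
  generates I g -> generates J g' ->
  (forall h, J h -> I (h \o H)) ->
  (forall h, I h -> exists2 k, J k & \forall z \near (0 : 'rV[C]_N), h z = k (H z)) ->
  (\forall z \near (0 : 'rV[C]_N), phi z = phi_gen g z) ->
  (\forall z \near (0 : 'rV[C]_N), phi' z = phi_gen g' z) ->
  singularity_equiv phi (phi' \o H).
Proof.
move=> hH H0 [Ig genI] [Jg' genJ] JI IJ ephi ephi'.
have cH : forall P : set 'rV[C]_N, (\forall z \near (0 : 'rV[C]_N), P z) ->
    \forall z \near (0 : 'rV[C]_N), P (H z).
  move=> P hP; have {}hP : \forall z \near H 0, P z by rewrite H0.
  exact: differentiable_continuous (nbhs_singleton hH) _ hP.
have /choice[a ha] := fun j => genI _ (JI _ (Jg' j)).
have [K1 K10 hK1] := @sum_sqr_le _ 0 _ _ (fun j => g' j \o H) g a (fun j => (ha j).1) (fun j => (ha j).2).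
have /choice[b hb] : forall k, exists b : 'I_n -> 'rV[C]_N -> C,
    (forall j, holomorphic_near (0 : 'rV[C]_N) (b j)) /\
    \forall z \near (0 : 'rV[C]_N), g k z = \sum_(j < n) b j z * g' j (H z).
  move=> k; have [h Jh eh] := IJ _ (Ig k); have [b [hb eb]] := genJ _ Jh.
  exists (fun j => b j \o H); split.
    by move=> j; apply: holomorphic_near_comp hH _; rewrite H0.
  by apply: filterS2 eh (cH _ eb) => z -> ->.
have [K2 K20 hK2] := @sum_sqr_le _ 0 _ _ g (fun j => g' j \o H) b (fun j => (hb j).1) (fun j => (hb j).2).
exists (Num.max (2^-1 * ln K1) (2^-1 * ln K2)).
have h1 : \forall z \near (0 : 'rV[C]_N),
  \sum_j nrm (g' j (H z)) ^+ 2 <= K1 * \sum_k nrm (g k z) ^+ 2 := hK1.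
have h2 : \forall z \near (0 : 'rV[C]_N),
  \sum_k nrm (g k z) ^+ 2 <= K2 * \sum_j nrm (g' j (H z)) ^+ 2 := hK2.
have h3 : \forall z \near (0 : 'rV[C]_N), phi z = phi_gen g z /\ phi' (H z) = phi_gen g' (H z).
  exact: filterI ephi (cH _ ephi').
apply: filterS3 h1 h2 h3 => z z1 z2 [-> /= ->]; split.
  apply: le_trans (phi_gen_le K20 z2) _.
  by apply: leeD2l; rewrite lee_fin le_max lexx orbT.
apply: le_trans (phi_gen_le K10 z1) _.
by apply: leeD2l; rewrite lee_fin le_max lexx.
Qed.
End Comparison.

Section Uniqueness.
Context {R : realType}.
Local Notation C := (Cplx R).

(** The dimensions stay distinct in the statement because they belong to different charts; mutually
    inverse differentials force them to be equal. The clause on [h \o G] ranges over all left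
    inverse germs because the inverse of [F] appears only inside the proof: [F'] is known to invert
    [F] to first order only. *)
Lemma inv_transport (inv : forall N, psh_germ R N -> \bar R) N N' (hinv : singularity_invariant inv)
   m n (I : set ('rV[C]_N -> C)) (J : set ('rV[C]_N' -> C))
   (F : 'rV[C]_N -> 'rV[C]_N') (F' : 'rV[C]_N' -> 'rV[C]_N)
   (g : 'I_m -> 'rV[C]_N -> C) (g' : 'I_n -> 'rV[C]_N' -> C) (phi : psh_germ R N) (phi' : psh_germ R N') :
  F 0 = 0 -> F' 0 = 0 -> holomorphic_near (0 : 'rV[C]_N) F -> holomorphic_near (0 : 'rV[C]_N') F' ->
  (forall v, 'd F' (0 : 'rV[C]_N') ('d F (0 : 'rV[C]_N) v) = v) ->
  (forall v, 'd F (0 : 'rV[C]_N) ('d F' (0 : 'rV[C]_N') v) = v) ->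
  generates I g -> generates J g' ->
  (forall h, J h -> I (h \o F)) ->
  (forall h, I h -> forall G : 'rV[C]_N' -> 'rV[C]_N, G 0 = 0 -> holomorphic_near (0 : 'rV[C]_N') G ->
     (\forall z \near (0 : 'rV[C]_N), G (F z) = z) -> J (h \o G)) ->
  (\forall z \near (0 : 'rV[C]_N), sval phi z = phi_gen g z) ->
  (\forall z \near (0 : 'rV[C]_N'), sval phi' z = phi_gen g' z) ->
  inv N phi = inv N' phi'.
Proof.
move=> F0 F'0 hF hF' d1 d2 gI gJ JI IJ ephi ephi'.
have NN' : N = N'.
  pose A := lin1_mx ('d F (0 : 'rV[C]_N)); pose B := lin1_mx ('d F' (0 : 'rV[C]_N')).
  have AB : A *m B = 1%:M.
    by apply/row_matrixP => i; rewrite rowE mulmxA !mul_rV_lin1 d1 row1.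
  have BA : B *m A = 1%:M.
    by apply/row_matrixP => i; rewrite rowE mulmxA !mul_rV_lin1 d2 row1.
  by apply/eqP; rewrite eqn_leq (mulmx1_min AB) (mulmx1_min BA).
subst N'.
have bF := biholomorphic_germ_of_diff F0 F'0 hF hF' d1 d2.
apply: (hinv.2 _ _ _ _ bF).
apply: (singularity_equiv_generators hF F0 gI gJ JI _ ephi ephi') => h Ih.
have [_ [_ [G [G0 hG GF FG]]]] := bF.
exists (h \o G); first exact: IJ.
by apply: filterS GF => z /= ->.
Qed.

Variable X : complex_space R.

Lemma chart_transition (c c' : chart R X) x : admissible c -> admissible c' ->
  chart_dom c x -> chart_dom c' x -> c x = 0 -> c' x = 0 ->
  exists F : 'rV[C]_(chart_dim c) -> 'rV[C]_(chart_dim c'),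
   [/\ F 0 = 0, holomorphic_near (0 : 'rV[C]_(chart_dim c)) F & \forall y \near x, c' y = F (c y)].
Proof.
move=> ac ac' cx cx' c0 c0'; have [F [hF eF]] := admissible_hol_at ac ac' cx cx'.
exists F; split; [by rewrite -c0 -(nbhs_singleton eF)|by rewrite c0 in hF|exact: eF].
Qed.

Lemma diff_rV_coord (V : normedModType C) N (f : V -> 'rV[C]_N) (p v : V) (i : 'I_N) :
  differentiable f p -> 'd (fun z => f z 0 i : C) p v = 'd f p v 0 i.
Proof.
move=> df.
have clin : linear (fun w : 'rV[C]_N => w 0 i : C) by move=> a u w; rewrite !mxE.
pose cM := GRing.isLinear.Build _ _ _ _ _ clin.
pose cL : {linear 'rV[C]_N -> C} := HB.pack (fun w : 'rV[C]_N => w 0 i : C) cM.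
have cc : continuous cL by exact: rV_linear_continuous.
have /(congr1 (fun k => k v)) e1 := diff_comp df (linear_differentiable (f p) cc).
have /(congr1 (fun k => k ('d f p v))) e2 := diff_lin (f p) cc.
exact: etrans e1 e2.
Qed.

Lemma transition_diffK (c c' : chart R X) x
   (F : 'rV[C]_(chart_dim c) -> 'rV[C]_(chart_dim c'))
   (F' : 'rV[C]_(chart_dim c') -> 'rV[C]_(chart_dim c)) :
  admissible c -> chart_dom c x -> c x = 0 -> embedding_dimension x (chart_dim c) ->
  F 0 = 0 -> holomorphic_near (0 : 'rV[C]_(chart_dim c)) F ->
  holomorphic_near (0 : 'rV[C]_(chart_dim c')) F' ->
  (\forall y \near x, c' y = F (c y)) -> (\forall y \near x, c y = F' (c' y)) ->
  forall v, 'd F' (0 : 'rV[C]_(chart_dim c')) ('d F (0 : 'rV[C]_(chart_dim c)) v) = v.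
Proof.
move=> ac cx c0 ec F0 hF hF' e e' v; apply/rowP => i.
(* One coordinate at a time, since [vanishing_diff0] concerns scalar germs. *)
pose k (p : 'rV[C]_(chart_dim c)) : C := ((F' \o F) \- id) p 0 i.
have hFF : holomorphic_near (0 : 'rV[C]_(chart_dim c)) (F' \o F).
  by apply: holomorphic_near_comp hF _; rewrite F0.
have dFF := nbhs_singleton hFF.
have did p : differentiable (id : 'rV[C]_(chart_dim c) -> 'rV[C]_(chart_dim c)) p by exact: ex_diff.
have hk : holomorphic_near (0 : 'rV[C]_(chart_dim c)) k.
  by apply: filterS hFF => p dp; apply: differentiable_rV_coord; exact: differentiableB dp (did p).
have k0 : \forall y \near x, k (c y) = 0.
  by apply: filterS2 e e' => y e1 e2; rewrite /k /= -e1 -e2 subrr mxE.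
have dd := differentiableB dFF (did 0).
have := vanishing_diff0 ac cx c0 ec hk k0 v.
rewrite [X in X = _](diff_rV_coord v i dd).
have /(congr1 (fun k => k v)) e1 := diffB dFF (did 0).
have dF' : differentiable F' (F 0) by rewrite F0; exact: nbhs_singleton hF'.
have /(congr1 (fun k => k v)) e2 := diff_comp (nbhs_singleton hF) dF'.
have e3 : 'd (id : 'rV[C]_(chart_dim c) -> _) (0 : 'rV[C]_(chart_dim c)) v = v.
  by have [_ ->] := is_diff_id (0 : 'rV[C]_(chart_dim c)).
have -> : 'd (F' \o F \- id) (0 : 'rV[C]_(chart_dim c)) v =
    'd F' (0 : 'rV[C]_(chart_dim c')) ('d F (0 : 'rV[C]_(chart_dim c)) v) - v.
  have e2' : 'd (F' \o F) (0 : 'rV[C]_(chart_dim c)) v =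
    'd F' (F 0) ('d F (0 : 'rV[C]_(chart_dim c)) v) := e2.
  rewrite F0 in e2'; rewrite -e2' -[X in _ - X]e3; exact: e1.
by rewrite !mxE => /eqP; rewrite subr_eq0 => /eqP.
Qed.

Lemma is_inv_at_unique (inv : forall N, psh_germ R N -> \bar R) (hinv : singularity_invariant inv)
  x v w : is_inv_at inv X x v -> is_inv_at inv X x w -> v = w.
Proof.
move=> [c [ac _ cx c0 [ec [m [g [phi [gg ephi ->]]]]]]].
move=> [c' [ac' _ cx' c0' [ec' [n [g' [phi' [gg' ephi' ->]]]]]]].
have {}ac : admissible c by move=> d /ac.
have {}ac' : admissible c' by move=> d /ac'.
have [F [F0 hF eF]] := chart_transition ac ac' cx cx' c0 c0'.
have [F' [F'0 hF' eF']] := chart_transition ac' ac cx' cx c0' c0.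
have d1 := transition_diffK ac cx c0 ec F0 hF hF' eF eF'.
have d2 := transition_diffK ac' cx' c0' ec' F'0 hF' hF eF' eF.
have vanP (e : chart R X) (ex : chart_dom e x) (e0 : e x = 0) (h : 'rV[C]_(chart_dim e) -> C) :
    vanishing_ideal (chart_img e) h <->
    holomorphic_near (0 : 'rV[C]_(chart_dim e)) h /\ \forall y \near x, h (e y) = 0.
  by rewrite /vanishing_ideal/=; have := near_chart_img (fun z => h z = 0) ex; rewrite e0 => ->.
apply: (inv_transport hinv F0 F'0 hF hF' d1 d2 gg gg' _ _ ephi ephi').
- move=> h /(vanP _ cx' c0')[hh h0]; apply/(vanP _ cx c0); split.
    by apply: holomorphic_near_comp hF _; rewrite F0.
  by apply: filterS2 eF h0 => y /= <-.
(* At points of the space [G] sends [c' y = F (c y)] back to [c y], where [h] vanishes. *)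
- move=> h /(vanP _ cx c0)[hh h0] G G0 hG GF; apply/(vanP _ cx' c0'); split.
    by apply: holomorphic_near_comp hG _; rewrite G0.
  have cGF : \forall y \near x, G (F (c y)) = c y.
    by rewrite -c0 in GF; exact: (chart_continuous_at cx) _ GF.
  by apply: filterS3 eF h0 cGF => y /= -> h1 ->.
Qed.
End Uniqueness.

(** * Transport along a biholomorphic map *)

Section Transport.
Context {R : realType}.
Local Notation C := (Cplx R).

Lemma holomorphic_map_hol_at (X Y : complex_space R) (f : X -> Y) c d x :
  holomorphic_map f -> atlas X c -> atlas Y d -> chart_dom c x -> chart_dom d (f x) ->
  hol_at c (d \o f) x.
Proof.
move=> [cf hf] ac ad cx dx; apply: hol_at_through (chart_continuous_at cx) _ (hf c d ac ad).
apply: filterI; first by apply: open_nbhs_nbhs; split=> //; exact: chart_dom_open.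
by apply: cf; apply: open_nbhs_nbhs; split=> //; exact: chart_dom_open.
Qed.

Lemma maximal_ideal_pullback (X Y : complex_space R) (f : X -> Y) x (u : Y -> C) :
  holomorphic_map f -> maximal_ideal (f x) u -> maximal_ideal x (u \o f).
Proof.
move=> hf; have [d ad dy] := atlas_cover (f x); have [c ac cx] := atlas_cover x.
move=> /(maximal_idealP _ (space_admissible ad) dy)[hu u0].
apply/(maximal_idealP _ (space_admissible ac) cx); split=> //.
apply: hol_at_comp (holomorphic_map_hol_at hf ac ad cx dy) _.
exact: hol_at_pullback (hf.1 x) hu.
Qed.

Lemma square_pullback (X Y : complex_space R) (f : X -> Y) x (u : Y -> C) :
  holomorphic_map f -> maximal_ideal_square (f x) u -> maximal_ideal_square x (u \o f).
Proof.
move=> hf [k [a [b [hab hu]]]].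
exists k, (fun i => a i \o f), (fun i => b i \o f); split.
  by move=> i; split; apply: maximal_ideal_pullback => //; [exact: (hab i).1|exact: (hab i).2].
exact: hf.1 x _ hu.
Qed.

Variables (X Y : complex_space R) (f : X -> Y) (g : Y -> X).
Hypotheses (fK : cancel f g) (gK : cancel g f).
Hypotheses (hf : holomorphic_map f) (hg : holomorphic_map g).

Lemma embedding_dimension_transport x N :
  embedding_dimension x N -> embedding_dimension (f x) N.
Proof.
move=> [h [hm hspan hind]].
have gfx : g (f x) = x := fK x.
exists (fun i => h i \o g); split.
- by move=> i; apply: maximal_ideal_pullback hg _; rewrite gfx.
- move=> u /(maximal_ideal_pullback hf)/hspan[c hc]; exists c.
  rewrite -gfx in hc; apply: square_near (square_pullback hg hc).
  by apply: filterE => y /=; rewrite gK.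
- move=> c hc; apply: hind.
  apply: square_near (square_pullback hf hc).
  by apply: filterE => y /=; apply: eq_bigr => i _; rewrite fK.
Qed.

Variable c : chart R X.

Lemma transport_dom_open : open (g @^-1` chart_dom c).
Proof. by move: hg.1 => /continuousP; apply; exact: chart_dom_open. Qed.

Lemma transport_bij : set_bij (g @^-1` chart_dom c) (chart_img c) (c \o g).
Proof.
have [bfun binj bsurj] := chart_bij c; split.
- by move=> y /= cy; exact: bfun.
- move=> y z; rewrite !inE/= => cy cz e.
  by rewrite -(gK y) -(gK z) (chart_inj cy cz e).
- move=> p /bsurj[x cx <-]; exists (f x) => /=; first by rewrite fK.
  by rewrite fK.
Qed.

Lemma transport_continuous : {within g @^-1` chart_dom c, continuous (c \o g)}.
Proof.
rewrite continuous_open_subspace; last exact: transport_dom_open.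
move=> y; rewrite inE/= => cy.
by apply: continuous_comp; [exact: hg.1|exact: chart_continuous_at].
Qed.

Lemma transport_inv_continuous y : (g @^-1` chart_dom c) y -> forall V, nbhs y V ->
  within (chart_img c) (nbhs ((c \o g) y)) ((c \o g) @` (V `&` (g @^-1` chart_dom c))).
Proof.
move=> /= cy V nV; have nV' : nbhs (g y) (f @^-1` V).
  by apply: hf.1; rewrite gK.
have hinv : \forall p \near c (g y), chart_img c p ->
    (c @` ((f @^-1` V) `&` chart_dom c)) p := chart_inv_continuous cy nV'.
apply: filterS hinv => p hp /hp[x [Vx cx] <-].
by exists (f x) => /=; rewrite fK.
Qed.

(** Ambient domain and image are those of [c]; only the map changes. Hence the vanishing ideal, its
    generators and the plurisubharmonic germ are literally the same for [X] and for [Y]. *)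
Definition transport_chart : chart R Y :=
  Chart transport_dom_open (@chart_ambient_open _ _ c) (chart_img_analytic c)
    transport_bij transport_continuous transport_inv_continuous.

Lemma transport_compatible : admissible c -> admissible transport_chart.
Proof.
move=> ac d ad.
have key y : chart_dom transport_chart y -> chart_dom d y ->
   hol_at transport_chart d y /\ hol_at d transport_chart y.
  (* Holomorphy of [f] and [g] is stated in atlas charts only, while [c] is merely admissible; the
     atlas chart [e] at [g y] mediates. *)
  move=> /= cy dy; have [e ae ey] := atlas_cover (g y).
  have [h1 h2] := compatible_hol_at (ac e ae) cy ey.
  have gy : {for y, continuous g} := hg.1 y.
  have dfy : chart_dom d (f (g y)) by rewrite gK.
  split.
    have h3 := hol_at_comp h1 (holomorphic_map_hol_at hf ae ad ey dfy).
    apply: hol_at_eq (hol_at_pullback gy h3); apply: filterE => z /=.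
    by rewrite gK.
  apply: hol_at_comp (holomorphic_map_hol_at hg ad ae dy ey) _.
  exact: hol_at_pullback gy h2.
split; apply: through_hol_at.
- by move=> y [].
- by move=> y [cy dy]; exact: (key y cy dy).1.
- by move=> y [].
- by move=> y [cy dy]; exact: (key y cy dy).2.
Qed.
End Transport.

Lemma is_inv_at_transport (R : realType) (inv : forall N, psh_germ R N -> \bar R)
  (X Y : complex_space R) (f : X -> Y) (x : X) v :
  biholomorphic_map f -> is_inv_at inv X x v -> is_inv_at inv Y (f x) v.
Proof.
move=> [hf [g [fK gK hg]]] [c [ac conn cx c0 [ec hphi]]].
exists (transport_chart fK gK hf hg c); split.
- exact: transport_compatible.
- exact: conn.
- by rewrite /= fK.
- by rewrite /= fK.
- by split; [exact: (embedding_dimension_transport fK gK hf hg)|exact: hphi].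
Qed.

(* The second conjunct: the number inv(X, x) does not depend on the choices. *)
Theorem theorem6p1 (R : realType) (inv : forall N : nat, psh_germ R N -> \bar R)
    (hinv : singularity_invariant inv) (X Y : complex_space R) (f : X -> Y)
    (hf : biholomorphic_map f) (x : X) :
  inv_at inv X x = inv_at inv Y (f x) /\
  (forall v : \bar R, is_inv_at inv X x v -> v = inv_at inv X x).
Proof.
split; last first.
  move=> v hv; apply: (is_inv_at_unique hinv hv).
  exact: (getI (P := [set v | is_inv_at inv X x v]) hv).
(* Equal sets have equal [get], so it suffices to carry the admissible data along [f] and along its
   inverse. *)
rewrite /inv_at; congr get; apply/seteqP; split=> v /=.
  exact: is_inv_at_transport.
have [hf' [g [fK gK hg]]] := hf.
have bg : biholomorphic_map g by split=> //; exists f.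
by move=> /(is_inv_at_transport bg); rewrite fK.
Qed.
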